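(* Let $S_j$, $j=1,2,3$, be self-adjoint and regular operators in the Hilbert-$B$-module $E$. Assume that $(S_1,S_2)$, $(S_2,S_3)$, $(S_1,S_3)$ are weakly anticommuting pairs. Then $S_1+S_2$ (on $\mathcal D(S_1)\cap\mathcal D(S_2)$) and $S_3$ are weakly anticommuting and hence $S_1+S_2+S_3$ is self-adjoint and regular on $\mathcal D(S_1)\cap\mathcal D(S_2)\cap\mathcal D(S_3)$.
   Context: $B$ is a $C^*$-algebra and $E$ a Hilbert-$C^*$-module over $B$ with $B$-valued inner product $\langle\cdot,\cdot\rangle$; inequalities between elements of $B$ are in the order of $B$. $\mathcal D(S)$ denotes the domain of $S$. A self-adjoint operator $S$ in $E$ is regular if $S\pm\lambda$ has dense range for one (hence all) $\lambda\in\mathbb C\setminus\mathbb R$. A core is a submodule of the domain dense in the graph norm. For self-adjoint regular $S,T$ in $E$ put $\mathcal F(S,T)=\{x\in\mathcal D(S)\cap\mathcal D(T): Sx\in\mathcal D(T),\ Tx\in\mathcal D(S)\}$ and $[S,T]=ST+TS$ on $\mathcal F(S,T)$. The pair $(S,T)$ is weakly anticommuting if (1) there are constants $C_0,C_1,C_2>0$ such that for all $x\in\mathcal F(S,T)$: $\langle[S,T]x,[S,T]x\rangle\le C_0\langle x,x\rangle+C_1\langle Sx,Sx\rangle+C_2\langle Tx,Tx\rangle$ in $B$; and (2) there are a core $\mathcal E\subset\mathcal D(T)$ for $T$ and $\lambda_0>0$ such that $(S+\lambda)^{-1}(\mathcal E)\subset\mathcal F(S,T)$ for all $\lambda\in i\mathbb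 R$, $|\lambda|\ge\lambda_0$. *)

(* Defs.v *)
From HB Require Import structures.
From mathcomp Require Import all_boot all_order all_algebra complex.
From mathcomp Require Import all_classical all_reals all_analysis.

Set Implicit Arguments.
Unset Strict Implicit.
Unset Printing Implicit Defensive.

Import Order.TTheory GRing.Theory Num.Theory.
Import numFieldNormedType.Exports.

Local Open Scope classical_set_scope.
Local Open Scope ring_scope.
Local Open Scope complex_scope.

(* C*-algebras are not assumed to be unital, so the product is not taken from
   the (unital) ring structures of the library. Norms over R[i] are
   R[i]-valued; 0 <= z in R[i] implies that z is real. *)
HB.mixin Record isCStarAlgebra (R : realType) B
    of CompleteNormedModule R[i] B := {
  cmul : B -> B -> B;
  cstar : B -> B;
  cmulA : forall a b c, cmul a (cmul b c) = cmul (cmul a b) c;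
  cmulDl : forall a b c, cmul (a + b) c = cmul a c + cmul b c;
  cmulDr : forall a b c, cmul a (b + c) = cmul a b + cmul a c;
  cmulZl : forall (z : R[i]) a b, cmul (z *: a) b = z *: cmul a b;
  cmulZr : forall (z : R[i]) a b, cmul a (z *: b) = z *: cmul a b;
  cstarK : forall a, cstar (cstar a) = a;
  cstarD : forall a b, cstar (a + b) = cstar a + cstar b;
  cstarZ : forall (z : R[i]) a, cstar (z *: a) = z^* *: cstar a;
  cstarM : forall a b, cstar (cmul a b) = cmul (cstar b) (cstar a);
  cmul_norm : forall a b, `|cmul a b| <= `|a| * `|b|;
  cstar_norm : forall a, `|cmul (cstar a) a| = `|a| ^+ 2
}.

#[short(type="cstarAlgType")]
HB.structure Definition CStarAlgebra (R : realType) :=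
  { B of CompleteNormedModule R[i] B & isCStarAlgebra R B }.

Definition cpositive (R : realType) (B : cstarAlgType R) (a : B) : Prop :=
  exists c : B, a = cmul (cstar c) c.

Definition cle (R : realType) (B : cstarAlgType R) (a b : B) : Prop :=
  cpositive (b - a).

(* Right modules, with an inner product linear in the second variable. The
   norm of the underlying Banach space is the one induced by the inner
   product, so that definiteness is part of the normed structure. *)
HB.mixin Record isHilbertModule (R : realType) (B : cstarAlgType R) E
    of CompleteNormedModule R[i] E := {
  mact : E -> B -> E;
  inner : E -> E -> B;
  mactDl : forall x y b, mact (x + y) b = mact x b + mact y b;
  mactDr : forall x b c, mact x (b + c) = mact x b + mact x c;
  mactA : forall x b c, mact x (cmul b c) = mact (mact x b) c;
  mactZl : forall (z : R[i]) x b, mact (z *: x) b = z *: mact x b;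
  mactZr : forall (z : R[i]) x b, mact x (z *: b) = z *: mact x b;
  innerDr : forall x y z, inner x (y + z) = inner x y + inner x z;
  innerZr : forall (z : R[i]) x y, inner x (z *: y) = z *: inner x y;
  inner_act : forall x y b, inner x (mact y b) = cmul (inner x y) b;
  inner_star : forall x y, cstar (inner x y) = inner y x;
  inner_ge0 : forall x, cpositive (inner x x);
  inner_norm : forall x, `|x| ^+ 2 = `|inner x x|
}.

#[short(type="hilbertModType")]
HB.structure Definition HilbertModule (R : realType) (B : cstarAlgType R) :=
  { E of CompleteNormedModule R[i] E & isHilbertModule R B E }.

Arguments mact {R B E} : rename.
Arguments inner {R B E} : rename.

Section Operators.
Context {R : realType} {B : cstarAlgType R} {E : hilbertModType B}.

Definition submodule (V : set E) : Prop :=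
  [/\ V 0,
      forall x y, V x -> V y -> V (x + y),
      forall (z : R[i]) x, V x -> V (z *: x) &
      forall x (b : B), V x -> V (mact x b)].

(* Unbounded operators. The values of opfun outside of dom are irrelevant. *)
Record operator := Operator {
  dom : set E;
  opfun :> E -> E;
  dom_submodule : submodule dom;
  opD : forall x y, dom x -> dom y -> opfun (x + y) = opfun x + opfun y;
  opZ : forall (z : R[i]) x, dom x -> opfun (z *: x) = z *: opfun x;
  opM : forall x (b : B), dom x -> opfun (mact x b) = mact (opfun x) b
}.

Lemma submoduleI (V W : set E) :
  submodule V -> submodule W -> submodule (V `&` W).
Proof.
move=> [V0 VD VZ VM] [W0 WD WZ WM]; split.
- by split.
- by move=> x y [Vx Wx] [Vy Wy]; split; [exact: VD | exact: WD].
- by move=> z x [Vx Wx]; split; [exact: VZ | exact: WZ].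
- by move=> x b [Vx Wx]; split; [exact: VM | exact: WM].
Qed.

Section Sum.
Variables S T : operator.

Fact op_addD x y : (dom S `&` dom T) x -> (dom S `&` dom T) y ->
  S (x + y) + T (x + y) = (S x + T x) + (S y + T y).
Proof. by move=> [Sx Tx] [Sy Ty]; rewrite !opD // addrACA. Qed.

Fact op_addZ (z : R[i]) x : (dom S `&` dom T) x ->
  S (z *: x) + T (z *: x) = z *: (S x + T x).
Proof. by move=> [Sx Tx]; rewrite !opZ // scalerDr. Qed.

Fact op_addM x (b : B) : (dom S `&` dom T) x ->
  S (mact x b) + T (mact x b) = mact (S x + T x) b.
Proof. by move=> [Sx Tx]; rewrite !opM // mactDl. Qed.

Definition op_add : operator :=
  @Operator (dom S `&` dom T) (fun x => S x + T x)
    (submoduleI (dom_submodule S) (dom_submodule T)) op_addD op_addZ op_addM.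

End Sum.

(* [adjoint_graph S y z] means that y is in the domain of S^* and S^* y = z
   (for a densely defined S, such a z is unique). *)
Definition adjoint_graph (S : operator) (y z : E) : Prop :=
  forall x, dom S x -> inner (S x) y = inner x z.

Definition self_adjoint (S : operator) : Prop :=
  dense (dom S) /\
  forall y z, adjoint_graph S y z <-> (dom S y /\ S y = z).

Definition shift_range (S : operator) (l : R[i]) : set E :=
  [set S x + l *: x | x in dom S].

Definition regular (S : operator) : Prop :=
  exists l : R[i], [/\ complex.Im l != 0,
    dense (shift_range S l) & dense (shift_range S (- l))].

Definition self_adjoint_regular (S : operator) : Prop :=
  self_adjoint S /\ regular S.

Definition graph_norm (T : operator) (x : E) : R[i] :=
  sqrtC `|inner x x + inner (T x) (T x)|.

Definition core (T : operator) (V : set E) : Prop :=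
  [/\ submodule V, V `<=` dom T &
      forall x, dom T x -> forall e : R[i], 0 < e ->
        exists2 y, V y & graph_norm T (x - y) < e].

(* [(S + l)^-1 (V)], as a preimage: S + l is a bijection from dom S onto E
   when S is self-adjoint and regular and l is not real. *)
Definition resolvent_image (S : operator) (l : R[i]) (V : set E) : set E :=
  [set x | dom S x /\ V (S x + l *: x)].

Definition comm_dom (S T : operator) : set E :=
  [set x | [/\ dom S x, dom T x, dom T (S x) & dom S (T x)]].

Definition anticomm (S T : operator) (x : E) : E := S (T x) + T (S x).

Definition anticomm_bound (S T : operator) : Prop :=
  exists C0 C1 C2 : R, [/\ 0 < C0, 0 < C1, 0 < C2 &
    forall x, comm_dom S T x ->
      cle (inner (anticomm S T x) (anticomm S T x))
          (C0%:C *: inner x x + C1%:C *: inner (S x) (S x)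
             + C2%:C *: inner (T x) (T x))].

Definition anticomm_core (S T : operator) : Prop :=
  exists (V : set E) (l0 : R), [/\ core T V, 0 < l0 &
    forall l : R[i], complex.Re l = 0 -> l0%:C <= `|l| ->
      resolvent_image S l V `<=` comm_dom S T].

Definition weakly_anticommuting (S T : operator) : Prop :=
  [/\ self_adjoint_regular S, self_adjoint_regular T,
      anticomm_bound S T & anticomm_core S T].

End Operators.

Arguments operator {R B} E.

(* Main.v *)
(* In a C*-algebra the elements [c^* c] form a closed convex cone and the norm is
   monotone on it; this is all the C*-theory needed, and it follows from the
   convergence of the square root iteration, without spectral theory.

   Let [R_m = (S + i m)^-1], [K = [S, T]] and [J_m = m^2 R_m R_(-m)]. Weak
   anticommutation gives [T R_m = R_(-m) K R_m - R_(-m) T], hence bounds for the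
   (anti)commutators of [T] with functions of [S] in terms of [|x|], [|S R_m x|]
   and [|T x|]. An approximate inverse with residual of norm [q < 1] then yields
   each of the required surjectivity statements:
   - for [S + T + i k], [k] large: solve [(T + S J_n + i k) x = y], a bounded
     perturbation of [T], and take [J_m x], with [n = m^2] and [m] large;
   - for [T + i k] in the graph norm of [S]: take [J_m (T + i k)^-1 y]. Hence
     weak anticommutation is a symmetric relation.
   By symmetry the resolvents of [S3] preserve [dom S1] and [dom S2], thus
   [dom (S1 + S2)], and a second use of symmetry gives the core condition for
   [(S1 + S2, S3)]. Its bound on [[S1 + S2, S3]] is a limit of those for
   [[S1, S3]] and [[S2, S3]], as [S1] and [S2] are bounded relatively to
   [S1 + S2] in the order of the C*-algebra. *)
From HB Require Import structures.
Require Import Defs.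
From mathcomp Require Import all_boot all_order all_algebra complex.
From mathcomp Require Import all_classical all_reals all_analysis.
From mathcomp Require Import ring lra.

Set Implicit Arguments.
Unset Strict Implicit.
Unset Printing Implicit Defensive.

Import Order.TTheory GRing.Theory Num.Theory.
Import numFieldNormedType.Exports.

Local Open Scope classical_set_scope.
Local Open Scope ring_scope.
Local Open Scope complex_scope.

(** * Norms and convergent sequences *)

(** The choice n = m^2 is a balance. The commutator of [T] with J_m applied to x costs |T x| / m, up
    to multiples of |x|, and |T x| can only be estimated through (T + S J_n) x, at a price of order
    sqrt(n) |x|. On the other hand the error S J_m - J_m S J_n stays bounded only if n is at least
    of order m^2. For n = m^2 the price m |x| is just cancelled by the factor 1 / m, and what
    remains is a fixed multiple of |x|, absorbed by a large k.

    The core condition has an obstacle of its own: cores of [S1] and [S2] may meet in too small a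
    set, so two core conditions do not combine into one for the sum. Whole domains do, since dom S1
    and dom S2 intersect in the domain of the sum; hence the enlargement of cores to domains.
    Symmetry of the relation asks that (T + i k)^-1 y lie in dom S, which a residual small in [E]
    cannot show; the iteration therefore has to converge in a graph norm of [S]. *)

Definition nrm {R : realType} {V : normedModType R[i]} (x : V) : R :=
  complex.Re `|x|.

Section RealNorm.
Context {R : realType} {V : normedModType R[i]}.
Implicit Types (x y : V) (z : R[i]) (t : R).

Lemma nrmE x : `|x| = (nrm x)%:C.
Proof. by rewrite /nrm RRe_real ?normr_real. Qed.

Lemma nrm_ge0 x : 0 <= nrm x.
Proof. by rewrite -lecR -nrmE normr_ge0. Qed.

Lemma nrmD x y : nrm (x + y) <= nrm x + nrm y.
Proof. by rewrite -lecR rmorphD /= -!nrmE; exact: ler_normD. Qed.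

Lemma nrmN x : nrm (- x) = nrm x.
Proof. by rewrite /nrm normrN. Qed.

Lemma nrm_distC x y : nrm (x - y) = nrm (y - x).
Proof. by rewrite -nrmN opprB. Qed.

Lemma nrmB x y : nrm (x - y) <= nrm x + nrm y.
Proof. by rewrite -(nrmN y) nrmD. Qed.

Lemma nrm0 : nrm (0 : V) = 0.
Proof. by rewrite /nrm normr0. Qed.

Lemma nrm_eq0 x : nrm x = 0 -> x = 0.
Proof. by move=> x0; apply/normr0_eq0; rewrite nrmE x0. Qed.

Lemma nrm_dist x y : nrm x <= nrm y + nrm (x - y).
Proof. by have := nrmD y (x - y); rewrite addrC subrK. Qed.

Lemma nrmZ z x : nrm (z *: x) = complex.Re `|z| * nrm x.
Proof.
apply: complexI; rewrite -nrmE normrZ nrmE -[in LHS](RRe_real (normr_real z)).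
exact/esym/rmorphM.
Qed.

Lemma norm_realC t : complex.Re `|t%:C| = `|t|.
Proof. by rewrite normc_def /= expr0n /= addr0 sqrtr_sqr. Qed.

Lemma norm_imagC t : complex.Re `|'i%C * t%:C| = `|t|.
Proof.
by rewrite normc_def /= !mul0r !mul1r subr0 add0r expr0n add0r sqrtr_sqr.
Qed.

Lemma nrmZr t x : nrm (t%:C *: x) = `|t| * nrm x.
Proof. by rewrite nrmZ norm_realC. Qed.

Lemma nrmZi t x : nrm (('i%C * t%:C) *: x) = `|t| * nrm x.
Proof. by rewrite nrmZ norm_imagC. Qed.

(** Phrased through a real sequence, so that squeezing and [lra] apply although the norms take
    values in [R[i]]. *)
Definition tends (u : nat -> V) (l : V) : Prop :=
  (fun n => nrm (u n - l)) @ \oo --> (0 : R).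

Implicit Types (u v : nat -> V).

Lemma tends_squeeze u l (a : nat -> R) :
  (forall n, nrm (u n - l) <= a n) -> a @ \oo --> (0 : R) -> tends u l.
Proof.
move=> ule a0; apply: (@squeeze_cvgr _ _ _ _ (fun=> 0) a) => //; last exact: cvg_cst.
by apply: nearW => n; rewrite nrm_ge0 ule.
Qed.

Lemma tendsP u l : tends u l <->
  forall e : R, 0 < e -> exists N, forall n, (N <= n)%N -> nrm (u n - l) < e.
Proof.
split=> [ul e e0|ul].
  have /cvgr0Pnorm_lt/(_ e e0)[N _ HN] := ul.
  by exists N => n /HN /=; rewrite ger0_norm // nrm_ge0.
apply/cvgr0Pnorm_lt => e /ul[N HN]; exists N => // n /= /HN.
by rewrite ger0_norm // nrm_ge0.
Qed.

Lemma tends_cst x : tends (fun=> x) x.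
Proof. by rewrite /tends subrr nrm0; exact: cvg_cst. Qed.

Lemma tendsD u v l k : tends u l -> tends v k -> tends (fun n => u n + v n) (l + k).
Proof.
move=> ul vk; apply: (tends_squeeze (a := fun n => nrm (u n - l) + nrm (v n - k))).
  by move=> n; rewrite opprD addrACA nrmD.
by rewrite -[0]addr0; exact: cvgD.
Qed.

Lemma tendsZ z u l : tends u l -> tends (fun n => z *: u n) (z *: l).
Proof.
move=> ul; apply: (tends_squeeze (a := fun n => complex.Re `|z| * nrm (u n - l))).
  by move=> n; rewrite -scalerBr nrmZ.
by rewrite -[X in _ --> X](mulr0 (complex.Re `|z|)); exact: cvgMr.
Qed.

Lemma tendsN u l : tends u l -> tends (fun n => - u n) (- l).
Proof. by apply: tends_squeeze => n; rewrite -opprD nrmN. Qed.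

Lemma tendsB u v l k : tends u l -> tends v k -> tends (fun n => u n - v n) (l - k).
Proof. by move=> ul /tendsN; exact: tendsD. Qed.

Lemma tends_le u l t : tends u l -> (forall n, nrm (u n) <= t) -> nrm l <= t.
Proof.
move=> /tendsP ul ut; apply/ler_addgt0Pr => e /ul[N /(_ N (leqnn N)) Nl].
apply: (le_trans (nrm_dist l (u N))); rewrite lerD ?ut //.
by rewrite nrm_distC ltW.
Qed.

Lemma tends_unique u l k : tends u l -> tends u k -> l = k.
Proof.
move=> ul uk; apply/eqP; rewrite -subr_eq0; apply/eqP/nrm_eq0/eqP.
rewrite eq_le nrm_ge0 andbT; apply: (tends_le (tendsB ul uk)) => n.
by rewrite subrr nrm0.
Qed.

Lemma tends_eq u v l : (forall n, u n = v n) -> tends u l -> tends v l.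
Proof. by move=> /funext ->. Qed.

Lemma tends_bound u l : tends u l -> exists2 t, 0 < t & forall n, nrm (u n) <= t.
Proof.
move=> ul; have [M [_ MP]] := cvg_seq_bounded (cvgP _ ul).
exists (`|M + 1| + 1 + nrm l) => [|n].
  by rewrite ltr_wpDr ?nrm_ge0 // ltr_pwDr.
have := MP (M + 1) ltac:(by rewrite ltrDl) n I; rewrite /= ger0_norm ?nrm_ge0 // => h.
rewrite (le_trans (nrm_dist (u n) l)) // addrC lerD2r (le_trans h) //.
by rewrite (le_trans (ler_norm _)) // lerDl.
Qed.

Definition tends_cauchy u := forall e : R, 0 < e ->
  exists N, forall m n, (N <= m)%N -> (N <= n)%N -> nrm (u m - u n) < e.

Lemma tends_is_cauchy u l : tends u l -> tends_cauchy u.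
Proof.
move=> /tendsP ul e e0; have [|N HN] := ul (e / 2); first by rewrite divr_gt0.
exists N => m n Nm Nn; rewrite -(subrKA l) (le_lt_trans (nrmD _ _)) //.
by rewrite [ltRHS]splitr ltrD ?HN // nrm_distC HN.
Qed.

End RealNorm.

Lemma tends_bounded (R : realType) (V W : normedModType R[i]) (F : V -> W) (c : R)
    (u : nat -> V) (l : V) :
  (forall n, nrm (F (u n) - F l) <= c * nrm (u n - l)) ->
  tends u l -> tends (fun n => F (u n)) (F l).
Proof.
move=> Fc ul; apply: (tends_squeeze Fc).
by rewrite -[X in _ --> X](mulr0 c); exact: cvgMr.
Qed.

Lemma cauchy_tends (R : realType) (V : completeNormedModType R[i]) (u : nat -> V) :
  tends_cauchy u -> exists l, tends u l.
Proof.
move=> uc; have /cauchy_cvg uE : cauchy (u @ \oo).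
  apply: cauchy_exP => e e0.
  have eE : e = (complex.Re e)%:C by rewrite RRe_real ?gtr0_real.
  have [|N HN] := uc (complex.Re e); first by rewrite -ltcR -eE.
  exists (u N); exists N => // n /= Nn; rewrite -ball_normE /=.
  by rewrite nrmE eE ltcR HN.
exists (lim (u @ \oo)); apply/tendsP => e e0.
have /cvgrPdist_lt/(_ e%:C)[|N _ HN] := uE; first by rewrite ltcR.
by exists N => n /HN /=; rewrite nrm_distC nrmE ltcR.
Qed.

(** * The unitization of a C*-algebra *)

Section CStarBasics.
Context {R : realType} {B : cstarAlgType R}.
Implicit Types (a b c : B) (t : R).

Lemma cmul0l a : cmul 0 a = 0 :> B.
Proof. by apply: (addrI (cmul 0 a)); rewrite -cmulDl !addr0. Qed.

Lemma cmul0r a : cmul a 0 = 0 :> B.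
Proof. by apply: (addrI (cmul a 0)); rewrite -cmulDr !addr0. Qed.

Lemma cmulNl a b : cmul (- a) b = - cmul a b.
Proof. by apply: (addrI (cmul a b)); rewrite -cmulDl !subrr cmul0l. Qed.

Lemma cmulNr a b : cmul a (- b) = - cmul a b.
Proof. by apply: (addrI (cmul a b)); rewrite -cmulDr !subrr cmul0r. Qed.

Lemma cstar0 : cstar 0 = 0 :> B.
Proof. by apply: (addrI (cstar 0)); rewrite -cstarD !addr0. Qed.

Lemma cstarN a : cstar (- a) = - cstar a.
Proof. by apply: (addrI (cstar a)); rewrite -cstarD !subrr cstar0. Qed.

Lemma cstarZr t a : cstar (t%:C *: a) = t%:C *: cstar a.
Proof. by rewrite cstarZ; congr (_ *: _); exact: conjc_real. Qed.

Lemma nrm_cmul a b : nrm (cmul a b) <= nrm a * nrm b.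
Proof. by rewrite -lecR rmorphM /= -!nrmE cmul_norm. Qed.

Lemma nrm_star_mul a : nrm (cmul (cstar a) a) = nrm a ^+ 2.
Proof.
apply: complexI; rewrite -nrmE cstar_norm nrmE; exact/esym/rmorphXn.
Qed.

Lemma nrm_cstar a : nrm (cstar a) = nrm a.
Proof.
suff h b : nrm b <= nrm (cstar b) by apply/le_anti; rewrite h -{2}(cstarK a) h.
have [->|b0] := eqVneq b 0; first by rewrite cstar0.
have nb : 0 < nrm b.
  by rewrite lt0r nrm_ge0 andbT; apply: contra_neq b0; exact: nrm_eq0.
rewrite -(ler_pM2r nb) -expr2 -nrm_star_mul; exact: nrm_cmul.
Qed.

End CStarBasics.

(* Real scalars are enough below; the scalar part of a self-adjoint element of
   the complex unitization is real anyway. *)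
Definition unitization {R : realType} (B : cstarAlgType R) : Type := (R * B)%type.

Section Unitization.
Context {R : realType} {B : cstarAlgType R}.
Local Notation U := (unitization B).

HB.instance Definition _ := GRing.Zmodule.copy U (R * B)%type.

Implicit Types (u v w : U) (t : R) (x : B).

Definition umul v w : U :=
  (v.1 * w.1, v.1%:C *: w.2 + w.1%:C *: v.2 + cmul v.2 w.2).

Fact umulA : associative umul.
Proof.
move=> [a1 a2] [b1 b2] [c1 c2]; rewrite /umul /=; congr (_, _); first exact: mulrA.
rewrite !cmulDl !cmulDr !cmulZl !cmulZr !scalerDr !scalerA cmulA.
rewrite -!rmorphM /= (mulrC c1 a1) (mulrC c1 b1).
by rewrite [LHS](AC (4*3)%AC ((1*(2*4*6))*(3*5*7))%AC).
Qed.

Fact umul1l : left_id (1, 0) umul.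
Proof.
by case=> a b; rewrite /umul /= mul1r scale1r scaler0 cmul0l !addr0.
Qed.

Fact umul1r : right_id (1, 0) umul.
Proof.
by case=> a b; rewrite /umul /= mulr1 scale1r scaler0 cmul0r add0r addr0.
Qed.

Fact umulDl : left_distributive umul +%R.
Proof.
move=> [a1 a2] [b1 b2] [c1 c2]; congr (_, _); rewrite /= ?mulrDl // rmorphD /=.
rewrite scalerDl scalerDr cmulDl.
by rewrite [LHS](AC (2*2*2)%AC ((1*3*5)*(2*4*6))%AC).
Qed.

Fact umulDr : right_distributive umul +%R.
Proof.
move=> [a1 a2] [b1 b2] [c1 c2]; congr (_, _); rewrite /= ?mulrDr // rmorphD /=.
rewrite scalerDl scalerDr cmulDr.
by rewrite [LHS](AC (2*2*2)%AC ((1*3*5)*(2*4*6))%AC).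
Qed.

HB.instance Definition _ :=
  GRing.Zmodule_isPzRing.Build U umulA umul1l umul1r umulDl umulDr.

Lemma umulE v w :
  v * w = (v.1 * w.1, v.1%:C *: w.2 + w.1%:C *: v.2 + cmul v.2 w.2) :> U.
Proof. by []. Qed.

Definition ureal t : U := (t, 0).
Definition uemb (b : B) : U := (0, b).
Definition ustar w : U := (w.1, cstar w.2).
(* Locked, lest rewriting with [scalerDr] and the like look inside. *)
Definition uact w x : B := locked (w.1%:C *: x + cmul w.2 x).

Lemma uactE w x : uact w x = w.1%:C *: x + cmul w.2 x.
Proof. by rewrite /uact -lock. Qed.

Lemma ustarK : involutive ustar.
Proof. by case=> a b; rewrite /ustar cstarK. Qed.

Lemma ustarD v w : ustar (v + w) = ustar v + ustar w.
Proof. by rewrite /ustar cstarD. Qed.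

Lemma ustarN v : ustar (- v) = - ustar v.
Proof. by rewrite /ustar cstarN. Qed.

Lemma ustarB v w : ustar (v - w) = ustar v - ustar w.
Proof. by rewrite ustarD ustarN. Qed.

Lemma ustarM v w : ustar (v * w) = ustar w * ustar v.
Proof.
rewrite !umulE /ustar /=; congr (_, _); first exact: mulrC.
rewrite !cstarD !cstarZr cstarM; congr (_ + _); exact: addrC.
Qed.

Lemma ustar_real t : ustar (ureal t) = ureal t.
Proof. by rewrite /ustar cstar0. Qed.

Lemma urealD s t : ureal (s + t) = ureal s + ureal t.
Proof. by congr (_, _); rewrite /= addr0. Qed.

Lemma urealM s t : ureal (s * t) = ureal s * ureal t.
Proof. by congr (_, _); rewrite /= !scaler0 cmul0l !addr0. Qed.

Lemma ureal1 : ureal 1 = 1. Proof. by []. Qed.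

Lemma urealC t w : ureal t * w = w * ureal t.
Proof.
rewrite !umulE /= !scaler0 cmul0l cmul0r !addr0 add0r; congr (_, _).
exact: mulrC.
Qed.

Lemma uembD a b : uemb (a + b) = uemb a + uemb b.
Proof. by congr (_, _); rewrite /= addr0. Qed.

Lemma uembN a : uemb (- a) = - uemb a.
Proof. by congr (_, _); rewrite /= oppr0. Qed.

Lemma uembM a b : uemb (cmul a b) = uemb a * uemb b.
Proof. by congr (_, _); rewrite /= ?mul0r // !scale0r !add0r. Qed.

Lemma ustar_emb a : ustar (uemb a) = uemb (cstar a). Proof. by []. Qed.

Lemma uactM v w x : uact (v * w) x = uact v (uact w x).
Proof.
rewrite !uactE /= rmorphM /= !cmulDl !cmulZl cmulDr cmulZr !scalerDr scalerA.
rewrite -cmulA -!addrA; congr (_ + (_ + _)).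
Qed.

Lemma uactD v w x : uact (v + w) x = uact v x + uact w x.
Proof. by rewrite !uactE /= rmorphD /= scalerDl cmulDl addrACA. Qed.

Lemma uactN w x : uact (- w) x = - uact w x.
Proof. by rewrite !uactE /= rmorphN /= scaleNr cmulNl opprD. Qed.

Lemma uact_real t x : uact (ureal t) x = t%:C *: x.
Proof. by rewrite !uactE /= cmul0l addr0. Qed.

Lemma uact_emb b x : uact (uemb b) x = cmul b x.
Proof. by rewrite !uactE /= scale0r add0r. Qed.

Lemma uact_star v x y : cmul (cstar (uact v x)) y = cmul (cstar x) (uact (ustar v) y).
Proof.
rewrite !uactE /= cstarD cstarZr cstarM cmulDl cmulDr cmulZl cmulZr -cmulA.
by [].
Qed.

(* The C*-norm of the unitization, when [B] is not unital; for unital [B] the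
   component [|w.1|] separates [(1, -1)] from [0]. *)
Definition unorm_le w t : Prop := `|w.1| <= t /\ forall x, nrm (uact w x) <= t * nrm x.

Lemma unorm_le_trans w s t : s <= t -> unorm_le w s -> unorm_le w t.
Proof.
move=> st [w1 w2]; split=> [|x]; first exact: le_trans st.
by rewrite (le_trans (w2 x)) // ler_wpM2r ?nrm_ge0.
Qed.

Lemma unorm_le_ge0 w t : unorm_le w t -> 0 <= t.
Proof. by case=> + _; exact: le_trans. Qed.

Lemma unorm_leD v w s t : unorm_le v s -> unorm_le w t -> unorm_le (v + w) (s + t).
Proof.
move=> [v1 v2] [w1 w2]; split=> [|x]; first by rewrite (le_trans (ler_normD _ _)) ?lerD.
by rewrite uactD mulrDl (le_trans (nrmD _ _)) ?lerD.
Qed.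

Lemma unorm_leN w t : unorm_le w t -> unorm_le (- w) t.
Proof. by move=> [w1 w2]; split=> [|x]; rewrite ?normrN // uactN nrmN. Qed.

Lemma unorm_leB v w s t : unorm_le v s -> unorm_le w t -> unorm_le (v - w) (s + t).
Proof. by move=> vs /unorm_leN; exact: unorm_leD. Qed.

Lemma unorm_leM v w s t : unorm_le v s -> unorm_le w t -> unorm_le (v * w) (s * t).
Proof.
move=> vs wt; have s0 := unorm_le_ge0 vs; case: vs wt => [v1 v2] [w1 w2].
split=> [|x]; first by rewrite normrM ler_pM.
by rewrite uactM (le_trans (v2 _)) // -mulrA ler_wpM2l.
Qed.

Lemma unorm_le_real t : unorm_le (ureal t) `|t|.
Proof. by split=> [|x] //=; rewrite uact_real nrmZr. Qed.

(** The lower bound comes from the vector [cstar b], on which the C*-identity gives |b b^*| =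
    |b|^2. *)
Lemma unorm_le_emb b t : 0 <= t -> unorm_le (uemb b) t <-> nrm b <= t.
Proof.
move=> t0; split=> [[_ /(_ (cstar b))]|bt].
  rewrite uact_emb -{1}(cstarK b) nrm_star_mul nrm_cstar expr2 => h.
  have [->//|nb] := eqVneq (nrm b) 0.
  by rewrite -(@ler_pM2r _ (nrm b)) // lt0r nb nrm_ge0.
split=> [|x]; rewrite ?normr0 // uact_emb (le_trans (nrm_cmul _ _)) //.
by rewrite ler_wpM2r ?nrm_ge0.
Qed.

Lemma unorm_le_ex w : exists2 t, 0 < t & unorm_le w t.
Proof.
exists (`|w.1| + nrm w.2 + 1).
  by rewrite ltr_wpDl // addr_ge0 ?nrm_ge0.
have -> : w = ureal w.1 + uemb w.2.
  by rewrite [LHS]surjective_pairing; congr (_, _); rewrite /= ?addr0 ?add0r.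
rewrite /= addr0 add0r; apply: (@unorm_le_trans _ (`|w.1| + nrm w.2)).
  by rewrite lerDl.
by apply: unorm_leD; [exact: unorm_le_real | apply/unorm_le_emb; rewrite ?nrm_ge0].
Qed.

Lemma unorm_le_star w t : unorm_le w t -> unorm_le (ustar w) t.
Proof.
move=> wt; have t0 := unorm_le_ge0 wt; case: wt => w1 w2; split=> // x.
have [->|n0] := eqVneq (nrm (uact (ustar w) x)) 0; first by rewrite mulr_ge0 ?nrm_ge0.
have np : 0 < nrm (uact (ustar w) x) by rewrite lt0r n0 nrm_ge0.
rewrite -(ler_pM2r np) -expr2 -nrm_star_mul uact_star ustarK.
rewrite (le_trans (nrm_cmul _ _)) // nrm_cstar mulrAC mulrC ler_wpM2r ?nrm_ge0 //.
Qed.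

Lemma unorm_le_sqr w t : 0 <= t -> unorm_le (ustar w * w) (t ^+ 2) -> unorm_le w t.
Proof.
move=> t0 [w1 w2]; split=> [|x].
  by move: w1; rewrite normrM -expr2 ler_pXn2r // nnegrE.
rewrite -(@ler_pXn2r _ 2) ?nnegrE ?mulr_ge0 ?nrm_ge0 //.
rewrite -nrm_star_mul uact_star -uactM (le_trans (nrm_cmul _ _)) // nrm_cstar.
by rewrite mulrC exprMn (expr2 (nrm x)) mulrA ler_wpM2r ?nrm_ge0.
Qed.

Lemma unorm_le0 w : unorm_le w 0 -> w = 0.
Proof.
move=> w0; have w1 : w.1 = 0 by apply/normr0_eq0/le_anti; rewrite normr_ge0 andbT; case: w0.
have wE : w = uemb w.2 by rewrite [LHS]surjective_pairing w1.
rewrite wE in w0 *; move/unorm_le_emb: w0 => /(_ (lexx 0)) w2.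
by rewrite /uemb (@nrm_eq0 _ _ w.2) //; apply/le_anti; rewrite w2 nrm_ge0.
Qed.

End Unitization.

Section UnitizationLimits.
Context {R : realType} {B : cstarAlgType R}.
Local Notation U := (unitization B).
Implicit Types (u v : nat -> U) (l k w c : U).

Definition utends u l : Prop := forall e : R, 0 < e ->
  exists N, forall n, (N <= n)%N -> unorm_le (u n - l) e.

Lemma unorm_le_closed w (t : R) : (forall e : R, 0 < e -> unorm_le w (t + e)) -> unorm_le w t.
Proof.
move=> wt; split=> [|x]; first by apply/ler_addgt0Pr => e /wt[].
apply/ler_addgt0Pr => e e0; have n1 : 0 < nrm x + 1 by rewrite ltr_wpDl ?nrm_ge0.
have [|_ /(_ x) h] := wt (e / (nrm x + 1)); first by rewrite divr_gt0.
rewrite (le_trans h) // mulrDl lerD2l mulrAC ler_pdivrMr // ler_wpM2l ?(ltW e0) //.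
by rewrite lerDl.
Qed.

Lemma unorm_le_00 : @unorm_le R B 0 0.
Proof. by have := @unorm_le_real R B 0; rewrite normr0. Qed.

Lemma utends_cst l : utends (fun=> l) l.
Proof.
move=> e e0; exists 0%N => n _; rewrite subrr.
exact: unorm_le_trans (ltW e0) unorm_le_00.
Qed.

Lemma utends_unique u l k : utends u l -> utends u k -> l = k.
Proof.
move=> ul uk; apply/eqP; rewrite -subr_eq0; apply/eqP/unorm_le0.
apply: unorm_le_closed => e e0; rewrite add0r.
have [|N HN] := ul (e / 2); first by rewrite divr_gt0.
have [|M HM] := uk (e / 2); first by rewrite divr_gt0.
have -> : l - k = (u (N + M)%N - k) - (u (N + M)%N - l).
  by rewrite opprB [RHS]addrC subrKA.
rewrite [e]splitr; apply: unorm_leB; [apply: HM | apply: HN].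
  exact: leq_addl.
exact: leq_addr.
Qed.

Lemma utendsD u v l k : utends u l -> utends v k -> utends (fun n => u n + v n) (l + k).
Proof.
move=> ul vk e e0.
have [|N HN] := ul (e / 2); first by rewrite divr_gt0.
have [|M HM] := vk (e / 2); first by rewrite divr_gt0.
exists (N + M)%N => n nNM; rewrite opprD addrACA [e]splitr.
apply: unorm_leD; [apply: HN | apply: HM].
  exact: leq_trans (leq_addr _ _) nNM.
exact: leq_trans (leq_addl _ _) nNM.
Qed.

Lemma utendsM u v l k : utends u l -> utends v k -> utends (fun n => u n * v n) (l * k).
Proof.
move=> ul vk e e0.
have [s s0 ls] := unorm_le_ex l; have [t t0 kt] := unorm_le_ex k.
have st : 0 < s + t + 1 by lra.
(* Since d <= 1, the error d (d + t) + s d is at most d (s + t + 1) <= e. *)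
pose d := Num.min 1 (e / (s + t + 1)).
have d0 : 0 < d by rewrite lt_min ltr01 divr_gt0.
have d1 : d <= 1 by rewrite ge_min lexx.
have de : d * (s + t + 1) <= e by rewrite -ler_pdivlMr // ge_min lexx orbT.
have [N HN] := ul d d0; have [M HM] := vk d d0.
exists (N + M)%N => n nNM; have un := HN n (leq_trans (leq_addr _ _) nNM).
have vn := HM n (leq_trans (leq_addl _ _) nNM).
have -> : u n * v n - l * k = (u n - l) * ((v n - k) + k) + l * (v n - k).
  by rewrite subrK mulrBl mulrBr addrA subrK.
apply: (@unorm_le_trans _ _ _ (d * (d + t) + s * d)); first by nra.
by apply: unorm_leD; apply: unorm_leM => //; exact: unorm_leD.
Qed.

Lemma utends_star u l : utends u l -> utends (fun n => ustar (u n)) (ustar l).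
Proof.
move=> ul e /ul[N HN]; exists N => n /HN; rewrite -ustarB; exact: unorm_le_star.
Qed.

Lemma utends_shift u l : utends u l -> utends (fun n => u n.+1) l.
Proof. by move=> ul e /ul[N HN]; exists N => n Nn; apply: HN; exact: leqW. Qed.

Lemma utends_eq u v l : (forall n, u n = v n) -> utends u l -> utends v l.
Proof. by move=> /funext ->. Qed.

Lemma utends_le u l (t : R) : utends u l -> (forall n, unorm_le (u n) t) -> unorm_le l t.
Proof.
move=> ul ut; apply: unorm_le_closed => e /ul[N /(_ N (leqnn N)) HN].
have -> : l = u N - (u N - l) by rewrite subKr.
exact: unorm_leB.
Qed.

(** Splitting off the scalar part reduces completeness of the unitization to that of [R] and of
    [B]. *)
Lemma unorm_le_snd w t : unorm_le w t -> nrm w.2 <= t + t.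
Proof.
move=> wt; have t0 := unorm_le_ge0 wt; apply/unorm_le_emb; first by rewrite addr_ge0.
have -> : uemb w.2 = w - ureal w.1.
  by rewrite [w in RHS]surjective_pairing; congr (_, _); rewrite /= ?subrr ?subr0.
apply: unorm_leB => //; apply: (@unorm_le_trans _ _ _ `|w.1|); first by case: wt.
exact: unorm_le_real.
Qed.

Lemma ucauchy_tends u :
  (forall e : R, 0 < e -> exists N, forall m n, (N <= m)%N -> (N <= n)%N ->
     unorm_le (u m - u n) e) -> exists l, utends u l.
Proof.
move=> uc.
have [|b ub] := @cauchy_tends R B (fun n => (u n).2).
  move=> e e0; have [|N HN] := uc (e / 3); first by rewrite divr_gt0.
  exists N => m n Nm Nn; apply: (le_lt_trans (unorm_le_snd (HN m n Nm Nn))).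
  lra.
have /cauchy_cvg cv : cauchy ((fun n => (u n).1 : R^o) @ \oo).
  apply: cauchy_exP => e e0; have [|N HN] := uc (e / 2); first by rewrite divr_gt0.
  exists (u N).1; exists N => // n /= Nn; rewrite -ball_normE /=.
  have [+ _] := HN N n (leqnn N) Nn; move=> /le_lt_trans; apply; lra.
exists (lim ((fun n => (u n).1 : R^o) @ \oo), b) => e e0.
have /cvgrPdist_lt/(_ (e / 2)) := cv; rewrite divr_gt0 // => /(_ isT)[N _ HN].
have [M HM] := (tendsP _ _).1 ub (e / 2) ltac:(by rewrite divr_gt0).
exists (N + M)%N => n nNM; have := HN n (leq_trans (leq_addr _ _) nNM).
have {HM} := HM n (leq_trans (leq_addl _ _) nNM) => h2 /= h1.
set a := lim _ in h1 *.
have -> : u n - (a, b) = ureal ((u n).1 - a) + uemb ((u n).2 - b).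
  by rewrite [in LHS](surjective_pairing (u n)); congr (_, _); rewrite /= ?addr0 ?add0r.
rewrite [e]splitr; apply: unorm_leD; last first.
  by apply/unorm_le_emb; [rewrite divr_ge0 // ltW | exact: ltW].
apply: unorm_le_trans (unorm_le_real _); rewrite distrC; exact: ltW.
Qed.

End UnitizationLimits.

(** * Square roots by iteration *)

Section SquareRoot.
Context {R : realType} {B : cstarAlgType R}.
Local Notation U := (unitization B).

(* A fixed point [u] of [u = (y + u^2) / 2] satisfies [(1 - u)^2 = 1 - y]. The
   iterates for [|y| <= 1] are dominated by those for the scalar [y = 1]. *)
Fixpoint sqrt_scal (n : nat) : R :=
  if n is n'.+1 then (1 + sqrt_scal n' ^+ 2) / 2 else 0.

Fixpoint sqrt_iter (y : U) (n : nat) : U :=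
  if n is n'.+1 then ureal (1 / 2) * (y + sqrt_iter y n' * sqrt_iter y n') else 0.

Local Notation r := sqrt_scal.

Lemma sqrt_scal_bound n : 0 <= r n <= 1.
Proof. by elim: n => [|n /andP[h0 h1]] /=; apply/andP; split; nra. Qed.

Lemma sqrt_scal_incr : {homo r : m n / (m <= n)%N >-> m <= n}.
Proof.
apply: homo_leq => [//|x y z|n]; first exact: le_trans.
by have := sqrt_scal_bound n; rewrite /=; nra.
Qed.

Lemma sqrt_scal_cauchy (e : R) : 0 < e ->
  exists N, forall m n, (N <= m)%N -> (N <= n)%N -> `|r m - r n| <= e.
Proof.
move=> e0; have /cvg_ex[l] : cvgn (r : nat -> R^o).
  apply: nondecreasing_is_cvgn; first exact: sqrt_scal_incr.
  by exists 1 => _ [n _ <-]; have /andP[] := sqrt_scal_bound n.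
move=> /cvgrPdist_lt/(_ (e / 2)); rewrite divr_gt0 // => /(_ isT)[N _ HN].
exists N => m n /HN /= lm /HN /= ln; rewrite -(subrKA l) (le_trans (ler_normD _ _)) //.
by rewrite (distrC _ l); lra.
Qed.

Variable y : U.
Hypothesis y1 : unorm_le y 1.
Local Notation u := (sqrt_iter y).

Lemma sqrt_iter_comm c : c * y = y * c -> forall n, c * u n = u n * c.
Proof.
move=> cy; elim=> [|n IH] /=; first by rewrite mulr0 mul0r.
rewrite mulrA -urealC -!mulrA; congr (_ * _).
by rewrite mulrDr mulrDl cy mulrA IH -!mulrA IH.
Qed.

Lemma sqrt_iter_commr m n : u m * u n = u n * u m.
Proof. by apply: sqrt_iter_comm; apply/esym/sqrt_iter_comm. Qed.

Lemma sqrt_iter_star : ustar y = y -> forall n, ustar (u n) = u n.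
Proof.
move=> ys; elim=> [|n IH] /=; first by rewrite /ustar cstar0.
by rewrite ustarM ustar_real ustarD ys ustarM IH urealC.
Qed.

Lemma sqrt_iter_le n : unorm_le (u n) (r n).
Proof.
elim: n => [|n IH] /=; first exact: unorm_le_00.
have -> : (1 + r n ^+ 2) / 2 = `|1 / 2| * (1 + r n * r n).
  by rewrite gtr0_norm ?divr_gt0 // expr2 mulrC mul1r.
by apply: unorm_leM (unorm_le_real _) _; apply: unorm_leD => //; exact: unorm_leM.
Qed.

(** The iterates commute, so the difference of their squares factors; the same factorization of the
    scalar iterates gives the majorant. *)
Lemma sqrt_iter_step n : unorm_le (u n.+1 - u n) (r n.+1 - r n).
Proof.
elim: n => [|n IH].
  rewrite !subr0 (_ : r 1 = `|1 / 2| * (1 + 0)); last first.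
    by rewrite gtr0_norm ?divr_gt0 //= expr0n /= mulrC mul1r.
  rewrite /= mulr0; apply: unorm_leM (unorm_le_real _) _; apply: unorm_leD => //.
  exact: unorm_le_00.
have -> : u n.+2 - u n.+1 = ureal (1 / 2) * ((u n.+1 - u n) * (u n.+1 + u n)).
  have uS k : u k.+1 = ureal (1 / 2) * (y + u k * u k) by [].
  rewrite [u n.+2]uS [X in _ - X = _]uS -mulrBr; congr (_ * _).
  rewrite mulrBl !mulrDr (sqrt_iter_commr n n.+1) addrKA.
  by rewrite opprD addrACA subrr add0r.
have -> : r n.+2 - r n.+1 = `|1 / 2| * ((r n.+1 - r n) * (r n.+1 + r n)).
  rewrite gtr0_norm ?divr_gt0 // (_ : r n.+2 = (1 + r n.+1 ^+ 2) / 2) //.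
  rewrite [X in _ - X = _](_ : _ = (1 + r n ^+ 2) / 2) //; by field.
apply: unorm_leM (unorm_le_real _) _; apply: unorm_leM => //.
by apply: unorm_leD; exact: sqrt_iter_le.
Qed.

Lemma sqrt_iter_dist n k : unorm_le (u (n + k) - u n) (r (n + k) - r n).
Proof.
elim: k => [|k IH]; first by rewrite addn0 !subrr; exact: unorm_le_00.
rewrite addnS -(subrKA (u (n + k)%N)) -(subrKA (r (n + k)%N)).
by apply: unorm_leD => //; exact: sqrt_iter_step.
Qed.

Lemma sqrt_iter_cvg : exists l, utends u l.
Proof.
apply: ucauchy_tends => e /sqrt_scal_cauchy[N HN]; exists N.
have le_case m n : (m <= n)%N -> `|r n - r m| <= e -> unorm_le (u n - u m) e.
  move=> /subnKC <-; set k := (n - m)%N; move=> h.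
  exact: unorm_le_trans (le_trans (ler_norm _) h) (sqrt_iter_dist m k).
move=> m n Nm Nn; have [mn|/ltnW nm] := leqP m n; last by apply: le_case => //; exact: HN.
by rewrite -opprB; apply/unorm_leN/le_case => //; exact: HN.
Qed.

(** The third clause encodes positivity of the root. The last one replaces functional calculus: it
    lets roots of commuting elements commute. *)
Lemma sqrt_exists : ustar y = y ->
  exists s, [/\ ustar s = s, s * s = 1 - y, unorm_le (1 - s) 1 &
    forall c, c * y = y * c -> c * s = s * c].
Proof.
move=> ys; have [l ul] := sqrt_iter_cvg.
have ls : ustar l = l.
  apply: utends_unique (utends_star ul) _; apply: utends_eq ul => n.
  by rewrite sqrt_iter_star.
have lE : l = ureal (1 / 2) * (y + l * l).
  apply: utends_unique (utends_shift ul) _.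
  apply: utendsM (utends_cst _) _; apply: utendsD (utends_cst _) _; exact: utendsM.
have lE2 : l + l = y + l * l.
  rewrite {1 2}lE -mulrDl -urealD (_ : 1 / 2 + 1 / 2 = 1 :> R) ?ureal1 ?mul1r //.
  by field.
exists (1 - l); split.
- by rewrite ustarB ls -ureal1 ustar_real.
- have -> : y = l + l - l * l by rewrite lE2 addrK.
  rewrite mulrBl mul1r mulrBr mulr1 !opprB opprD.
  by rewrite [LHS](AC (2*2)%AC (1*(3*(2*4)))%AC).
- rewrite subKr; apply: utends_le ul _ => n.
  by apply: unorm_le_trans (sqrt_iter_le n); case/andP: (sqrt_scal_bound n).
- move=> c cy; rewrite mulrBl mulrBr mul1r mulr1; congr (_ - _).
  apply: (utends_unique (utendsM (utends_cst c) ul)).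
  apply: utends_eq (utendsM ul (utends_cst c)) => n; exact/esym/sqrt_iter_comm.
Qed.

End SquareRoot.

(** * The positive cone *)

Section PositiveCone.
Context {R : realType} {B : cstarAlgType R}.
Local Notation U := (unitization B).
Implicit Types (a b h s r q : U) (t c : R).

(** For self-adjoint [h] the norm inequality places the spectrum in [0, 2 t]. In this form,
    stability under sums is immediate. *)
Definition upos h : Prop := ustar h = h /\ exists t, unorm_le (ureal t - h) t.

Lemma uposD a b : upos a -> upos b -> upos (a + b).
Proof.
move=> [sa [t at_]] [sb [t' bt]]; split; first by rewrite ustarD sa sb.
by exists (t + t'); rewrite urealD opprD addrACA; exact: unorm_leD.
Qed.

Lemma uposZ c a : 0 <= c -> upos a -> upos (ureal c * a).
Proof.
move=> c0 [sa [t at_]]; split; first by rewrite ustarM ustar_real sa urealC.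
exists (c * t); rewrite urealM -mulrBr; apply: unorm_leM => //.
by rewrite -[X in unorm_le _ X]ger0_norm //; exact: unorm_le_real.
Qed.

Lemma upos_gt0 a : upos a -> exists2 t, 0 < t & unorm_le (ureal t - a) t.
Proof.
move=> [_ [t at_]]; exists (t + 1); first by rewrite ltr_wpDl // (unorm_le_ge0 at_).
rewrite urealD addrAC; apply: unorm_leD => //.
by rewrite -[X in unorm_le _ X]normr1; exact: unorm_le_real.
Qed.

Lemma ureal_commute t a b : a * b = b * a -> a * (ureal t * b) = ureal t * b * a.
Proof. by move=> ab; rewrite mulrA -urealC -!mulrA ab. Qed.

Lemma ureal_mulV t : 0 < t -> ureal t * ureal t^-1 = 1 :> U.
Proof. by move=> t0; rewrite -urealM divff ?gt_eqF. Qed.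

(** The element 1 - a / t has norm at most 1, so the iteration provides a root of a / t, to be
    rescaled by the root of t. *)
Lemma upos_sqrt a : upos a ->
  exists s, [/\ ustar s = s, s * s = a, upos s & forall b, b * a = a * b -> b * s = s * b].
Proof.
move=> pa; have [t t0 at_] := upos_gt0 pa; have sa := pa.1.
pose y : U := 1 - ureal t^-1 * a.
have yE : y = ureal t^-1 * (ureal t - a).
  by rewrite mulrBr urealC ureal_mulV.
have y1 : unorm_le y 1.
  rewrite yE -(@divff _ t) ?gt_eqF // mulrC; apply: unorm_leM at_.
  by rewrite -[X in unorm_le _ X]gtr0_norm ?invr_gt0 //; exact: unorm_le_real.
have ys : ustar y = y.
  by rewrite /y ustarB -ureal1 ustar_real ustarM ustar_real sa urealC.
have [s [ss s2 s1 sc]] := sqrt_exists y1 ys.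
exists (ureal (Num.sqrt t) * s); split.
- by rewrite ustarM ustar_real ss urealC.
- rewrite mulrA -[_ * s * _]mulrA -[s * _]urealC -!mulrA s2 /y subKr !mulrA -!urealM.
  by rewrite -expr2 sqr_sqrtr ?ltW // divff ?gt_eqF // ureal1 mul1r.
- apply: uposZ; first exact: sqrtr_ge0.
  by split => //; exists 1; rewrite ureal1.
- move=> b ba; apply/ureal_commute/sc.
  by rewrite /y mulrBr mulrBl mulr1 mul1r (ureal_commute _ ba).
Qed.

Lemma uactZ a (z : R[i]) x : uact a (z *: x) = z *: uact a x.
Proof. by rewrite !uactE cmulZr scalerDr !scalerA mulrC. Qed.

Lemma uactDr a x y : uact a (x + y) = uact a x + uact a y.
Proof. by rewrite !uactE cmulDr scalerDr addrACA. Qed.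

(* [s + i r] is normal, with [(s + i r)^* (s + i r) = s^2 + r^2]. *)
Lemma unorm_le_sum_sqr s r t : ustar s = s -> ustar r = r -> s * r = r * s ->
  0 <= t -> unorm_le (s * s + r * r) (t ^+ 2) -> unorm_le s t.
Proof.
move=> ss sr src t0 [h1 h2].
(* Used for e = i and e = - i; adding the two estimates eliminates [r]. *)
have key (e : R[i]) x : Num.conj e * e = 1 -> Num.conj e = - e ->
    nrm (uact s x + e *: uact r x) <= t * nrm x.
  move=> e1 eN.
  rewrite -(@ler_pXn2r _ 2) ?nnegrE ?mulr_ge0 ?nrm_ge0 // -nrm_star_mul.
  have -> : cmul (cstar (uact s x + e *: uact r x)) (uact s x + e *: uact r x)
      = cmul (cstar x) (uact (s * s + r * r) x).
    rewrite cstarD cstarZ cmulDl cmulZl !uact_star ss sr -cmulZr -cmulDr.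
    congr (cmul _ _); rewrite (uactDr s) (uactDr r) (uactZ s) (uactZ r) -!uactM src.
    rewrite scalerDr scalerA e1 scale1r.
    by rewrite eN scaleNr addrA addrK uactD.
  rewrite (le_trans (nrm_cmul _ _)) // nrm_cstar mulrC exprMn (expr2 (nrm x)) mulrA.
  by rewrite ler_wpM2r ?nrm_ge0.
split=> [|x].
  rewrite -(@ler_pXn2r _ 2) ?nnegrE // real_normK ?num_real //.
  rewrite (le_trans _ h1) // (le_trans _ (ler_norm _)) //= !expr2.
  by rewrite lerDl -expr2 sqr_ge0.
have iJ : Num.conj ('i%C : R[i]) = - 'i%C by apply/eqP; rewrite eq_complex /= oppr0 !eqxx.
have ii : ('i%C : R[i]) * 'i%C = -1 by rewrite -expr2 sqr_i.
have h3 := key 'i%C x ltac:(by rewrite iJ mulNr ii opprK) iJ.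
have h4 := key (- 'i%C) x ltac:(by rewrite rmorphN /= iJ opprK mulrN ii opprK)
             ltac:(by rewrite rmorphN /= iJ).
rewrite scaleNr in h4.
have := le_trans (nrmD _ _) (lerD h3 h4).
rewrite addrACA subrr addr0 -mulr2n -scaler_nat nrmZ.
have -> : complex.Re `|2%:R : R[i]| = 2 by rewrite normr_nat.
by move=> h; lra.
Qed.

(** After scaling to |s| <= 1, the root u of 1 - s^2 commutes with s and satisfies s^2 + u^2 = 1,
    whence |u| <= 1. This is what makes squares positive. *)
Lemma unorm_le_sqr_compl s t : ustar s = s -> 0 < t -> unorm_le s t ->
  unorm_le (ureal (t * t) - s * s) (t * t).
Proof.
move=> ss t0 st.
pose s1 : U := ureal t^-1 * s.
have s1s : ustar s1 = s1 by rewrite /s1 ustarM ustar_real ss urealC.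
have s1u : unorm_le s1 1.
  rewrite -(@mulVf _ t) ?gt_eqF //; apply: unorm_leM st.
  by rewrite -[X in unorm_le _ X]gtr0_norm ?invr_gt0 //; exact: unorm_le_real.
have [|u [su u2 _ uc]] := @sqrt_exists _ _ (s1 * s1) _ ltac:(by rewrite ustarM s1s).
  by rewrite -[X in unorm_le _ X]mulr1; exact: unorm_leM.
have u1 : unorm_le u 1.
  apply: (@unorm_le_sum_sqr _ s1) => //; first by apply/esym/uc; rewrite mulrA.
  rewrite u2 subrK expr1n -[X in unorm_le _ X]normr1; exact: (unorm_le_real 1).
have -> : ureal (t * t) - s * s = ureal (t * t) * (u * u).
  have -> : s * s = ureal (t * t) * (s1 * s1).
    rewrite /s1 -[in RHS]mulrA (ureal_commute _ (erefl (s * s))) !mulrA -!urealM.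
    by rewrite mulfK ?gt_eqF // divff ?gt_eqF // ureal1 mul1r.
  by rewrite u2 mulrBr mulr1.
rewrite -[X in unorm_le _ X]mulr1; apply: unorm_leM.
  by rewrite -[X in unorm_le _ X]ger0_norm ?mulr_ge0 ?ltW //; exact: unorm_le_real.
by rewrite -[X in unorm_le _ X]mulr1; exact: unorm_leM.
Qed.

Lemma upos_sqr s : ustar s = s -> upos (s * s).
Proof.
move=> ss; split; first by rewrite ustarM ss.
have [t t0 st] := unorm_le_ex s; exists (t * t); exact: unorm_le_sqr_compl.
Qed.

(** Frees the parameter in [upos]: every t > 0 above the norm serves, hence one t for a whole
    bounded sequence. *)
Lemma upos_le h t : upos h -> 0 < t -> unorm_le h t -> unorm_le (ureal t - h) t.
Proof.
move=> /upos_sqrt[s [ss s2 _ _]] t0 ht; rewrite -s2 -(@sqr_sqrtr _ t) ?ltW // expr2.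
apply: unorm_le_sqr_compl => //; first by rewrite sqrtr_gt0.
by apply: unorm_le_sqr; rewrite ?sqrtr_ge0 // ss s2 sqr_sqrtr ?ltW.
Qed.

(** If a = s^2 and - a = r^2 with commuting roots, then s^2 + r^2 = 0 bounds |s| by 0. *)
Lemma upos_anti a : upos a -> upos (- a) -> a = 0.
Proof.
move=> /upos_sqrt[s [ss s2 _ sc]] /upos_sqrt[r [sr r2 _ rc]].
suff s0 : s = 0 by rewrite -s2 s0 mul0r.
apply/unorm_le0/(@unorm_le_sum_sqr _ r) => //.
  by apply: rc; rewrite mulrN mulNr -s2 mulrA.
by rewrite s2 r2 subrr expr0n; exact: unorm_le_00.
Qed.

Lemma uposM a b : upos a -> upos b -> a * b = b * a -> upos (a * b).
Proof.
move=> pa pb ab; have [s [ss s2 _ sc]] := upos_sqrt pa.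
have [r [sr r2 _ rc]] := upos_sqrt pb.
have sb : s * b = b * s by apply/esym/sc.
have srE : s * r = r * s by exact: rc.
have -> : a * b = s * r * (s * r).
  by rewrite -s2 -r2 -!mulrA; congr (_ * _); rewrite !mulrA srE.
by apply: upos_sqr; rewrite ustarM ss sr srE.
Qed.

Lemma ustar_sqr_eq0 s : ustar s = s -> s * s = 0 -> s = 0.
Proof.
move=> ss s2; apply/unorm_le0/unorm_le_sqr => //.
by rewrite ss s2 expr0n; exact: unorm_le_00.
Qed.

End PositiveCone.

(** * Positivity of c^* c *)

Section Kaplansky.
Context {R : realType} {B : cstarAlgType R}.
Local Notation U := (unitization B).
Implicit Types (a b c : B) (u v w h q : U) (t : R).

(** Here [x] and [y] are twice the real and the imaginary part of [c]; the mixed terms cancel in the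
    sum. *)
Lemma upos_star_sum c :
  upos (uemb (cmul (cstar c) c) + uemb (cmul c (cstar c))).
Proof.
pose x := c + cstar c; pose y := 'i%C *: (cstar c - c).
have xs : cstar x = x by rewrite cstarD cstarK addrC.
have iJ : Num.conj ('i%C : R[i]) = - 'i%C by apply/eqP; rewrite eq_complex /= oppr0 !eqxx.
have ii : ('i%C : R[i]) * 'i%C = -1 by rewrite -expr2 sqr_i.
have ys : cstar y = y by rewrite cstarZ iJ scaleNr -scalerN cstarD cstarN cstarK opprB.
have yy : cmul y y = - cmul (cstar c - c) (cstar c - c).
  by rewrite cmulZl cmulZr scalerA ii scaleN1r.
have -> : uemb (cmul (cstar c) c) + uemb (cmul c (cstar c)) =
    ureal (1 / 2) * (uemb x * uemb x + uemb y * uemb y).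
  rewrite -!uembM yy -!uembD.
  have -> : cmul x x - cmul (cstar c - c) (cstar c - c) =
     (cmul (cstar c) c + cmul c (cstar c)) + (cmul (cstar c) c + cmul c (cstar c)).
    rewrite !cmulDl !cmulDr !cmulNl !cmulNr opprK !opprD !opprK.
    rewrite [LHS](AC ((2*2)*(2*2))%AC (((3*2)*(6*7))*((1*8)*(4*5)))%AC).
    by rewrite /= !subrr !addr0.
  rewrite [in RHS]uembD mulrDr -mulrDl -urealD (_ : 1 / 2 + 1 / 2 = 1 :> R).
    by rewrite ureal1 mul1r.
  by field.
apply: uposZ; first by rewrite divr_ge0.
by apply: uposD; apply: upos_sqr; rewrite ustar_emb ?xs ?ys.
Qed.

(** [B] is an ideal of its unitization, so a product such as [D * g] below comes from [B] again and
    [upos_star_sum] applies to it. *)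
Lemma uemb_mul b w : uemb b * w = uemb (uemb b * w).2.
Proof. by rewrite umulE /= mul0r. Qed.

(* If [d^* d = - h] with [h >= 0], then [k = d d^* >= 0], and the same holds for
   [x = d h^(1/2)], with [x^* x = - h^2] and [x x^* = - k^2]. *)
Lemma upos_neg_star d h : upos h -> ustar (uemb d) * uemb d = - h -> h = 0 :> U.
Proof.
move=> ph dh; pose D : U := uemb d; pose k := D * ustar D.
have sk : ustar k = k by rewrite /k ustarM ustarK.
have pk : upos k.
  have -> : k = ustar D * D + k + h by rewrite dh addrC addNKr.
  by apply: uposD => //; rewrite /k ustar_emb -!uembM; exact: upos_star_sum.
have [g [sg g2 pg gc]] := upos_sqrt ph.
have gh : g * h = h * g by rewrite -g2 mulrA.
pose x := (D * g).2; have xE : uemb x = D * g by rewrite /x [RHS]uemb_mul.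
have x1 : ustar (uemb x) * uemb x = - (h * h).
  by rewrite xE ustarM sg mulrA -[_ * D]mulrA dh mulrN mulNr gh -mulrA g2.
have x2 : uemb x * ustar (uemb x) = - (k * k).
  rewrite xE ustarM sg mulrA -(mulrA D) g2 -[h]opprK -dh mulrN mulNr.
  by rewrite /k !mulrA.
(* The opposite of this sum of squares is x^* x + x x^*, positive as well. *)
have hk : h * h + k * k = 0.
  apply: upos_anti; first by apply: uposD; apply: upos_sqr => //; case: ph.
  rewrite opprD -x1 -x2 ustar_emb -!uembM; exact: upos_star_sum.
apply: ustar_sqr_eq0; first by case: ph.
apply: upos_anti; first by apply: upos_sqr; case: ph.
by move/eqP: hk; rewrite addr_eq0 => /eqP ->; rewrite opprK; exact: upos_sqr.
Qed.

(** With b = |a| the root of a^2, q = b - a is twice the negative part of a = c^* c. For d = c q one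
    gets d^* d = q a q = - b q^2, so b q^2 = 0 by the previous lemma; then q^3 = 0, and q = 0
    because q is self-adjoint. *)
Lemma upos_star_mul c : upos (uemb (cmul (cstar c) c) : U).
Proof.
pose a : U := uemb (cmul (cstar c) c).
have sa : ustar a = a by rewrite /a ustar_emb cstarM cstarK.
have [b [sb b2 pb bc]] := upos_sqrt (upos_sqr sa).
have ab : a * b = b * a by apply: bc; rewrite mulrA.
pose q := b - a; have sq : ustar q = q by rewrite /q ustarB sa sb.
have aq : a * q = q * a by rewrite /q mulrBr mulrBl ab.
have bq : b * q = q * b by rewrite /q mulrBr mulrBl ab.
have aqE : a * q = - (b * q) by rewrite /q !mulrBr ab b2 opprB.
have hp : upos (b * (q * q)).
  by apply: uposM => //; [exact: upos_sqr | rewrite mulrA bq -!mulrA bq].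
have h0 : b * (q * q) = 0.
  apply: (@upos_neg_star (uemb c * q).2) => //.
  rewrite -uemb_mul ustarM sq ustar_emb mulrA -[q * _ * _]mulrA -uembM -/a -aq.
  by rewrite aqE mulNr mulrA.
have q3 : q * (q * q) = 0.
  by rewrite {1}/q mulrBl h0 sub0r mulrA aqE mulNr opprK -mulrA.
have q0 : q = 0.
  apply: ustar_sqr_eq0 => //; apply: ustar_sqr_eq0; first by rewrite ustarM sq.
  by rewrite -mulrA q3 mulr0.
by rewrite -/a (_ : a = b) //; apply/eqP; rewrite eq_sym -subr_eq0 -/q q0.
Qed.

Lemma cpositiveE a : cpositive a <-> upos (uemb a).
Proof.
split=> [[c ->]|pa]; first exact: upos_star_mul.
have [s [ss s2 _ _]] := upos_sqrt pa.
(* The root lies in [B], as its scalar part squares to 0. *)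
have s1 : s.1 = 0.
  by have := congr1 fst s2; rewrite /= => /eqP; rewrite mulf_eq0 orbb => /eqP.
exists s.2; have := congr1 snd ss => /= ->.
have sE : s = uemb s.2 by rewrite [LHS]surjective_pairing s1.
by have := congr1 snd s2; rewrite {1 2}sE -uembM.
Qed.

End Kaplansky.

Section PositiveElements.
Context {R : realType} {B : cstarAlgType R}.
Implicit Types (a b c : B) (t : R).

Lemma cpositiveD a b : cpositive a -> cpositive b -> cpositive (a + b).
Proof. by rewrite !cpositiveE uembD; exact: uposD. Qed.

Lemma cpositiveZ t a : 0 <= t -> cpositive a -> cpositive (t%:C *: a).
Proof.
move=> t0; rewrite !cpositiveE => /(uposZ t0).
by rewrite (_ : ureal t * uemb a = uemb (t%:C *: a)) // umulE /= mulr0 scale0r cmul0l !addr0.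
Qed.

(* With [t = |a + b|], both [a] and [t - a = (t - a - b) + b] are squares of
   commuting self-adjoint elements. *)
Lemma cpositive_nrm_le a b : cpositive a -> cpositive b -> nrm a <= nrm (a + b).
Proof.
rewrite !cpositiveE => pa pb; set t := nrm (a + b).
have t0 : 0 <= t by exact: nrm_ge0.
have pta : upos (ureal t - uemb a : unitization B).
  rewrite (_ : _ - _ = (ureal t - uemb (a + b)) + uemb b); last first.
    by rewrite uembD opprD addrA subrK.
  apply: uposD => //; split.
    rewrite ustarB ustar_real ustar_emb (_ : cstar (a + b) = a + b) //.
    have sa : cstar a = a := congr1 snd pa.1; have sb : cstar b = b := congr1 snd pb.1.
    by rewrite cstarD sa sb.
  by exists t; rewrite subKr; apply/unorm_le_emb.
have [s [ss s2 _ sc]] := upos_sqrt pa.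
have [r [sr r2 _ rc]] := upos_sqrt pta.
have src : s * r = r * s.
  by apply: rc; rewrite mulrBr mulrBl urealC -s2 mulrA.
have : unorm_le s (Num.sqrt t).
  apply: (@unorm_le_sum_sqr _ _ s r) => //.
  by rewrite s2 r2 addrC subrK sqr_sqrtr // -[X in unorm_le _ X]ger0_norm //;
    exact: unorm_le_real.
move=> h; have := unorm_leM h h; rewrite s2 -expr2 sqr_sqrtr //.
by move/unorm_le_emb; exact.
Qed.

(** A common bound t on the norms is an admissible parameter for all terms by [upos_le], and the
    norm inequality passes to the limit. *)
Lemma cpositive_closed (u : nat -> B) (l : B) :
  tends u l -> (forall n, cpositive (u n)) -> cpositive l.
Proof.
move=> ul pu; have [t t0 ut] := tends_bound ul; rewrite cpositiveE; split.
  rewrite ustar_emb; congr (uemb _); apply: (@tends_unique _ _ (fun n => cstar (u n))).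
    apply: (tends_bounded (c := 1)) ul => n.
    by rewrite -cstarN -cstarD nrm_cstar mul1r.
  apply: tends_eq ul => n; have [h _] := (cpositiveE _).1 (pu n).
  by have -> : cstar (u n) = u n := congr1 snd h.
exists t; apply: (@unorm_le_closed _ _ (ureal t - uemb l)) => e e0.
have [N /(_ N (leqnn N)) HN] := (tendsP _ _).1 ul e e0.
have -> : ureal t - uemb l = (ureal t - uemb (u N)) + uemb (u N - l).
  by rewrite uembD uembN addrA subrK.
apply: unorm_leD; last by apply/unorm_le_emb; rewrite ltW // HN.
by apply: upos_le => //; [exact/cpositiveE | apply/unorm_le_emb; rewrite // ltW].
Qed.

End PositiveElements.

(** * Hilbert modules and symmetric operators *)

Section HilbertModuleBasics.
Context {R : realType} {B : cstarAlgType R} {E : hilbertModType B}.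
Implicit Types (x y z : E) (l : R[i]) (t : R).

Lemma innerDl x y z : inner (x + y) z = inner x z + inner y z.
Proof. by rewrite -!(inner_star z) innerDr cstarD. Qed.

Lemma innerZl l x y : inner (l *: x) y = Num.conj l *: inner x y.
Proof. by rewrite -!(inner_star y) innerZr cstarZ. Qed.

Lemma inner0l y : inner 0 y = 0.
Proof. by rewrite -(scale0r 0) innerZl rmorph0 scale0r. Qed.

Lemma inner0r y : inner y 0 = 0.
Proof. by rewrite -(scale0r 0) innerZr scale0r. Qed.

Lemma innerNl x y : inner (- x) y = - inner x y.
Proof. by rewrite -scaleN1r innerZl rmorphN rmorph1 scaleN1r. Qed.

Lemma innerNr x y : inner x (- y) = - inner x y.
Proof. by rewrite -scaleN1r innerZr scaleN1r. Qed.

Lemma innerZlr t x y : inner (t%:C *: x) y = t%:C *: inner x y.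
Proof. by rewrite innerZl; congr (_ *: _); exact: conjc_real. Qed.

Lemma nrm_sqr_inner x : nrm (inner x x) = nrm x ^+ 2.
Proof. by apply: complexI; rewrite -nrmE -inner_norm nrmE; exact/esym/rmorphXn. Qed.

(** Crude polarization: the sum of <x, y> and <y, x> is estimated for [y] and for i y, and the two
    are added. A constant larger than that of Cauchy-Schwarz does no harm below. *)
Lemma nrm_inner_sqr_le x y : nrm (inner x y) <= 3 * (nrm x ^+ 2 + nrm y ^+ 2).
Proof.
have sum_le (u v : E) : nrm (inner (u + v) (u + v) - inner u u - inner v v)
    <= 3 * (nrm u ^+ 2 + nrm v ^+ 2).
  have h1 := nrmB (inner (u + v) (u + v) - inner u u) (inner v v).
  have h2 := nrmB (inner (u + v) (u + v)) (inner u u).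
  move: h1 h2; rewrite !nrm_sqr_inner => h1 h2; have h := nrmD u v; have := nrm_ge0 (u + v);
    have := nrm_ge0 u; have := nrm_ge0 v.
  by have := sqr_ge0 (nrm u - nrm v); nra.
have h1 := sum_le x y; have h2 := sum_le x ('i%C *: y).
have sumE (u v : E) : inner (u + v) (u + v) - inner u u - inner v v = inner u v + inner v u.
  rewrite innerDl !innerDr [LHS](AC ((2*2)*1*1)%AC ((2*3)*((1*5)*(4*6)))%AC).
  by rewrite /= !subrr !addr0.
rewrite sumE in h1; rewrite sumE in h2.
have iJ : Num.conj ('i%C : R[i]) = - 'i%C by apply/eqP; rewrite eq_complex /= oppr0 !eqxx.
have i1 : nrm ('i%C *: y) = nrm y by have := nrmZi 1 y; rewrite mulr1 normr1 mul1r.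
rewrite innerZr innerZl iJ scaleNr -scalerBr i1 in h2.
have i2 (b : B) : nrm ('i%C *: b) = nrm b by have := nrmZi 1 b; rewrite mulr1 normr1 mul1r.
rewrite i2 in h2.
have := le_trans (nrmD _ _) (lerD h1 h2); rewrite addrACA subrr addr0.
rewrite (_ : _ + _ = (2 : R)%:C *: inner x y); last by rewrite rmorphD /= scalerDl scale1r.
by rewrite nrmZr ger0_norm // => h; lra.
Qed.

(** The previous estimate at unit vectors: 6 = 3 (1 + 1). *)
Lemma nrm_inner_le x y : nrm (inner x y) <= 6 * (nrm x * nrm y).
Proof.
have [x0|x0] := eqVneq (nrm x) 0; first by rewrite (nrm_eq0 x0) inner0l !nrm0 mul0r mulr0.
have [y0|y0] := eqVneq (nrm y) 0; first by rewrite (nrm_eq0 y0) inner0r !nrm0 !mulr0.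
have xp : 0 < nrm x by rewrite lt0r x0 nrm_ge0.
have yp : 0 < nrm y by rewrite lt0r y0 nrm_ge0.
have := nrm_inner_sqr_le ((nrm x)^-1%:C *: x) ((nrm y)^-1%:C *: y).
rewrite innerZlr innerZr !nrmZr !gtr0_norm ?invr_gt0 // !mulVf // expr1n.
set a := _ * _ => h; have -> : nrm (inner x y) = a * (nrm x * nrm y).
  by rewrite /a; field; rewrite x0 y0.
by rewrite ler_wpM2r ?mulr_ge0 ?nrm_ge0 //; lra.
Qed.

Lemma nrm_le_inner_add x y : nrm x ^+ 2 <= nrm (inner x x + inner y y).
Proof. by rewrite -nrm_sqr_inner cpositive_nrm_le //; exact: inner_ge0. Qed.

Lemma tends_innerl (u : nat -> E) x y : tends u x -> tends (fun n => inner (u n) y) (inner x y).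
Proof.
apply: (tends_bounded (F := fun z => inner z y) (c := 6 * nrm y)) => n.
by rewrite -innerNl -innerDl -mulrA (mulrC (nrm y)) nrm_inner_le.
Qed.

Lemma tends_innerr (u : nat -> E) x y : tends u x -> tends (fun n => inner y (u n)) (inner y x).
Proof.
apply: (tends_bounded (F := fun z => inner y z) (c := 6 * nrm y)) => n.
by rewrite -innerNr -innerDr -mulrA nrm_inner_le.
Qed.

Lemma tends_inner_sqr (u : nat -> E) x : tends u x ->
  tends (fun n => inner (u n) (u n)) (inner x x).
Proof.
move=> ux; have [t t0 ut] := tends_bound ux.
apply: (tends_squeeze (a := fun n => (6 * t + 6 * nrm x) * nrm (u n - x))).
  move=> n; have -> : inner (u n) (u n) - inner x x = inner (u n) (u n - x) + inner (u n - x) x.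
    by rewrite innerDr innerDl innerNr innerNl addrA subrK.
  apply: (le_trans (nrmD _ _)); rewrite mulrDl lerD //.
    apply: (le_trans (nrm_inner_le _ _)); rewrite mulrA ler_wpM2r ?nrm_ge0 //.
    by rewrite ler_wpM2l.
  by rewrite -mulrA (mulrC (nrm x)) nrm_inner_le.
by rewrite -[X in _ --> X](mulr0 (6 * t + 6 * nrm x)); exact: cvgMr.
Qed.

Lemma denseP (A : set E) :
  dense A <-> forall x t, 0 < t -> exists2 y, A y & nrm (x - y) < t.
Proof.
split=> [dA x t t0|dA O [x Ox] oO].
  have [||y [yb Ay]] := dA (ball x t%:C); last 1 first.
  - exists y => //; move: yb; rewrite -ball_normE /= nrmE ltcR //.
  - by exists x; apply: ballxx; rewrite ltcR.
  - by apply: ball_open; rewrite ltcR.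
have /nbhs_ballP[e /= e0 be] : nbhs x O by apply: open_nbhs_nbhs.
have eE : e = (complex.Re e)%:C by rewrite RRe_real ?gtr0_real.
have [|y Ay xy] := dA x (complex.Re e); first by rewrite -ltcR -eE.
by exists y; split=> //; apply: be; rewrite -ball_normE /= nrmE eE ltcR.
Qed.

Lemma inner_dense_eq0 (A : set E) z : dense A -> (forall y, A y -> inner z y = 0) -> z = 0.
Proof.
move=> /denseP dA zA; apply: nrm_eq0; apply/eqP.
rewrite -sqrf_eq0 -nrm_sqr_inner; apply/eqP/le_anti; rewrite nrm_ge0 andbT.
apply/ler_addgt0Pr => e e0; rewrite add0r.
have p : 0 < 6 * nrm z + 1 by have := nrm_ge0 z; lra.
have [|y Ay zy] := dA z (e / (6 * nrm z + 1)); first by rewrite divr_gt0.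
have -> : inner z z = inner z (z - y) by rewrite innerDr innerNr (zA y Ay) subr0.
apply: (le_trans (nrm_inner_le _ _)); move: zy; rewrite ltr_pdivlMr // => zy.
by have := nrm_ge0 (z - y); nra.
Qed.

End HilbertModuleBasics.

(** * Symmetric closed operators and surjectivity of their shifts *)

Section OperatorBasics.
Context {R : realType} {B : cstarAlgType R} {E : hilbertModType B}.
Implicit Types (S T : operator E) (x y z : E) (l : R[i]) (t : R).

Lemma dom0 S : dom S 0. Proof. by case: (dom_submodule S). Qed.

Lemma domD S x y : dom S x -> dom S y -> dom S (x + y).
Proof. by case: (dom_submodule S) => _ h _ _; exact: h. Qed.

Lemma domZ S l x : dom S x -> dom S (l *: x).
Proof. by case: (dom_submodule S) => _ _ h _; exact: h. Qed.

Lemma domM S x (b : B) : dom S x -> dom S (mact x b).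
Proof. by case: (dom_submodule S) => _ _ _ h; exact: h. Qed.

Lemma domN S x : dom S x -> dom S (- x).
Proof. by move=> Sx; rewrite -scaleN1r; exact: domZ. Qed.

Lemma domB S x y : dom S x -> dom S y -> dom S (x - y).
Proof. by move=> Sx Sy; apply: domD => //; exact: domN. Qed.

Lemma op0 S : S 0 = 0.
Proof. by rewrite -(scale0r 0) opZ ?scale0r //; exact: dom0. Qed.

Lemma opN S x : dom S x -> S (- x) = - S x.
Proof. by move=> Sx; rewrite -scaleN1r opZ // scaleN1r. Qed.

Lemma opB S x y : dom S x -> dom S y -> S (x - y) = S x - S y.
Proof. by move=> Sx Sy; rewrite opD ?opN //; exact: domN. Qed.

Definition opshift S l x : E := S x + l *: x.

Lemma opshiftZ S l (c : R[i]) x : dom S x -> opshift S l (c *: x) = c *: opshift S l x.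
Proof. by move=> Sx; rewrite /opshift opZ // scalerDr !scalerA mulrC. Qed.

Lemma opshiftD S l x y : dom S x -> dom S y ->
  opshift S l (x + y) = opshift S l x + opshift S l y.
Proof. by move=> Sx Sy; rewrite /opshift opD // scalerDr addrACA. Qed.

Lemma opshiftB S l x y : dom S x -> dom S y ->
  opshift S l (x - y) = opshift S l x - opshift S l y.
Proof. by move=> Sx Sy; rewrite /opshift opB // scalerBr opprD addrACA. Qed.

Definition symmetric_op S : Prop :=
  forall x y, dom S x -> dom S y -> inner (S x) y = inner x (S y).

Definition closed_op S : Prop := forall (u : nat -> E) x y,
  (forall n, dom S (u n)) -> tends u x -> tends (fun n => S (u n)) y ->
  dom S x /\ S x = y.

Definition onto_shift S l : Prop := forall y, exists2 x, dom S x & opshift S l x = y.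

Lemma self_adjoint_symmetric S : self_adjoint S -> symmetric_op S.
Proof. by move=> [_ Sadj] x y Sx Sy; have [_ ->] := Sadj y (S y). Qed.

Lemma self_adjoint_closed S : self_adjoint S -> closed_op S.
Proof.
move=> [_ Sadj] u x y Su ux Suy; apply/Sadj => v Sv.
apply: (tends_unique (tends_innerr (S v) ux)).
apply: tends_eq (tends_innerr v Suy) => n.
by have [_ ->] := Sadj (u n) (S (u n)).
Qed.

Lemma symmetric_inner_shift S l x y : symmetric_op S -> dom S x -> dom S y ->
  inner (opshift S l x) y = inner x (opshift S (Num.conj l) y).
Proof. by move=> Ssym Sx Sy; rewrite /opshift innerDl innerDr innerZl innerZr Ssym. Qed.

Lemma shift_conj_nrm S l x : symmetric_op S -> dom S x ->
  nrm (opshift S (Num.conj l) x) = nrm (opshift S l x).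
Proof.
move=> Ssym Sx; apply/eqP; rewrite -(@eqrXn2 _ 2) ?nrm_ge0 // -!nrm_sqr_inner.
apply/eqP; congr nrm; rewrite /opshift !innerDl !innerDr !innerZl !innerZr conjCK.
rewrite (Ssym x x Sx Sx) !scalerA [l * _]mulrC.
by rewrite [LHS](AC (2*2)%AC ((1*3)*(2*4))%AC).
Qed.

(** Symmetry cancels the cross terms in [b]. The identity holds in [B], so monotonicity of the norm
    yields both lower bounds that follow. *)
Lemma symmetric_shift_inner S (a b : R) x : symmetric_op S -> dom S x ->
  inner (opshift S (a +i* b) x) (opshift S (a +i* b) x) =
  inner (opshift S a%:C x) (opshift S a%:C x) + inner (b%:C *: x) (b%:C *: x).
Proof.
move=> Ssym Sx; have aJ (c : R) : Num.conj c%:C = c%:C :> R[i] by exact: conjc_real.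
have lJ : Num.conj (a +i* b) = a -i* b :> R[i] by [].
rewrite /opshift !innerDl !innerDr !innerZl !innerZr !aJ lJ (Ssym x x Sx Sx) !scalerA.
have -> : (a -i* b) * (a +i* b) = a%:C * a%:C + b%:C * b%:C :> R[i].
  by apply/eqP; rewrite eq_complex /=; apply/andP; split; apply/eqP; ring.
rewrite [in LHS]addrACA [in RHS]addrA; rewrite scalerDl [in LHS]addrA.
rewrite addrA; congr (_ + _ + _); rewrite -!addrA -!scalerDl; congr (_ + _ *: _).
by apply/eqP; rewrite eq_complex /= addNr addr0 !eqxx.
Qed.

Lemma shift_lower_bound S l x : symmetric_op S -> dom S x ->
  `|complex.Im l| * nrm x <= nrm (opshift S l x).
Proof.
move=> Ssym Sx; rewrite -(@ler_pXn2r _ 2) ?nnegrE ?mulr_ge0 ?nrm_ge0 //.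
rewrite -nrmZr -nrm_sqr_inner; case: l => a b /=; rewrite -(nrm_sqr_inner (opshift _ _ _)).
by rewrite symmetric_shift_inner // addrC cpositive_nrm_le //; exact: inner_ge0.
Qed.

Lemma op_le_shift_imag S (m : R) x : symmetric_op S -> dom S x ->
  nrm (S x) <= nrm (opshift S (0 +i* m) x).
Proof.
move=> Ssym Sx; rewrite -(@ler_pXn2r _ 2) ?nnegrE ?nrm_ge0 //.
rewrite -!nrm_sqr_inner symmetric_shift_inner // {2}/opshift scale0r addr0.
by rewrite /opshift scale0r addr0 cpositive_nrm_le //; exact: inner_ge0.
Qed.

(** Correcting by an approximate solution for the residual shrinks it geometrically. The
    approximations are Cauchy by [shift_lower_bound], and closedness identifies the limit; the
    approximate inverse may be neither linear nor bounded. *)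
Lemma onto_of_residual S l (q : R) : symmetric_op S -> closed_op S ->
  complex.Im l != 0 -> 0 <= q < 1 ->
  (forall y, exists2 x, dom S x & nrm (y - opshift S l x) <= q * nrm y) -> onto_shift S l.
Proof.
move=> Ssym Scl l0 /andP[q0 q1] res y.
have /choice[x xP] : forall n : nat, exists x : E,
    dom S x /\ nrm (y - opshift S l x) <= q ^+ n * nrm y.
  elim=> [|n [x [Sx xn]]].
    exists 0; split; first exact: dom0.
    by rewrite /opshift op0 scaler0 addr0 subr0 expr0 mul1r.
  have [z Sz zn] := res (y - opshift S l x); exists (x + z); split; first exact: domD.
  by rewrite opshiftD // opprD addrA (le_trans zn) // exprS -mulrA ler_wpM2l.
have Sxy : tends (fun n => opshift S l (x n)) y.
  apply: (tends_squeeze (a := fun n => nrm y * q ^+ n)).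
    by move=> n; rewrite nrm_distC mulrC; case: (xP n).
  rewrite -[X in _ --> X](mulr0 (nrm y)); apply: cvgMr; apply: cvg_expr.
  by rewrite ger0_norm.
have [|z xz] := @cauchy_tends _ _ x.
  move=> e e0; have Il : 0 < `|complex.Im l| by rewrite normr_gt0.
  have [|N HN] := tends_is_cauchy Sxy (e := `|complex.Im l| * e); first by rewrite mulr_gt0.
  exists N => m n Nm Nn; rewrite -(ltr_pM2l Il); apply: le_lt_trans (HN m n Nm Nn).
  have [[Sm _] [Sn _]] := (xP m, xP n).
  by rewrite -opshiftB //; apply: shift_lower_bound => //; exact: domB.
have [Sz Szy] : dom S z /\ S z = y - l *: z.
  apply: (Scl x) => //; first by move=> n; case: (xP n).
  apply: tends_eq (tendsB Sxy (tendsZ l xz)) => n; exact: addrK.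
by exists z => //; rewrite /opshift Szy subrK.
Qed.

Lemma onto_of_dense S l : symmetric_op S -> closed_op S -> complex.Im l != 0 ->
  dense (shift_range S l) -> onto_shift S l.
Proof.
move=> Ssym Scl l0 /denseP dS; apply: (@onto_of_residual _ _ (1 / 2)) => //; first by lra.
move=> y; have [y0|y0] := eqVneq (nrm y) 0.
  exists 0; first exact: dom0.
  by rewrite y0 mulr0 (nrm_eq0 y0) /opshift op0 scaler0 addr0 subrr nrm0.
have yp : 0 < nrm y by rewrite lt0r y0 nrm_ge0.
have [|_ [x Sx <-] xy] := dS y (1 / 2 * nrm y); first by rewrite mulr_gt0 // divr_gt0.
by exists x => //; exact: ltW.
Qed.

(* The Cayley transform [u = (S + conj l) (S + l)^-1 y] of [y] has the norm of
   [y]; up to a scalar, the residual of [x' = c (S + l)^-1 y] for [S + k] is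
   [(l - k) / (conj l - k) u]. *)
Lemma onto_shift_half_plane S l k : symmetric_op S -> closed_op S ->
  onto_shift S l -> 0 < complex.Im l * complex.Im k -> onto_shift S k.
Proof.
move=> Ssym Scl Sl lk.
pose d := Num.conj l - k.
have ltd : complex.Re `|l - k| < complex.Re `|d|.
  have [dR dI] : complex.Re d = complex.Re l - complex.Re k /\
      complex.Im d = - complex.Im l - complex.Im k by rewrite /d; case: (l) (k) => ? ? [].
  have [eR eI] : complex.Re (l - k) = complex.Re l - complex.Re k /\
      complex.Im (l - k) = complex.Im l - complex.Im k by case: (l) (k) => ? ? [].
  rewrite !normc_def /= dR dI eR eI ltr_sqrt; first by nra.
  by have := sqr_ge0 (complex.Re l - complex.Re k); nra.
have dp : 0 < complex.Re `|d|.
  apply: le_lt_trans ltd; rewrite normc_def /=; exact: sqrtr_ge0.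
have d0 : d != 0 by apply: contraTneq dp => ->; rewrite normr0 ltxx.
have k0 : complex.Im k != 0 by apply: contraTneq lk => ->; rewrite mulr0 ltxx.
apply: (@onto_of_residual _ _ (complex.Re `|l - k| / complex.Re `|d|)) => //.
  rewrite ltr_pdivrMr // mul1r ltd andbT divr_ge0 // ?(ltW dp) //.
  by rewrite normc_def /=; exact: sqrtr_ge0.
move=> y; have [x Sx xy] := Sl y.
exists ((Num.conj l - l) / d *: x); first exact: domZ.
have key : d *: (y - opshift S k ((Num.conj l - l) / d *: x)) =
    (l - k) *: opshift S (Num.conj l) x.
  rewrite opshiftZ // scalerBr scalerA mulrCA divff // mulr1 -xy /opshift.
  rewrite !scalerDr !scalerA opprD addrACA -scalerBl -scalerBl /d.
  congr (_ *: _ + _ *: _); ring.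
rewrite -(ler_pM2l dp) -nrmZ key nrmZ shift_conj_nrm // xy mulrA.
by rewrite (mulrC (complex.Re `|d|)) divfK ?gt_eqF.
Qed.

(** Equivalent to [self_adjoint_regular], but free of adjoints and with surjectivity at all nonreal
    points. *)
Record resolvable (S : operator E) : Prop := Resolvable {
  resolvable_sym : symmetric_op S;
  resolvable_closed : closed_op S;
  resolvable_dense : dense (dom S);
  resolvable_onto : forall l, complex.Im l != 0 -> onto_shift S l }.

Lemma resolvable_of_onto S (m : R) : symmetric_op S -> closed_op S -> dense (dom S) -> 0 < m ->
  onto_shift S (0 +i* m) -> onto_shift S (0 +i* (- m)) -> resolvable S.
Proof.
move=> Ssym Scl Sd m0 Sp Sm; split => // l l0.
have [lp|lm|lz] := ltgtP (complex.Im l) 0; last by rewrite lz eqxx in l0.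
  by apply: (onto_shift_half_plane _ _ Sm) => //=; nra.
by apply: (onto_shift_half_plane _ _ Sp) => //=; nra.
Qed.

Lemma resolvable_of_self_adjoint_regular S : self_adjoint_regular S -> resolvable S.
Proof.
move=> [Ssa [l [l0 dl dNl]]]; have Ssym := self_adjoint_symmetric Ssa.
have Scl := self_adjoint_closed Ssa; split => //; first by case: Ssa.
have ol := onto_of_dense Ssym Scl l0 dl.
have Nl0 : complex.Im (- l) != 0 by case: l l0 {dl dNl ol} => a b /=; rewrite oppr_eq0.
have oNl := onto_of_dense Ssym Scl Nl0 dNl.
move=> k k0; have NE : complex.Im (- l) = - complex.Im l by case: (l).
have [lk|lk|/eqP] := ltgtP 0 (complex.Im l * complex.Im k).
- exact: (onto_shift_half_plane _ _ ol).
- by apply: (onto_shift_half_plane _ _ oNl) => //; rewrite NE; nra.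
- by rewrite eq_sym mulf_eq0 (negPf l0) (negPf k0).
Qed.

Lemma self_adjoint_regular_of_resolvable S : resolvable S -> self_adjoint_regular S.
Proof.
move=> [Ssym Scl Sd So]; split; last first.
  exists (0 +i* 1); split => /=; first exact: oner_neq0.
    by apply/denseP => y t t0; have [|x Sx xy] := So (0 +i* 1) _ y;
      [exact: oner_neq0|exists y; [exists x | rewrite subrr nrm0]].
  apply/denseP => y t t0; have [|x Sx xy] := So (- (0 +i* 1)) _ y.
    by rewrite /= oppr_eq0 oner_neq0.
  by exists y; [exists x | rewrite subrr nrm0].
split=> // y z; split=> [yz|[Sy <-] x Sx]; last exact: Ssym.
(* For y in the domain of the adjoint, the solution x of (S + l) x = z + l y equals y: the
   difference y - x is orthogonal to the range of S + conj l, hence to itself. *)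
pose l : R[i] := 0 +i* 1.
have [|x Sx xE] := So l _ (z + l *: y); first exact: oner_neq0.
have [|v Sv vE] := So (Num.conj l) _ (y - x); first by rewrite /= oppr_eq0 oner_neq0.
have xy : x = y.
  apply/esym/eqP; rewrite -subr_eq0; apply/eqP/nrm_eq0/eqP.
  rewrite -sqrf_eq0 -nrm_sqr_inner -{1}vE innerDr innerNr.
  rewrite (symmetric_inner_shift _ Ssym Sv Sx) conjCK xE /opshift innerDl innerZl conjCK.
  by rewrite (yz v Sv) innerDr innerZr subrr nrm0.
subst x; split=> //; move: xE; rewrite /opshift => /addIr; exact.
Qed.

End OperatorBasics.

(** * Resolvents *)

Section Resolvent.
Context {R : realType} {B : cstarAlgType R} {E : hilbertModType B}.
Implicit Types (x y z : E) (m k t e : R).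

Definition im m : R[i] := 0 +i* m.

Lemma imN m : im (- m) = - im m.
Proof. by apply/eqP; rewrite eq_complex /= oppr0 !eqxx. Qed.

Lemma imM m k : im m * im k = (- (m * k))%:C.
Proof. by apply/eqP; rewrite eq_complex /= !mul0r mulr0 sub0r addr0 !eqxx. Qed.

Lemma nrm_im (V : normedModType R[i]) m (x : V) : nrm (im m *: x) = `|m| * nrm x.
Proof.
by rewrite nrmZ normc_def /= expr0n /= add0r sqrtr_sqr.
Qed.

Variable S : operator E.

(** Total in [m] and [y]; the default 0 is never reached for resolvable [S] and nonzero [m]. *)
Definition resolvent m y : E := xget 0 [set x | dom S x /\ opshift S (im m) x = y].
Local Notation Rs := resolvent.

Hypothesis gS : resolvable S.

Section FixedParameter.
Variable m : R.
Hypothesis m0 : m != 0.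

Lemma resolvent_spec y : dom S (Rs m y) /\ opshift S (im m) (Rs m y) = y.
Proof.
have [x Sx xy] := resolvable_onto gS (l := im m) m0 y.
exact: (xgetI (P := [set x | dom S x /\ opshift S (im m) x = y]) 0 (conj Sx xy)).
Qed.

Lemma resolvent_dom y : dom S (Rs m y). Proof. by case: (resolvent_spec y). Qed.

Lemma op_resolvent y : S (Rs m y) = y - im m *: Rs m y.
Proof. by case: (resolvent_spec y) => _ {2}<-; rewrite /opshift addrK. Qed.

Lemma shift_inj x : dom S x -> opshift S (im m) x = 0 -> x = 0.
Proof.
move=> Sx sx; have := shift_lower_bound (im m) (resolvable_sym gS) Sx.
rewrite sx nrm0 /= pmulr_rle0 ?normr_gt0 // => x0.
by apply/nrm_eq0/le_anti; rewrite x0 nrm_ge0.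
Qed.

Lemma resolvent_uniq x y : dom S x -> S x + im m *: x = y -> Rs m y = x.
Proof.
move=> Sx xy; apply/eqP; rewrite -subr_eq0; apply/eqP/shift_inj.
  by apply: domB => //; exact: resolvent_dom.
rewrite opshiftB //; last exact: resolvent_dom.
by rewrite (resolvent_spec y).2 /opshift xy subrr.
Qed.

Lemma resolvent_shift x : dom S x -> Rs m (S x + im m *: x) = x.
Proof. by move=> Sx; exact: resolvent_uniq. Qed.

Lemma resolventD x y : Rs m (x + y) = Rs m x + Rs m y.
Proof.
apply: resolvent_uniq; first by apply: domD; exact: resolvent_dom.
rewrite opD; [|exact: resolvent_dom|exact: resolvent_dom].
by rewrite !op_resolvent scalerDr addrACA !subrK.
Qed.

Lemma resolventZ (l : R[i]) x : Rs m (l *: x) = l *: Rs m x.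
Proof.
apply: resolvent_uniq; first by apply: domZ; exact: resolvent_dom.
rewrite opZ; last exact: resolvent_dom.
by rewrite op_resolvent scalerBr !scalerA [l * _]mulrC subrK.
Qed.

Lemma resolventM x (b : B) : Rs m (mact x b) = mact (Rs m x) b.
Proof.
apply: resolvent_uniq; first by apply: domM; exact: resolvent_dom.
rewrite opM; last exact: resolvent_dom.
by rewrite -mactZl -mactDl op_resolvent subrK.
Qed.

Lemma resolventN x : Rs m (- x) = - Rs m x.
Proof. by rewrite -scaleN1r resolventZ scaleN1r. Qed.

Lemma resolventB x y : Rs m (x - y) = Rs m x - Rs m y.
Proof. by rewrite resolventD resolventN. Qed.

Lemma resolvent_le x : `|m| * nrm (Rs m x) <= nrm x.
Proof.
have := shift_lower_bound (im m) (resolvable_sym gS) (resolvent_dom x).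
by rewrite (resolvent_spec x).2.
Qed.

Lemma op_resolvent_le x : nrm (S (Rs m x)) <= nrm x.
Proof.
have := op_le_shift_imag m (resolvable_sym gS) (resolvent_dom x).
by rewrite (resolvent_spec x).2.
Qed.

Lemma op_resolventC x : dom S x -> S (Rs m x) = Rs m (S x).
Proof.
move=> Sx; rewrite op_resolvent -{1}(resolvent_shift Sx) -resolventZ -resolventB.
by rewrite addrK.
Qed.

Lemma resolvent_tends (u : nat -> E) x : tends u x -> tends (fun n => Rs m (u n)) (Rs m x).
Proof.
apply: (tends_bounded (c := `|m|^-1)) => n.
by rewrite -resolventB -ler_pdivrMl ?invr_gt0 ?normr_gt0 // invrK resolvent_le.
Qed.

End FixedParameter.

Lemma resolvent_comm m k x : m != 0 -> k != 0 -> Rs m (Rs k x) = Rs k (Rs m x).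
Proof.
move=> m0 k0; have dk y := resolvent_dom k0 y.
apply: resolvent_uniq => //.
rewrite op_resolventC //; last exact: resolvent_dom.
by rewrite -resolventZ // -resolventD // op_resolvent // subrK.
Qed.

Lemma resolvent_adj m x y : m != 0 -> inner (Rs m x) y = inner x (Rs (- m) y).
Proof.
move=> m0; have Nm0 : - m != 0 by rewrite oppr_eq0.
have [d2 e2] := resolvent_spec Nm0 y; have [d1 e1] := resolvent_spec m0 x.
rewrite -{1}e2 -{2}e1 (symmetric_inner_shift (im m) (resolvable_sym gS) d1 d2).
by [].
Qed.

Lemma resolvent_approx x e : 0 < e -> exists2 M, 0 < M &
  forall m, M <= `|m| -> nrm (x - im m *: Rs m x) <= e.
Proof.
move=> e0; have [|y Sy xy] := (denseP _).1 (resolvable_dense gS) x (e / 3);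
  first by rewrite divr_gt0.
(* Chosen so that |R_m S y| <= |S y| / |m| <= e / 3; the summand 1 keeps the threshold positive. *)
exists (3 * nrm (S y) / e + 1) => [|m Mm].
  by rewrite ltr_wpDl // divr_ge0 ?mulr_ge0 ?nrm_ge0 // ltW.
have mp : 0 < `|m|.
  by apply: lt_le_trans Mm; rewrite ltr_wpDl // divr_ge0 ?mulr_ge0 ?nrm_ge0 // ltW.
have m0 : m != 0 by rewrite -normr_gt0.
have -> : x - im m *: Rs m x = (x - y) + (S (Rs m y) - im m *: Rs m (x - y)).
  rewrite op_resolvent // resolventB // scalerBr opprB.
  by rewrite [RHS](AC ((1*1)*((1*1)*(1*1)))%AC ((1*6)*((3*2)*(5*4)))%AC) /= !subrr !addr0.
have h1 := nrmD (x - y) (S (Rs m y) - im m *: Rs m (x - y)).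
have h2 := nrmB (S (Rs m y)) (im m *: Rs m (x - y)).
have h3 := resolvent_le m0 (x - y); have h4 := resolvent_le m0 (S y).
rewrite nrm_im op_resolventC // in h2; rewrite op_resolventC // in h1.
have h5 : nrm (Rs m (S y)) <= e / 3.
  rewrite -(ler_pM2l mp) (le_trans h4) //.
  have : (3 * nrm (S y) / e + 1) * (e / 3) <= `|m| * (e /
    3) by rewrite ler_wpM2r // divr_ge0 // ltW.
  have -> : (3 * nrm (S y) / e + 1) * (e / 3) = nrm (S y) + e / 3 by field; rewrite gt_eqF.
  by lra.
rewrite op_resolventC //; lra.
Qed.

Lemma im_resolvent_le m x : m != 0 -> nrm (im m *: Rs m x) <= nrm x.
Proof. by move=> m0; rewrite nrm_im resolvent_le. Qed.

(** This is m^2 (S^2 + m^2)^-1, an even function of [S]: passing [T] through it flips the sign of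
    [S] twice, hence a commutator rather than an anticommutator. *)
Definition smoothing m x : E := (m ^+ 2)%:C *: Rs m (Rs (- m) x).

Lemma smoothingE m x : m != 0 -> smoothing m x = im m *: Rs m (im (- m) *: Rs (- m) x).
Proof.
by move=> m0; rewrite resolventZ // scalerA imM mulrN opprK -expr2.
Qed.

Lemma smoothing_le m x : m != 0 -> nrm (smoothing m x) <= nrm x.
Proof.
move=> m0; rewrite smoothingE // (le_trans (im_resolvent_le _ m0)) //.
by rewrite im_resolvent_le // oppr_eq0.
Qed.

Lemma smoothing_approx x e : 0 < e -> exists2 M, 0 < M &
  forall m, M <= `|m| -> nrm (x - smoothing m x) <= e.
Proof.
move=> e0; have [|M M0 MP] := @resolvent_approx x (e / 2); first by rewrite divr_gt0.
exists M => // m Mm; have mp : 0 < `|m| by exact: lt_le_trans Mm.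
have m0 : m != 0 by rewrite -normr_gt0.
rewrite smoothingE //.
have -> : x - im m *: Rs m (im (- m) *: Rs (- m) x) =
   (x - im m *: Rs m x) + im m *: Rs m (x - im (- m) *: Rs (- m) x).
  by rewrite (resolventB m0 x) scalerBr addrA subrK.
rewrite (le_trans (nrmD _ _)) // [e]splitr lerD ?MP //.
by rewrite (le_trans (im_resolvent_le _ m0)) // MP // normrN.
Qed.

End Resolvent.

(** * Weak anticommutation *)

(** Three sequences match the three terms of [norm_bound]; a zero sequence fills a spare slot. *)
Lemma cauchy_dom3 (R : realType) (V1 V2 V3 W : normedModType R[i])
    (u : nat -> V1) (v : nat -> V2) (z : nat -> V3) (w : nat -> W) (a : R) :
  tends_cauchy u -> tends_cauchy v -> tends_cauchy z ->
  (forall m n, nrm (w m - w n) <=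
     a * (nrm (u m - u n) + nrm (v m - v n) + nrm (z m - z n))) ->
  tends_cauchy w.
Proof.
move=> cu cv cz h e e0; have ap : 0 < 3 * (`|a| + 1) by rewrite mulr_gt0 // ltr_wpDl.
have d0 : 0 < e / (3 * (`|a| + 1)) by rewrite divr_gt0.
have [N1 H1] := cu _ d0; have [N2 H2] := cv _ d0; have [N3 H3] := cz _ d0.
exists (N1 + N2 + N3)%N => m n.
rewrite -addnA => Nm Nn.
have l1 k : (N1 + (N2 + N3) <= k)%N -> (N1 <= k)%N by apply: leq_trans; exact: leq_addr.
have l2 k : (N1 + (N2 + N3) <= k)%N -> (N2 <= k)%N.
  by apply: leq_trans; rewrite addnCA leq_addr.
have l3 k : (N1 + (N2 + N3) <= k)%N -> (N3 <= k)%N.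
  by apply: leq_trans; rewrite addnA leq_addl.
have := H1 m n (l1 _ Nm) (l1 _ Nn); have := H2 m n (l2 _ Nm) (l2 _ Nn).
have := H3 m n (l3 _ Nm) (l3 _ Nn); rewrite !ltr_pdivlMr // => h3 h2 h1.
apply: le_lt_trans (h m n) _; set s := _ + _ + _.
have s0 : 0 <= s by rewrite !addr_ge0 ?nrm_ge0.
apply: (@le_lt_trans _ _ ((`|a| + 1) * s)).
  by rewrite ler_wpM2r // ler_wpDr // ler_norm.
rewrite /s; nra.
Qed.

Section AnticommutatorDomain.
Context {R : realType} {B : cstarAlgType R} {E : hilbertModType B}.
Implicit Types (S T : operator E) (x y : E).

Lemma comm_domC S T x : comm_dom S T x -> comm_dom T S x.
Proof. by case. Qed.

Lemma anticommC S T x : anticomm S T x = anticomm T S x.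
Proof. exact: addrC. Qed.

Lemma comm_domB S T x y : comm_dom S T x -> comm_dom S T y -> comm_dom S T (x - y).
Proof.
move=> [Sx Tx TSx STx] [Sy Ty TSy STy].
by split; rewrite ?opB //; exact: domB.
Qed.

Lemma comm_domZ S T (l : R[i]) x : comm_dom S T x -> comm_dom S T (l *: x).
Proof. by move=> [Sx Tx TSx STx]; split; rewrite ?opZ //; exact: domZ. Qed.

Lemma anticommB S T x y : comm_dom S T x -> comm_dom S T y ->
  anticomm S T (x - y) = anticomm S T x - anticomm S T y.
Proof.
move=> [Sx Tx TSx STx] [Sy Ty TSy STy].
by rewrite /anticomm !opB // opprD addrACA.
Qed.

Lemma anticommZ S T (l : R[i]) x : comm_dom S T x ->
  anticomm S T (l *: x) = l *: anticomm S T x.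
Proof. by move=> [Sx Tx TSx STx]; rewrite /anticomm !opZ // scalerDr. Qed.

Lemma inner_anticomm S T x y : symmetric_op S -> symmetric_op T ->
  comm_dom S T x -> dom S y -> dom T y ->
  inner (anticomm S T x) y = inner (T x) (S y) + inner (S x) (T y).
Proof.
by move=> Ss Ts [Sx Tx TSx STx] Sy Ty; rewrite /anticomm innerDl (Ss _ y STx) // (Ts _ y TSx).
Qed.

End AnticommutatorDomain.

(** The scalar shadow of [anticomm_bound], on which the resolvent estimates rest. The bound in the
    order of [B] itself returns in [sum_estimate] and [sum_anticomm_bound]. *)
Definition norm_bound {R : realType} {B : cstarAlgType R} {E : hilbertModType B}
    (S T : operator E) (C : R) : Prop := forall x, comm_dom S T x ->
  nrm (anticomm S T x) <= C * (nrm x + nrm (S x) + nrm (T x)).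

Lemma anticomm_bound_norm (R : realType) (B : cstarAlgType R) (E : hilbertModType B)
    (S T : operator E) : anticomm_bound S T -> exists2 C, 0 <= C & norm_bound S T C.
Proof.
move=> [C0 [C1 [C2 [c0 c1 c2 b]]]]; exists (1 + C0 + C1 + C2); first by lra.
move=> x Fx; have h := cpositive_nrm_le (inner_ge0 (anticomm S T x)) (b x Fx).
rewrite addrC subrK nrm_sqr_inner in h.
have := le_trans (le_trans h (nrmD _ _)) (lerD (nrmD _ _) (lexx _)).
rewrite !nrmZr !nrm_sqr_inner !gtr0_norm // => {}h.
rewrite -(@ler_pXn2r _ 2) ?nnegrE ?nrm_ge0 ?mulr_ge0 ?addr_ge0 ?nrm_ge0 //; try lra.
apply: (le_trans h); have := nrm_ge0 x; have := nrm_ge0 (S x); have := nrm_ge0 (T x).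
move: (nrm x) (nrm (S x)) (nrm (T x)) => p q r r0 q0 p0.
have s0 : 0 <= p + q + r by lra.
have h1 : p ^+ 2 <= (p + q + r) ^+ 2 by nra.
have h2 : q ^+ 2 <= (p + q + r) ^+ 2 by nra.
have h3 : r ^+ 2 <= (p + q + r) ^+ 2 by nra.
rewrite exprMn; set s := (p + q + r) ^+ 2 in h1 h2 h3 *.
have sp : 0 <= s by exact: sqr_ge0.
have k : C0 + C1 + C2 <= (1 + C0 + C1 + C2) ^+ 2 by nra.
apply: (@le_trans _ _ ((C0 + C1 + C2) * s)); last by rewrite ler_wpM2r.
nra.
Qed.

Section ResolventCommutation.
Context {R : realType} {B : cstarAlgType R} {E : hilbertModType B}.
Variables (S T : operator E) (C m : R).
Hypotheses (gS : resolvable S) (C0 : 0 <= C) (bST : norm_bound S T C).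
Hypotheses (m1 : 1 <= `|m|) (mC : 2 * C <= `|m|).
Local Notation Rs := (resolvent S).
Local Notation K := (anticomm S T).
Implicit Types x : E.

Fact parameter_neq0 : m != 0.
Proof. by rewrite -normr_gt0 (lt_le_trans ltr01). Qed.

Fact opp_parameter_neq0 : - m != 0.
Proof. by rewrite oppr_eq0 parameter_neq0. Qed.

(** Moving [T] past S + i m turns S into - S but leaves i m alone, which is why the resolvent at - m
    appears. *)
Lemma op_resolvent_anticomm x : dom T x -> comm_dom S T (Rs m x) ->
  T (Rs m x) = Rs (- m) (K (Rs m x) - T x).
Proof.
move=> Tx [Sv Tv TSv STv]; have m0 := parameter_neq0.
apply/esym/(resolvent_uniq gS opp_parameter_neq0) => //.
rewrite /anticomm op_resolvent // opB //; last exact: domZ.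
by rewrite opZ // imN scaleNr [T x - _]addrC addrA addrK.
Qed.

(** The term C |T R_m x| coming from [K] is absorbed on the left thanks to 2 C <= |m|, which doubles
    the remaining terms. *)
Lemma op_resolvent_anticomm_le x : dom T x -> comm_dom S T (Rs m x) ->
  `|m| * nrm (T (Rs m x)) <= (2 + 4 * C) * (nrm (T x) + nrm x).
Proof.
move=> Tx Fv; have m0 := parameter_neq0.
have h1 := resolvent_le gS opp_parameter_neq0 (K (Rs m x) - T x).
rewrite -op_resolvent_anticomm // normrN in h1.
have h2 := nrmB (K (Rs m x)) (T x); have h3 := bST Fv.
have h4 := resolvent_le gS m0 x; have h5 := op_resolvent_le gS m0 x.
have h6 := nrm_ge0 (Rs m x); have h7 := nrm_ge0 (T (Rs m x)).
have h8 := nrm_ge0 x; have h9 := nrm_ge0 (T x).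
have h10 : nrm (Rs m x) <= nrm x by apply: le_trans h4; rewrite ler_peMl.
have h11 : C * (nrm (Rs m x) + nrm (S (Rs m x)) + nrm (T (Rs m x)))
   <= C * (2 * nrm x + nrm (T (Rs m x))) by rewrite ler_wpM2l //; lra.
have h12 := ler_wpM2r h7 mC; have h13 := mulr_ge0 C0 h9; have h14 := mulr_ge0 C0 h8.
lra.
Qed.

End ResolventCommutation.

(* The core of [anticomm_core] is enlarged to all of [dom T]; [L] is a threshold
   for the resolvents of [S] to preserve [dom T]. *)
Record anticommuting {R : realType} {B : cstarAlgType R} {E : hilbertModType B}
    (S T : operator E) (C L : R) : Prop := Anticommuting {
  anticommuting_resolvablel : resolvable S;
  anticommuting_resolvabler : resolvable T;
  anticommuting_C0 : 0 <= C;
  anticommuting_L1 : 1 <= L;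
  anticommuting_LC : 2 * C <= L;
  anticommuting_bound : norm_bound S T C;
  anticommuting_dom : forall m x, L <= `|m| -> dom T x -> comm_dom S T (resolvent S m x) }.

(** * From a core to the whole domain *)

Section CoreExtension.
Context {R : realType} {B : cstarAlgType R} {E : hilbertModType B}.
Implicit Types (S T : operator E) (V : set E) (x : E).

Lemma graph_norm_lt T x (e : R) : graph_norm T x < e%:C -> nrm x < e /\ nrm (T x) < e.
Proof.
rewrite /graph_norm nrmE => h; set N := nrm _ in h.
have N0 : 0 <= N%:C :> R[i] by rewrite ler0c nrm_ge0.
have e0 : 0 < e.
  rewrite -ltcR; apply: le_lt_trans h; by rewrite sqrtC_ge0.
have Ne : N < e ^+ 2.
  rewrite -ltcR rmorphXn /= -[N%:C]sqrtCK ltr_pXn2r // ?nnegrE ?sqrtC_ge0 //.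
  by rewrite ler0c ltW.
split; rewrite -(@ltr_pXn2r _ 2) ?nnegrE ?nrm_ge0 ?(ltW e0) //; apply: le_lt_trans Ne.
  exact: nrm_le_inner_add.
by rewrite /N addrC; exact: nrm_le_inner_add.
Qed.

Lemma core_seq T V x : core T V -> dom T x ->
  exists u : nat -> E, [/\ forall n, V (u n), tends u x & tends (fun n => T (u n)) (T x)].
Proof.
move=> [_ VT Vd] Tx.
have /choice[u uP] : forall n : nat, exists y : E,
    [/\ V y, nrm (y - x) <= n.+1%:R^-1 & nrm (T y - T x) <= n.+1%:R^-1].
  move=> n; have [|y Vy] := Vd x Tx (n.+1%:R^-1 : R)%:C; first by rewrite ltcR invr_gt0.
  move=> /graph_norm_lt; rewrite opB //; last exact: VT.
  by move=> [h1 h2]; exists y; split=> //; rewrite nrm_distC ltW.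
exists u; split; first by move=> n; case: (uP n).
  apply: (tends_squeeze (a := fun n => n.+1%:R^-1)); first by move=> n; case: (uP n).
  exact: cvg_harmonic.
apply: (tends_squeeze (a := fun n => n.+1%:R^-1)); first by move=> n; case: (uP n).
exact: cvg_harmonic.
Qed.

(** On the core, T R_m is bounded for the graph norm of [T], so closedness of [T] extends the
    inclusion to dom T. The threshold adds up the three requirements on |m|. *)
Lemma anticommuting_of_core S T V (C l0 : R) : resolvable S -> resolvable T -> 0 <= C ->
  norm_bound S T C ->
  core T V -> (forall m, l0 <= `|m| -> resolvent_image S (im m) V `<=` comm_dom S T) ->
  anticommuting S T C (1 + 2 * C + `|l0|).
Proof.
move=> gS gT C0 bST cV HV; split=> //; try by have := normr_ge0 l0; lra.
move=> m x Lm Tx; have l0m : l0 <= `|m| by have := ler_norm l0; lra.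
have m1 : 1 <= `|m| by have := normr_ge0 l0; lra.
have mC : 2 * C <= `|m| by have := normr_ge0 l0; lra.
have m0 : m != 0 by exact: parameter_neq0 m1.
have Nm0 : - m != 0 by rewrite oppr_eq0.
have Fu y : V y -> comm_dom S T (resolvent S m y).
  move=> Vy; apply: (HV m l0m); split; first exact: resolvent_dom.
  by have := (resolvent_spec gS m0 y).2; rewrite /opshift => ->.
have [u [Vu ux Tux]] := core_seq cV Tx.
have VT : V `<=` dom T by case: cV.
have Vsub : submodule V by case: cV.
set v := resolvent S m x; pose w n := resolvent S m (u n).
have wv : tends w v by exact: resolvent_tends.
have Sw : tends (fun n => S (w n)) (S v).
  rewrite /v op_resolvent //.
  by apply: tends_eq (tendsB ux (tendsZ (im m) wv)) => n; rewrite [RHS]op_resolvent.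
have z0 : tends_cauchy (fun=> 0 : E) by exact: tends_is_cauchy (tends_cst 0).
have [|t Twt] := @cauchy_tends _ _ (fun n => T (w n)).
  apply: (cauchy_dom3 (tends_is_cauchy Tux) (tends_is_cauchy ux) z0 (a := 2 + 4 * C)).
  move=> i j; rewrite subrr nrm0 addr0.
  have Vij : V (u i - u j).
    case: Vsub => _ VD VZ _; rewrite -scaleN1r; apply: VD => //; exact: VZ.
  have Fij := Fu _ Vij; have := op_resolvent_anticomm_le gS C0 bST m1 mC (VT _ Vij) Fij.
  rewrite resolventB // opB; [|by case: (Fu _ (Vu i))|by case: (Fu _ (Vu j))].
  rewrite opB; [|exact: VT|exact: VT]; apply: le_trans.
  by rewrite ler_peMl // nrm_ge0.
have [Tv Tvt] : dom T v /\ T v = t.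
  by apply: (resolvable_closed gT) wv Twt => n; case: (Fu _ (Vu n)).
subst t.
have [|k Kwk] := @cauchy_tends _ _ (fun n => anticomm S T (w n)).
  apply: (cauchy_dom3 (tends_is_cauchy wv) (tends_is_cauchy Sw) (tends_is_cauchy Twt) (a := C)).
  move=> i j; have [Fi Fj] := (Fu _ (Vu i), Fu _ (Vu j)).
  rewrite -anticommB // (le_trans (bST _ (comm_domB Fi Fj))) //.
  by case: Fi => Si Ti _ _; case: Fj => Sj Tj _ _; rewrite !opB.
split=> //; first exact: resolvent_dom.
  by rewrite /v op_resolvent //; apply: domB => //; exact: domZ.
(* Membership in dom S is read off from the range of a resolvent, once T v is written as such a
   value. *)
suff -> : T v = resolvent S (- m) (k - T x) by exact: resolvent_dom.
apply: (tends_unique Twt); apply: tends_eq (resolvent_tends gS Nm0 (tendsB Kwk Tux)) => n.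
by rewrite -(op_resolvent_anticomm gS m1) //; [exact: VT | exact: Fu].
Qed.

Lemma weakly_anticommuting_resolvent S T : weakly_anticommuting S T ->
  exists C L, anticommuting S T C L.
Proof.
move=> [sS sT /anticomm_bound_norm[C C0 bST] [V [l0 [cV l00 HV]]]].
exists C, (1 + 2 * C + `|l0|); apply: (anticommuting_of_core (V := V)) => //.
- exact: resolvable_of_self_adjoint_regular.
- exact: resolvable_of_self_adjoint_regular.
move=> m l0m; apply: HV => //.
by rewrite normc_def /= expr0n /= add0r sqrtr_sqr lecR.
Qed.

End CoreExtension.

(** * Regularization by resolvents *)

Section Regularization.
Context {R : realType} {B : cstarAlgType R} {E : hilbertModType B}.
Variables (S T : operator E) (C L : R).
Hypothesis W : anticommuting S T C L.
Local Notation Rs := (resolvent S).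
Local Notation K := (anticomm S T).
Implicit Types (x y : E) (m : R).

Let gS := anticommuting_resolvablel W.
Let gT := anticommuting_resolvabler W.

Lemma anticommuting_ge1 m : L <= `|m| -> 1 <= `|m|.
Proof. by apply: le_trans; case: W. Qed.

Lemma anticommuting_neq0 m : L <= `|m| -> m != 0.
Proof. by move=> Lm; rewrite -normr_gt0 (lt_le_trans ltr01) // anticommuting_ge1. Qed.

Lemma anticommuting_opp_neq0 m : L <= `|m| -> - m != 0.
Proof. by move=> /anticommuting_neq0; rewrite oppr_eq0. Qed.

Lemma anticommuting_resolvent m x : L <= `|m| -> dom T x ->
  T (Rs m x) = Rs (- m) (K (Rs m x)) - Rs (- m) (T x).
Proof.
move=> Lm Tx; rewrite -(resolventB gS) ?anticommuting_opp_neq0 //.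
rewrite -(op_resolvent_anticomm gS (anticommuting_ge1 Lm)) //;
  exact: anticommuting_dom W _ _ Lm Tx.
Qed.

Lemma anticommuting_op_resolvent_le m x : L <= `|m| -> dom T x ->
  `|m| * nrm (T (Rs m x)) <= (2 + 4 * C) * (nrm (T x) + nrm x).
Proof.
move=> Lm Tx; apply: (op_resolvent_anticomm_le gS (anticommuting_C0 W) (anticommuting_bound
  W)) => //.
- exact: anticommuting_ge1.
- by apply: le_trans Lm; case: W.
- exact: anticommuting_dom W _ _ Lm Tx.
Qed.

Definition reg_param (n : nat) : R := L + n%:R.

Lemma reg_param_ge n : L <= `|reg_param n|.
Proof. by rewrite (le_trans _ (ler_norm _)) // lerDl. Qed.

Lemma reg_param_large (M : R) : exists N, forall n, (N <= n)%N -> M <= `|reg_param n|.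
Proof.
exists (Num.bound `|M|) => n Nn; rewrite (le_trans _ (ler_norm _)) //.
have := archi_boundP (normr_ge0 M); rewrite -(ler_nat R) in Nn.
by have L1 := anticommuting_L1 W; have := ler_norm M; rewrite /reg_param => h1 h2; lra.
Qed.

(** Approximations of the identity with values in dom S. Moving [T] through [regularize] produces
    [regularizeN], because the sign of [S] flips. *)
Definition regularize (n : nat) x : E := im (reg_param n) *: Rs (reg_param n) x.
Definition regularizeN (n : nat) x : E := im (- reg_param n) *: Rs (- reg_param n) x.

Lemma reg_tends x : tends (fun n => regularize n x) x.
Proof.
apply/tendsP => e e0; have [|M _ MP] := @resolvent_approx _ _ _ _ gS x (e / 2).
  by rewrite divr_gt0.
have [N HN] := reg_param_large M; exists N => n /HN /MP.
by rewrite nrm_distC => h; rewrite (le_lt_trans h) //; lra.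
Qed.

Lemma regN_tends x : tends (fun n => regularizeN n x) x.
Proof.
apply/tendsP => e e0; have [|M _ MP] := @resolvent_approx _ _ _ _ gS x (e / 2).
  by rewrite divr_gt0.
have [N HN] := reg_param_large M; exists N => n /HN; rewrite -normrN => /MP.
by rewrite nrm_distC => h; rewrite (le_lt_trans h) //; lra.
Qed.

Lemma resolvent_tends0 (u : nat -> E) (c : R) : (forall n, nrm (u n) <= c) ->
  tends (fun n => Rs (- reg_param n) (u n)) 0.
Proof.
move=> uc; apply/tendsP => e e0; have [N HN] := reg_param_large ((c + 1) / e).
exists N => n /HN h; rewrite subr0.
have m0 := anticommuting_opp_neq0 (reg_param_ge n); have := resolvent_le gS m0 (u n).
have mp := lt_le_trans ltr01 (anticommuting_ge1 (reg_param_ge n)).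
rewrite normrN => h2; rewrite -(ltr_pM2l mp); apply: (le_lt_trans h2).
move: h; rewrite ler_pdivrMr // => h; have := uc n; lra.
Qed.

(** S R_(-m) is the identity minus [regularizeN], which converges strongly to the identity and is
    bounded by 1. *)
Lemma op_resolvent_tends0 (u : nat -> E) y : tends u y ->
  tends (fun n => S (Rs (- reg_param n) (u n))) 0.
Proof.
move=> uy; have ru : tends (fun n => regularizeN n (u n)) y.
  apply: (tends_squeeze (a := fun n => nrm (u n - y) + nrm (regularizeN n y - y))).
    move=> n; have m0 := anticommuting_opp_neq0 (reg_param_ge n).
    have -> : regularizeN n (u n) - y = regularizeN n (u n - y) + (regularizeN n y - y).
      by rewrite /regularizeN (resolventB gS m0) scalerBr addrA subrK.
    by rewrite (le_trans (nrmD _ _)) // lerD2r im_resolvent_le.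
  by rewrite -[0]addr0; apply: cvgD => //; exact: regN_tends.
rewrite -(subrr y); apply: tends_eq (tendsB uy ru) => n.
by rewrite op_resolvent //; exact: anticommuting_opp_neq0 (reg_param_ge n).
Qed.

Lemma reg_comm_dom n x : dom T x -> comm_dom S T (regularize n x).
Proof. by move=> Tx; apply/comm_domZ/(anticommuting_dom W _ Tx)/reg_param_ge. Qed.

Lemma op_reg n x : dom S x -> S (regularize n x) = regularize n (S x).
Proof.
move=> Sx; have m0 := anticommuting_neq0 (reg_param_ge n).
rewrite /regularize opZ; last exact: resolvent_dom.
by rewrite op_resolventC.
Qed.

Lemma op_regN n x : dom S x -> S (regularizeN n x) = regularizeN n (S x).
Proof.
move=> Sx; have m0 := anticommuting_opp_neq0 (reg_param_ge n).
rewrite /regularizeN opZ; last exact: resolvent_dom.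
by rewrite op_resolventC.
Qed.

Lemma anticomm_op_reg n x : dom T x ->
  T (regularize n x) = regularizeN n (T x) + Rs (- reg_param n) (K (regularize n x)).
Proof.
move=> Tx; have Lm := reg_param_ge n; have [Sv Tv _ _] := anticommuting_dom W Lm Tx.
have Nm0 := anticommuting_opp_neq0 Lm.
rewrite /regularize opZ // anticommuting_resolvent // scalerBr anticommZ;
  last exact: anticommuting_dom W _ _ Lm Tx.
by rewrite resolventZ // /regularizeN imN scaleNr addrC.
Qed.

Lemma anticomm_reg_bounded x : dom S x -> dom T x ->
  exists c : R, forall n, nrm (K (regularize n x)) <= c.
Proof.
move=> Sx Tx; exists (C * (nrm x + nrm (S x) + (2 + 4 * C) * (nrm (T x) + nrm x))) => n.
apply: (le_trans (anticommuting_bound W (reg_comm_dom n Tx))); apply: ler_wpM2l;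
  first exact: anticommuting_C0 W.
have Lm := reg_param_ge n; have m0 := anticommuting_neq0 Lm.
rewrite op_reg //; apply: lerD; first by apply: lerD; exact: im_resolvent_le.
rewrite /regularize opZ ?nrm_im; last by case: (anticommuting_dom W Lm Tx).
exact: anticommuting_op_resolvent_le.
Qed.

Lemma op_reg_tends x : dom S x -> tends (fun n => S (regularize n x)) (S x).
Proof. by move=> Sx; apply: tends_eq (reg_tends (S x)) => n; rewrite op_reg. Qed.

Lemma anticomm_op_reg_tends x : dom S x -> dom T x -> tends (fun n => T (regularize n x)) (T x).
Proof.
move=> Sx Tx; have [c hc] := anticomm_reg_bounded Sx Tx.
rewrite -[T x]addr0; apply: tends_eq (tendsD (regN_tends (T x)) (resolvent_tends0 hc)) => n.
by rewrite anticomm_op_reg.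
Qed.

(** The bound makes [K] continuous for the joint graph norm, so it has a limit even at points of dom
    S and dom T where [S, T] itself is undefined. *)
Lemma anticomm_reg_cvg x : dom S x -> dom T x -> exists k, tends (fun n => K (regularize n x)) k.
Proof.
move=> Sx Tx; apply: cauchy_tends.
apply: (cauchy_dom3 (tends_is_cauchy (reg_tends x)) (tends_is_cauchy (op_reg_tends Sx))
  (tends_is_cauchy (anticomm_op_reg_tends Sx Tx)) (a := C)) => i j.
have [Fi Fj] := (reg_comm_dom i Tx, reg_comm_dom j Tx).
rewrite -anticommB // (le_trans (anticommuting_bound W (comm_domB Fi Fj))) //.
by case: Fi => Si Ti _ _; case: Fj => Sj Tj _ _; rewrite !opB.
Qed.

(** Of the two second-order conditions one implies the other: along regularized vectors T S = K - S
    T converges, and [T] is closed. *)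
Lemma comm_dom_of_op x : dom S x -> dom T x -> dom S (T x) -> comm_dom S T x.
Proof.
move=> Sx Tx STx; have [k hk] := anticomm_reg_cvg Sx Tx.
suff [TSx _] : dom T (S x) /\ T (S x) = k - S (T x) by [].
apply: (resolvable_closed gT) (op_reg_tends Sx) _.
  by move=> n; case: (reg_comm_dom n Tx).
have ST : tends (fun n => S (T (regularize n x))) (S (T x)).
  have h1 : tends (fun n => regularizeN n (S (T x))) (S (T x)) by exact: regN_tends.
  rewrite -[S (T x)]addr0; apply: tends_eq (tendsD h1 (op_resolvent_tends0 hk)) => n.
  have Nm0 := anticommuting_opp_neq0 (reg_param_ge n).
  rewrite -op_regN // anticomm_op_reg // opD //; last exact: resolvent_dom.
  by apply: domZ; exact: resolvent_dom.
apply: tends_eq (tendsB hk ST) => n; rewrite /anticomm addrAC subrr add0r //.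
Qed.

End Regularization.

(** * Commutators with functions of the first operator *)

Section Truncation.
Context {R : realType} {B : cstarAlgType R} {E : hilbertModType B}.
Variable S : operator E.
Hypothesis gS : resolvable S.
Local Notation Rs := (resolvent S).
Local Notation J := (smoothing S).
Implicit Types (x y : E) (m n : R).

Lemma smoothing_subZ m (l : R[i]) x y : m != 0 -> J m (y - l *: x) = J m y - l *: J m x.
Proof.
move=> m0; have Nm0 : - m != 0 by rewrite oppr_eq0.
rewrite /smoothing (resolventB gS Nm0) (resolventB gS m0) (resolventZ gS Nm0).
by rewrite (resolventZ gS m0) scalerBr !scalerA mulrC.
Qed.

(* The bounded operator [S J]; see [truncationE]. *)
Definition truncation m x : E := (m ^+ 2 / 2)%:C *: (Rs m x + Rs (- m) x).

Lemma truncationE m x : m != 0 -> S (J m x) = truncation m x.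
Proof.
move=> m0; have Nm0 : - m != 0 by rewrite oppr_eq0.
have dm := resolvent_dom gS m0; have dN := resolvent_dom gS Nm0.
rewrite /smoothing opZ // /truncation.
have -> : Rs m x = Rs (- m) x - (im m *: Rs m (Rs (- m) x) + im m *: Rs m (Rs (- m) x)).
  rewrite -{1}(resolvent_spec gS Nm0 x).2 /opshift imN scaleNr resolventB // resolventZ //.
  by rewrite -op_resolventC // op_resolvent // opprD addrA.
rewrite op_resolvent //; set v := Rs (- m) x; set a := im m *: _.
have -> : v - (a + a) + v = (2 : R)%:C *: (v - a).
  rewrite rmorphD /= scalerDl scale1r opprD.
  by rewrite [LHS](AC ((1*2)*1)%AC ((1*2)*(4*3))%AC).
by rewrite scalerA -rmorphM /= divfK.
Qed.

Lemma smoothing_opC m x : m != 0 -> dom S x -> S (J m x) = J m (S x).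
Proof.
move=> m0 Sx; have Nm0 : - m != 0 by rewrite oppr_eq0.
have dm := resolvent_dom gS m0; have dN := resolvent_dom gS Nm0.
by rewrite /smoothing opZ // !op_resolventC.
Qed.

Lemma smoothingN m x : m != 0 -> J (- m) x = J m x.
Proof.
move=> m0; rewrite /smoothing sqrrN opprK resolvent_comm // oppr_eq0 //.
Qed.

Lemma smoothing_dom m x : m != 0 -> dom S (J m x).
Proof. by move=> m0; apply: domZ; exact: resolvent_dom. Qed.

(** The function m s / (s - i m) is split into its even part m (1 - J) and its odd part i s J. The
    first nearly commutes with [T], the second nearly anticommutes, and so |m| |S R_(-m) x| becomes
    accessible. *)
Lemma op_resolvent_smoothing m x : m != 0 ->
  m%:C *: S (Rs (- m) x) = m%:C *: (x - J m x) + 'i%C *: S (J m x).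
Proof.
move=> m0; have Nm0 : - m != 0 by rewrite oppr_eq0.
rewrite /smoothing opZ; last exact: resolvent_dom.
rewrite !op_resolvent // imN scaleNr opprK !scalerBr !scalerDr !scalerA.
rewrite -[RHS]addrA; congr (_ + _).
have -> : 'i%C * (m ^+ 2)%:C = m%:C * im m.
  by apply/eqP; rewrite eq_complex /= !mulr0 !mul0r !mul1r; apply/andP; split; apply/eqP; ring.
have -> : m%:C * im m * im m = - (m%:C * (m ^+ 2)%:C).
  by rewrite -mulrA imM rmorphN /= mulrN expr2.
by rewrite scaleNr opprK addrCA addNr addr0.
Qed.

Lemma op_resolvent_le_smoothing m x : m != 0 ->
  `|m| * nrm (S (Rs (- m) x)) <= `|m| * nrm (x - J m x) + nrm (S (J m x)).
Proof.
move=> m0; rewrite -nrmZr op_resolvent_smoothing // (le_trans (nrmD _ _)) // nrmZr lerD2l.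
by have := nrmZi 1 (S (J m x)); rewrite mulr1 normr1 mul1r => ->.
Qed.

Lemma op_resolvent_le_smoothingN m x : m != 0 ->
  `|m| * nrm (S (Rs m x)) <= `|m| * nrm (x - J m x) + nrm (S (J m x)).
Proof.
move=> m0; have Nm0 : - m != 0 by rewrite oppr_eq0.
by have := op_resolvent_le_smoothing x Nm0; rewrite opprK normrN smoothingN.
Qed.

Lemma smoothing_dist_le m x : m != 0 -> dom S x ->
  `|m| * nrm (x - J m x) <= 2 * nrm (S x).
Proof.
move=> m0 Sx; have Nm0 : - m != 0 by rewrite oppr_eq0.
rewrite -nrmZr (_ : _ *: _ = m%:C *: S (Rs (- m) x) - 'i%C *: S (J m x)); last first.
  by rewrite op_resolvent_smoothing // addrK.
have hi : nrm ('i%C *: S (J m x)) = nrm (S (J m x)).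
  by have := nrmZi 1 (S (J m x)); rewrite mulr1 normr1 mul1r => ->.
have := nrmB (m%:C *: S (Rs (- m) x)) ('i%C *: S (J m x)).
rewrite hi nrmZr op_resolventC // smoothing_opC //.
have := smoothing_le gS (S x) m0; have := resolvent_le gS Nm0 (S x); rewrite normrN.
lra.
Qed.

Lemma op2_smoothing m x : m != 0 -> dom S (S (J m x)) /\
  S (S (J m x)) = (m ^+ 2)%:C *: (x - J m x).
Proof.
move=> m0; have Nm0 : - m != 0 by rewrite oppr_eq0.
have dm := resolvent_dom gS m0; have dN := resolvent_dom gS Nm0.
rewrite {1 2 3}/smoothing opZ // (op_resolvent gS m0).
have dd : dom S (Rs (- m) x - im m *: Rs m (Rs (- m) x)) by apply: domB => //; exact: domZ.
split; first exact: domZ.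
rewrite opZ //; congr (_ *: _); rewrite opB //; last exact: domZ.
rewrite opZ // !op_resolvent // imN scaleNr opprK scalerBr opprB scalerA imM.
rewrite [LHS](AC (2*2)%AC ((1*3)*(2*4))%AC) /= subrr addr0.
by rewrite /smoothing -expr2 rmorphN scaleNr.
Qed.

Lemma truncation_smoothing m n x : m != 0 -> n != 0 ->
  truncation n (J m x) = J m (truncation n x).
Proof.
move=> m0 n0; have Nm0 : - m != 0 by rewrite oppr_eq0.
have Nn0 : - n != 0 by rewrite oppr_eq0.
have comm k : k != 0 -> Rs k (J m x) = J m (Rs k x).
  move=> k0; rewrite /smoothing (resolventZ gS k0) (resolvent_comm gS _ k0 m0).
  by rewrite (resolvent_comm gS _ k0 Nm0).
rewrite /truncation !comm // /smoothing -scalerDr.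
rewrite -(resolventD gS m0) -(resolventD gS Nm0) (resolventZ gS Nm0) (resolventZ gS m0).
by rewrite !scalerA mulrC.
Qed.

(** The difference is (1 - J_n) S J_m x, of norm at most 2 |S^2 J_m x| / |n|, while S^2 J_m = m^2 (1
    - J_m). Here n = m^2 makes the bound independent of m. *)
Lemma truncation_error m n x : m != 0 -> n != 0 -> `|n| = m ^+ 2 ->
  nrm (S (J m x) - J m (truncation n x)) <= 4 * nrm x.
Proof.
move=> m0 n0 nm; rewrite -truncation_smoothing // -(truncationE) //.
have [Sw SwE] := op2_smoothing x m0; rewrite (smoothing_opC n0); last exact: smoothing_dom.
have np : 0 < `|n| by rewrite normr_gt0.
rewrite -(ler_pM2l np); apply: (le_trans (smoothing_dist_le n0 Sw)).
rewrite SwE nrmZr ger0_norm ?sqr_ge0 // -nm.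
have h := nrmB x (J m x); have h2 := smoothing_le gS x m0.
have h3 : nrm (x - J m x) <= 2 * nrm x by lra.
by have := ler_wpM2l (ltW np) h3; lra.
Qed.

End Truncation.

Section SmoothingCommutator.
Context {R : realType} {B : cstarAlgType R} {E : hilbertModType B}.
Variables (S T : operator E) (C L : R).
Hypothesis W : anticommuting S T C L.
Local Notation Rs := (resolvent S).
Local Notation K := (anticomm S T).
Local Notation J := (smoothing S).
Implicit Types (x y : E) (m : R).

Let gS := anticommuting_resolvablel W.
Let gT := anticommuting_resolvabler W.
Let c : R := 2 + 4 * C.

(** One passage of [T] through a resolvent costs the factor [c], two cost c^2; the sum covers both
    estimates below. *)
Definition comm_const : R := C * (1 + c + c ^+ 2).
Local Notation C1 := comm_const.

Lemma comm_const_ge0 : 0 <= C1.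
Proof. by have C0 := anticommuting_C0 W; rewrite mulr_ge0 // /c; nra. Qed.

(** On dom T this is T J_m x - J_m T x. Expressing it by [K] between resolvents exposes the decay in
    m. *)
Definition smoothing_comm m x : E := (m ^+ 2)%:C *:
  (Rs (- m) (K (Rs m (Rs (- m) x))) - Rs (- m) (Rs m (K (Rs (- m) x)))).

Definition truncation_anticomm m x : E := (m ^+ 2 / 2)%:C *:
  (Rs (- m) (K (Rs m x)) + Rs m (K (Rs (- m) x))).

Section LargeParameter.
Variable m : R.
Hypothesis Lm : L <= `|m|.

Let Lm' : L <= `|- m|. Proof. by rewrite normrN. Qed.
Let m0 := anticommuting_neq0 W Lm.
Let Nm0 := anticommuting_opp_neq0 W Lm.

Lemma op_smoothing_comm x : dom T x -> dom T (J m x) /\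
  T (J m x) = J m (T x) + smoothing_comm m x.
Proof.
move=> Tx; have [Sv Tv TSv STv] := anticommuting_dom W Lm' Tx.
have [Sw Tw TSw STw] := anticommuting_dom W Lm Tv.
split; first exact: domZ.
rewrite /smoothing opZ // (anticommuting_resolvent W Lm) // (anticommuting_resolvent W Lm'
  Tx) opprK.
rewrite -scalerDr; congr (_ *: _); rewrite (resolventB gS Nm0) opprB addrCA addrC -addrA.
by rewrite [Rs (- m) (Rs m (T x))]resolvent_comm // addrA [RHS]addrC.
Qed.

Lemma op_truncation x : dom T x -> dom T (truncation S m x) /\
  T (truncation S m x) = truncation_anticomm m x - truncation S m (T x).
Proof.
move=> Tx; have [_ Tv _ _] := anticommuting_dom W Lm' Tx;
  have [_ Tw _ _] := anticommuting_dom W Lm Tx.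
split; first by apply: domZ; exact: domD.
rewrite /truncation opZ; last exact: domD.
rewrite opD // (anticommuting_resolvent W Lm Tx) (anticommuting_resolvent W Lm' Tx) opprK.
by rewrite -scalerBr; congr (_ *: _); rewrite addrACA -opprD [Rs (- m) (T x) + _]addrC.
Qed.

(** The term |m| |S R_m x| is kept, not replaced by |m| |x|: for suitable x it is bounded uniformly
    in m, see [smoothing_uniform_bound]. *)
Lemma anticomm_resolvent_le x : dom T x ->
  `|m| * nrm (K (Rs m x)) <= C1 * (`|m| * nrm (S (Rs m x)) + (nrm (T x) + nrm x)).
Proof.
move=> Tx; have h1 := anticommuting_bound W (anticommuting_dom W Lm Tx).
have h2 := resolvent_le gS m0 x; have h3 := anticommuting_op_resolvent_le W Lm Tx.
have C0 := anticommuting_C0 W; have mp := normr_ge0 m.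
apply: (le_trans (ler_wpM2l mp h1)).
rewrite mulrCA /C1 -[C * _ * _]mulrA; apply: ler_wpM2l => //.
rewrite !mulrDr; set p := _ * nrm (S _) in h1 h2 h3 *; rewrite -/c in h3.
have p0 : 0 <= p by rewrite mulr_ge0 ?nrm_ge0.
have c0 : 2 <= c by rewrite /c; lra.
have N0 := nrm_ge0 (T x); have X0 := nrm_ge0 x.
have c2 := sqr_ge0 c; have h4 := mulr_ge0 c2 N0; have h5 := mulr_ge0 c2 X0.
have h6 := mulr_ge0 c2 p0; have h7 : 0 <= c * p by rewrite mulr_ge0 //; lra.
lra.
Qed.

End LargeParameter.

Section SmoothingEstimates.
Variable m : R.
Hypothesis Lm : L <= `|m|.

Let Lm' : L <= `|- m|. Proof. by rewrite normrN. Qed.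
Let m0 := anticommuting_neq0 W Lm.
Let Nm0 := anticommuting_opp_neq0 W Lm.
Let mp : 0 < `|m|. Proof. by rewrite normr_gt0; exact: m0. Qed.

Lemma anticomm_resolvent2_le x : dom T x ->
  `|m| ^+ 2 * nrm (K (Rs m (Rs (- m) x))) <=
  C1 * (`|m| * nrm (S (Rs (- m) x)) + (nrm (T x) + nrm x)).
Proof.
move=> Tx; have Fv := anticommuting_dom W Lm' Tx; have Tv : dom T (Rs (- m) x) by case: Fv.
have h1 := anticommuting_bound W (anticommuting_dom W Lm Tv).
have h2 := resolvent_le gS m0 (Rs (- m) x); have h2' := resolvent_le gS Nm0 x.
have h3 := anticommuting_op_resolvent_le W Lm Tv;
  have h3' := anticommuting_op_resolvent_le W Lm' Tx.
rewrite -/c normrN in h2' h3 h3'.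
have h4 := resolvent_le gS m0 (S (Rs (- m) x)).
rewrite -op_resolventC // in h4; last exact: resolvent_dom.
have C0 := anticommuting_C0 W; have mn := ltW mp.
apply: (le_trans (ler_wpM2l (sqr_ge0 _) h1)).
rewrite mulrCA /C1 -[C * _ * _]mulrA; apply: ler_wpM2l => //.
have c0 : 2 <= c by rewrite /c; lra.
have k2 := ler_wpM2l mn h2; have k3 := ler_wpM2l mn h3; have k4 := ler_wpM2l mn h4.
have N0 := nrm_ge0 (T x); have X0 := nrm_ge0 x.
set p := `|m| * nrm (S (Rs (- m) x)) in k4 *.
have p0 : 0 <= p by rewrite mulr_ge0 ?nrm_ge0.
have cn : 0 <= c by lra.
have q1 := ler_wpM2l cn h3'; have q2 := ler_wpM2l cn h2'.
have h7 := mulr_ge0 cn p0; have h6 := mulr_ge0 (sqr_ge0 c) p0.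
have h8 := mulr_ge0 cn N0; have h9 := mulr_ge0 cn X0.
rewrite !mulrDr !expr2 in k2 k3 k4 q1 q2 *; lra.
Qed.

Lemma smoothing_comm_le x : dom T x ->
  `|m| * nrm (smoothing_comm m x) <=
  2 * C1 * (`|m| * nrm (S (Rs (- m) x)) + (nrm (T x) + nrm x)).
Proof.
move=> Tx; have a1 := anticomm_resolvent2_le Tx; have b1 := anticomm_resolvent_le Lm' Tx.
rewrite normrN in b1; set a := K _ in a1; set b := K _ in b1.
have a2 := resolvent_le gS Nm0 a; have b2 := resolvent_le gS m0 b.
have b3 := resolvent_le gS Nm0 (Rs m b); rewrite normrN in a2 b3.
rewrite /smoothing_comm -/a -/b nrmZr normrX.
have h := nrmB (Rs (- m) a) (Rs (- m) (Rs m b)).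
have k := ler_wpM2l (exprn_ge0 3 (ltW mp)) h.
have a3 := ler_wpM2l (exprn_ge0 2 (ltW mp)) a2.
have b4 := ler_wpM2l (exprn_ge0 2 (ltW mp)) b3; have b5 := ler_wpM2l (ltW mp) b2.
rewrite !exprS !expr0 in k a1 a3 b4 *; lra.
Qed.

(** Applying [S] uses up the factor 1 / |m| of [smoothing_comm_le]. The commutator is thus bounded
    but not small in the graph norm of [S]. *)
Lemma op_smoothing_comm_le x : dom T x -> dom S (smoothing_comm m x) /\
  nrm (S (smoothing_comm m x)) <=
  2 * C1 * (`|m| * nrm (S (Rs (- m) x)) + (nrm (T x) + nrm x)).
Proof.
move=> Tx; have a1 := anticomm_resolvent2_le Tx; have b1 := anticomm_resolvent_le Lm' Tx.
have dN := resolvent_dom gS Nm0.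
rewrite normrN in b1; set a := K _ in a1; set b := K _ in b1.
split; first by apply: domZ; exact: domB.
have a2 := op_resolvent_le gS Nm0 a; have b2 := resolvent_le gS m0 b.
have b3 := op_resolvent_le gS Nm0 (Rs m b).
rewrite /smoothing_comm -/a -/b opZ; last exact: domB.
rewrite opB // nrmZr normrX.
have h := nrmB (S (Rs (- m) a)) (S (Rs (- m) (Rs m b))).
have k := ler_wpM2l (exprn_ge0 2 (ltW mp)) h.
have a3 := ler_wpM2l (exprn_ge0 2 (ltW mp)) a2.
have b4 := ler_wpM2l (exprn_ge0 2 (ltW mp)) b3; have b5 := ler_wpM2l (ltW mp) b2.
rewrite !exprS !expr0 in k a1 a3 b4 *; lra.
Qed.

Lemma truncation_anticomm_le x : dom T x ->
  2 * nrm (truncation_anticomm m x) <=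
  C1 * (`|m| * nrm (S (Rs m x)) + `|m| * nrm (S (Rs (- m) x)) + 2 * (nrm (T x) + nrm x)).
Proof.
move=> Tx; have a1 := anticomm_resolvent_le Lm Tx; have b1 := anticomm_resolvent_le Lm' Tx.
rewrite normrN in b1; set a := K _ in a1; set b := K _ in b1.
have a2 := resolvent_le gS Nm0 a; have b2 := resolvent_le gS m0 b; rewrite normrN in a2.
rewrite /truncation_anticomm -/a -/b nrmZr ger0_norm; last by rewrite divr_ge0 ?sqr_ge0.
have h := nrmD (Rs (- m) a) (Rs m b).
have k := ler_wpM2l (exprn_ge0 2 (ltW mp)) h.
have a3 := ler_wpM2l (ltW mp) a2; have b3 := ler_wpM2l (ltW mp) b2.
rewrite mulrA (mulrC 2) divfK // -(real_normK (num_real m)).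
rewrite !exprS !expr0 in k *; lra.
Qed.

End SmoothingEstimates.

End SmoothingCommutator.

(** * Symmetry of weak anticommutation *)

Section SymmetryOfWeakAnticommutation.
Context {R : realType} {B : cstarAlgType R} {E : hilbertModType B}.
Variables (S T : operator E) (C L : R).
Hypothesis W : anticommuting S T C L.
Local Notation Rs := (resolvent S).
Local Notation K := (anticomm S T).
Local Notation J := (smoothing S).
Local Notation C1 := (comm_const C).
Implicit Types (x y z : E) (m k : R).

Let gS := anticommuting_resolvablel W.
Let gT := anticommuting_resolvabler W.

Variable k : R.
Hypothesis k1 : 1 <= `|k|.
Hypothesis kC : 48 * C1 <= `|k|.
Hypothesis kC2 : 2 * C <= `|k|.

Let k0 : k != 0. Proof. by rewrite -normr_gt0 (lt_le_trans ltr01). Qed.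
Let Nk0 : - k != 0. Proof. by rewrite oppr_eq0. Qed.

Lemma resolvent_nrm_le y : nrm (resolvent T k y) <= nrm y.
Proof. by apply: le_trans (resolvent_le gT k0 y); rewrite ler_peMl ?nrm_ge0. Qed.

(* [|S J x|] and [|m (x - J x)|] are bounded uniformly in [m]: up to bounded
   errors, [S J] anticommutes with [T] and [m (1 - J)] commutes with it. *)
Lemma smoothing_uniform_bound m x y : L <= `|m| -> dom S y -> x = resolvent T k y ->
  `|k| * (nrm (S (J m x)) + `|m| * nrm (x - J m x)) <= 6 * nrm (S y) + 12 * C1 * nrm y.
Proof.
move=> Lm Sy xE; have m0 := anticommuting_neq0 W Lm; have mp : 0 < `|m| by rewrite normr_gt0.
have Tx : dom T x by rewrite xE; exact: resolvent_dom.
have TxE : T x = y - im k *: x by rewrite xE op_resolvent.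
have x_le := resolvent_nrm_le y; have Tx_le := op_resolvent_le gT k0 y.
rewrite -xE in x_le Tx_le.
set s := nrm (S (J m x)); set e := _ * nrm (x - _).
have pm := op_resolvent_le_smoothing gS x m0; have pp := op_resolvent_le_smoothingN gS x m0.
have C1p := comm_const_ge0 W.
have hs : `|k| * s <= nrm (S y) + nrm (truncation_anticomm S T m x).
  have [Tg gE] := op_truncation W Lm Tx.
  have sE : s = nrm (truncation S m x) by rewrite /s (truncationE gS x m0).
  rewrite sE.
  (* With g the truncation and T x = y - i k x, anticommutation turns the shift by i k into one by -
     i k: (T - i k) g x is the anticommutator term minus g y. *)
  have -> : truncation S m x = resolvent T (- k)
      (truncation_anticomm S T m x - truncation S m y).
    apply/esym/(resolvent_uniq gT Nk0) => //; rewrite gE TxE.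
    have -> : truncation S m (y - im k *: x) = truncation S m y - im k *: truncation S m x.
      rewrite /truncation !(resolventB gS m0) !(resolventB gS (anticommuting_opp_neq0 W Lm)).
      rewrite !(resolventZ gS m0) !(resolventZ gS (anticommuting_opp_neq0 W Lm)).
      by rewrite addrACA -opprD -scalerDr scalerBr !scalerA [im k * _]mulrC.
    by rewrite opprB addrA imN scaleNr addrAC addrK.
  have h1 := resolvent_le gT Nk0 (truncation_anticomm S T m x - truncation S m y).
  rewrite normrN in h1; apply: (le_trans h1); apply: (le_trans (nrmB _ _)).
  rewrite addrC lerD2r -(truncationE gS) // (smoothing_opC gS) //; exact: smoothing_le.
have he : `|k| * e <= 2 * nrm (S y) + `|m| * nrm (smoothing_comm S T m x).
  have [TJ TJE] := op_smoothing_comm W Lm Tx.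
  have dJ : y - J m y - smoothing_comm S T m x = opshift T (im k) (x - J m x).
    rewrite /opshift opB // TJE TxE.
    rewrite (smoothing_subZ gS) // scalerBr !opprD opprK.
    by rewrite [RHS](AC ((2*((1*1)*1))*2)%AC (((1*3)*5)*((2*6)*(4*7)))%AC) /= addNr subrr !addr0.
  have h1 := shift_lower_bound (im k) (resolvable_sym gT) (domB Tx TJ).
  rewrite -dJ /= in h1.
  have h2 := nrmB (y - J m y) (smoothing_comm S T m x).
  have h3 := smoothing_dist_le gS m0 Sy; have h4 := ler_wpM2l (ltW mp) (le_trans h1 h2).
  rewrite /e; lra.
have ht := truncation_anticomm_le W Lm Tx; have hc := smoothing_comm_le W Lm Tx.
have N2 : nrm (T x) + nrm x <= 2 * nrm y by lra.
have ht2 : C1 * (`|m| * nrm (S (Rs m x)) + `|m| * nrm (S (Rs (- m) x)) + 2 * (nrm (T x) + nrm x))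
   <= C1 * (2 * (s + e) + 4 * nrm y) by apply: ler_wpM2l => //; rewrite /e /s; lra.
have hc2 : C1 * (`|m| * nrm (S (Rs (- m) x)) + (nrm (T x) + nrm x))
   <= C1 * ((s + e) + 2 * nrm y) by apply: ler_wpM2l => //; rewrite /e /s; lra.
have e0 : 0 <= e by rewrite mulr_ge0 ?nrm_ge0.
have s0 : 0 <= s by rewrite nrm_ge0.
have hk : 48 * C1 * (s + e) <= `|k| * (s + e) by apply: ler_wpM2r => //; lra.
have f1 := nrm_ge0 (S y); have f2 := mulr_ge0 C1p (nrm_ge0 y); lra.
Qed.

(* [20 * C1 + 1] weighs [|y|] against [|S y|]: the residual is small in [E], but
   in the graph norm only up to a multiple of [|y|]. *)
Lemma shift_residual y : dom S y -> exists2 z, dom S z /\ dom T z &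
  dom S (opshift T (im k) z) /\
  nrm (S (y - opshift T (im k) z)) + (20 * C1 + 1) * nrm (y - opshift T (im k) z)
    <= 1 / 2 * (nrm (S y) + (20 * C1 + 1) * nrm y).
Proof.
move=> Sy; have C1p := comm_const_ge0 W; set A := 20 * C1 + 1; set w := nrm (S y) + A * nrm y.
have A0 : 0 < A by rewrite /A; lra.
have w0 : 0 <= w by rewrite addr_ge0 ?mulr_ge0 ?nrm_ge0 // ltW.
have [wz|wn] := eqVneq w 0.
  have yz : y = 0.
    apply: nrm_eq0; have h1 := nrm_ge0 (S y); have h2 := nrm_ge0 y.
    rewrite /w in wz; nra.
  exists 0; first by split; exact: dom0.
  rewrite /opshift op0 scaler0 addr0 yz subrr op0 nrm0 mulr0 addr0; split; first exact: dom0.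
  by rewrite mulr_ge0 // divr_ge0.
have wp : 0 < w by rewrite lt0r wn.
have [|M1 _ H1] := smoothing_approx gS (S y) (e := w / 12); first by rewrite divr_gt0.
have [|M2 _ H2] := smoothing_approx gS y (e := w / 12 / A); first by rewrite !divr_gt0.
pose x := resolvent T k y.
(* An m-independent bound for |m| times the norm of the commutator; m above c0 A / (w / 12) makes
   the weighted commutator at most w / 12. *)
pose c0 := 2 * C1 * (6 * nrm (S y) + 12 * C1 * nrm y + 2 * nrm y).
pose m := L + `|M1| + `|M2| + `|c0 * A / (w / 12)|.
have L1 := anticommuting_L1 W.
have [p1 [p2 p3]] := (normr_ge0 M1, (normr_ge0 M2, normr_ge0 (c0 * A / (w / 12)))).
have q1 := ler_norm M1; have q2 := ler_norm M2; have q3 := ler_norm (c0 * A / (w / 12)).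
have mE : `|m| = m by rewrite ger0_norm // /m; lra.
have Lm : L <= `|m| by rewrite mE /m; lra.
have m0 := anticommuting_neq0 W Lm; have mp : 0 < `|m| by rewrite normr_gt0.
have Tx : dom T x by exact: resolvent_dom.
have TxE : T x = y - im k *: x by rewrite /x op_resolvent.
have {H1} H1 := H1 m ltac:(rewrite mE /m; lra).
have {H2} H2 := H2 m ltac:(rewrite mE /m; lra).
have hu := smoothing_uniform_bound Lm Sy (erefl x).
have pm := op_resolvent_le_smoothing gS x m0.
have [TJ TJE] := op_smoothing_comm W Lm Tx.
have hc := smoothing_comm_le W Lm Tx; have [Sc hSc] := op_smoothing_comm_le W Lm Tx.
have x_le := resolvent_nrm_le y; have Tx_le := op_resolvent_le gT k0 y.
rewrite -/x in x_le Tx_le.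
set se := nrm (S (J m x)) + _ in hu.
have hP : `|m| * nrm (S (Rs (- m) x)) + (nrm (T x) + nrm x) <= se + 2 * nrm y.
  by rewrite /se; lra.
have hP2 := ler_wpM2l C1p hP.
have se0 : 0 <= se by rewrite addr_ge0 ?mulr_ge0 ?nrm_ge0.
have yp := nrm_ge0 y; have Syp := nrm_ge0 (S y).
have hse1 : 48 * C1 * se <= 6 * nrm (S y) + 12 * C1 * nrm y.
  by apply: le_trans hu; rewrite ler_wpM2r.
have hse2 : se <= 6 * nrm (S y) + 12 * C1 * nrm y by apply: le_trans hu; rewrite ler_peMl.
exists (J m x); first by split => //; exact: (smoothing_dom gS).
have E1 : y - opshift T (im k) (J m x) = (y - J m y) - smoothing_comm S T m x.
  rewrite /opshift TJE TxE (smoothing_subZ gS) //.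
  by rewrite addrAC subrK opprD addrA.
have SJy := smoothing_dom gS y m0.
have dE : dom S (y - opshift T (im k) (J m x)) by rewrite E1; apply: domB => //; exact: domB.
split; first by rewrite -[opshift _ _ _](subKr y); exact: domB.
rewrite E1 opB //; last exact: domB.
rewrite (opB Sy SJy) (smoothing_opC gS m0 Sy).
have hcm : nrm (smoothing_comm S T m x) * A <= w / 12.
  rewrite -(ler_pM2l mp) mulrA.
  apply: (@le_trans _ _ (c0 * A)).
    apply: ler_wpM2r; first exact: ltW.
    have h := ler_wpM2l C1p hse2; rewrite /c0; lra.
  have w12 : 0 < w / 12 by rewrite divr_gt0.
  have h := ler_wpM2r (ltW w12) q3; rewrite divfK ?gt_eqF // in h; apply: (le_trans h).
  by apply: ler_wpM2r; [exact: ltW | rewrite mE /m; lra].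
have h1 := nrmB (S y - J m (S y)) (S (smoothing_comm S T m x)).
have h2 := nrmB (y - J m y) (smoothing_comm S T m x).
rewrite ler_pdivlMr // in H2.
have h3 := ler_wpM2l (ltW A0) h2.
(* The factor 48 in [kC] produces the coefficient 1 / 4, and 5 C1 |y| is at most a quarter of the
   weighted |y|. With three further errors of w / 12 this adds up to w / 2. *)
have key : nrm (S (smoothing_comm S T m x)) <= 1 / 4 * nrm (S y) + 5 * C1 * nrm y.
  by have f2 := mulr_ge0 C1p yp; lra.
rewrite /w in H1 H2 hcm *; rewrite /A in H1 H2 hcm h3 *; lra.
Qed.

(** With v = (T + i k) z one has (T - i k) S z = K z - S v; the term C |S z| in the bound on K z is
    absorbed by 2 C <= |k|. *)
Lemma shift_a_priori z : dom S z -> dom T z -> dom S (opshift T (im k) z) ->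
  nrm (S z) <= (2 + 4 * C) * (nrm (opshift T (im k) z) + nrm (S (opshift T (im k) z))).
Proof.
move=> Sz Tz; set v := opshift _ _ _ => Sv; have C0 := anticommuting_C0 W.
have STz : dom S (T z).
  by rewrite -[T z](addrK (im k *: z)); apply: domB => //; exact: domZ.
have Fz := comm_dom_of_op W Sz Tz STz; have [_ _ TSz _] := Fz.
have SzE : opshift T (im (- k)) (S z) = K z - S v.
  rewrite /v /opshift opD ?opZ //; last exact: domZ.
  by rewrite /anticomm imN scaleNr opprD addrA [S (T z) + _]addrC addrK.
have h1 := shift_lower_bound (im (- k)) (resolvable_sym gT) TSz.
rewrite SzE /= normrN in h1; have h2 := nrmB (K z) (S v); have h3 := anticommuting_bound W Fz.
have h4 := op_le_shift_imag k (resolvable_sym gT) Tz; rewrite -/(im k) -/v in h4.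
have h5 := shift_lower_bound (im k) (resolvable_sym gT) Tz; rewrite -/v /= in h5.
have z0 := nrm_ge0 z; have Sz0 := nrm_ge0 (S z); have v0 := nrm_ge0 v.
have h6 : nrm z <= nrm v by apply: le_trans h5; rewrite ler_peMl.
have h7 := ler_wpM2r Sz0 kC2; have h8 := ler_wpM2r Sz0 k1.
have h9 : C * (nrm z + nrm (S z) + nrm (T z)) <= C * (2 * nrm v + nrm (S z)).
  by rewrite ler_wpM2l //; lra.
have h10 := mulr_ge0 C0 v0; have h11 := mulr_ge0 C0 (nrm_ge0 (S v)).
lra.
Qed.

(** The residual iteration is run in the weighted graph norm of [S]. The a priori estimate makes S
    z_n Cauchy, so the limit (T + i k)^-1 y lies in dom S. *)
Lemma resolvent_comm_dom y : dom S y -> comm_dom T S (resolvent T k y).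
Proof.
move=> Sy; have C1p := comm_const_ge0 W; have C0 := anticommuting_C0 W.
set A := 20 * C1 + 1; pose w y' := nrm (S y') + A * nrm y'.
have A1 : 1 <= A by rewrite /A; lra.
have /choice[z zP] : forall n : nat, exists z : E, [/\ dom S z, dom T z,
    dom S (opshift T (im k) z) & w (y - opshift T (im k) z) <= (1 / 2) ^+ n * w y].
  elim=> [|n [z [Sz Tz Sv zw]]].
    exists 0; split; try exact: dom0.
      by rewrite /opshift op0 scaler0 addr0; exact: dom0.
    by rewrite /opshift op0 scaler0 addr0 subr0 expr0 mul1r.
  have [z' [Sz' Tz'] [Sv' zw']] := shift_residual (domB Sy Sv).
  exists (z + z'); rewrite opshiftD //; split; [exact: domD..|].
  rewrite opprD addrA (le_trans zw') // exprS -[1 / 2 * _ * _]mulrA; apply: ler_wpM2l => //.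
pose v n := opshift T (im k) (z n).
have w_half : (fun n => w y * (1 / 2) ^+ n) @ \oo --> (0 : R).
  rewrite -[X in _ --> X](mulr0 (w y)); apply: cvgMr; apply: cvg_expr.
  by rewrite ger0_norm //; lra.
have vy : tends v y.
  apply: tends_squeeze w_half => n; rewrite nrm_distC mulrC.
  have [_ _ _] := zP n; apply: le_trans; rewrite /w.
  by have := nrm_ge0 (S (y - v n)); have := nrm_ge0 (y - v n); rewrite /v; nra.
have Svy : tends (fun n => S (v n)) (S y).
  apply: tends_squeeze w_half => n; rewrite nrm_distC mulrC.
  have [_ _ Sv] := zP n; apply: le_trans; rewrite -opB // /w lerDl.
  by rewrite mulr_ge0 ?nrm_ge0 //; lra.
have zx : tends z (resolvent T k y).
  apply: tends_eq (resolvent_tends gT k0 vy) => n.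
  by have [_ Tz _ _] := zP n; exact: resolvent_shift.
have [|l Szl] := @cauchy_tends _ _ (fun n => S (z n)).
  have c0 : tends_cauchy (fun=> 0 : E) by exact: tends_is_cauchy (tends_cst 0).
  apply: (cauchy_dom3 (tends_is_cauchy vy) (tends_is_cauchy Svy) c0 (a := 2 + 4 * C)) => i j.
  have [[Si Ti vi _] [Sj Tj vj _]] := (zP i, zP j).
  rewrite subrr nrm0 addr0 -!opB // /v -opshiftB //.
  by apply: shift_a_priori; rewrite ?opshiftB //; exact: domB.
have [Sx _] := resolvable_closed gS (fun n => let: And4 h _ _ _ := zP n in h) zx Szl.
apply: comm_domC; apply: (comm_dom_of_op W) => //; first exact: resolvent_dom.
by rewrite op_resolvent //; apply: domB => //; exact: domZ.
Qed.

End SymmetryOfWeakAnticommutation.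

Lemma norm_boundC (R : realType) (B : cstarAlgType R) (E : hilbertModType B)
    (S T : operator E) (C : R) : norm_bound S T C -> norm_bound T S C.
Proof.
move=> b x /comm_domC Fx; rewrite anticommC addrAC; exact: b.
Qed.

Lemma anticommuting_sym (R : realType) (B : cstarAlgType R) (E : hilbertModType B)
    (S T : operator E) (C L : R) : anticommuting S T C L ->
  anticommuting T S C (1 + 2 * C + 48 * comm_const C).
Proof.
move=> W; have C0 := anticommuting_C0 W; have C1 := comm_const_ge0 W; split=> //.
- exact: anticommuting_resolvabler W.
- exact: anticommuting_resolvablel W.
- by lra.
- by lra.
- exact/norm_boundC/(anticommuting_bound W).
move=> m x Lm; apply: (resolvent_comm_dom W) => //; lra.
Qed.

(** * The sum of two operators *)

Section TruncatedOperator.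
Context {R : realType} {B : cstarAlgType R} {E : hilbertModType B}.
Variables S T : operator E.
Hypotheses (gS : resolvable S) (gT : resolvable T).
Local Notation Rs := (resolvent S).
Implicit Types (x y : E).

Variable n : R.
Hypothesis n0 : n != 0.
Let Nn0 : - n != 0. Proof. by rewrite oppr_eq0. Qed.
Local Notation g := (truncation S n).

Lemma truncationD x y : g (x + y) = g x + g y.
Proof.
by rewrite /truncation (resolventD gS n0) (resolventD gS Nn0) addrACA scalerDr.
Qed.

Lemma truncationZ (l : R[i]) x : g (l *: x) = l *: g x.
Proof.
rewrite /truncation (resolventZ gS n0) (resolventZ gS Nn0) -scalerDr !scalerA.
by rewrite [l * _]mulrC.
Qed.

Lemma truncationM x (b : B) : g (mact x b) = mact (g x) b.
Proof.
by rewrite /truncation (resolventM gS n0) (resolventM gS Nn0) -mactDl mactZl.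
Qed.

Fact submodule_setT : submodule ([set: E]).
Proof. by []. Qed.

Definition truncation_op : operator E :=
  @Operator R B E setT g submodule_setT (fun x y _ _ => truncationD x y)
    (fun l x _ => truncationZ l x) (fun x b _ => truncationM x b).

Definition truncated_sum : operator E := op_add T truncation_op.

Lemma truncation_sym x y : inner (g x) y = inner x (g y).
Proof.
rewrite /truncation innerZlr innerZr; congr (_ *: _).
by rewrite innerDl innerDr !(resolvent_adj gS) // opprK addrC.
Qed.

Lemma truncation_le x : nrm (g x) <= `|n| * nrm x.
Proof.
have np : 0 < `|n| by rewrite normr_gt0.
rewrite /truncation nrmZr ger0_norm; last by rewrite divr_ge0 ?sqr_ge0.
have h := nrmD (Rs n x) (Rs (- n) x).
have h1 := resolvent_le gS n0 x; have h2 := resolvent_le gS Nn0 x; rewrite normrN in h2.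
rewrite -(real_normK (num_real n)).
have h3 := ler_wpM2l (ltW np) h1; have h4 := ler_wpM2l (ltW np) h2.
have h5 := ler_wpM2l (sqr_ge0 `|n|) h.
rewrite !expr2 in h5 *; lra.
Qed.

Lemma truncated_sum_resolvable : resolvable truncated_sum.
Proof.
have np : 0 < `|n| by rewrite normr_gt0.
have dT x : dom T x -> dom truncated_sum x by [].
have sym : symmetric_op truncated_sum.
  move=> x y [Tx _] [Ty _]; rewrite innerDl innerDr truncation_sym.
  by rewrite (resolvable_sym gT).
have cl : closed_op truncated_sum.
  move=> u x y du ux ey; have gu : tends (fun j => g (u j)) (g x).
    apply: (tends_bounded (c := `|n|)) ux => j.
    by rewrite -scaleN1r -truncationZ -truncationD scaleN1r truncation_le.
  have [Tx TxE] : dom T x /\ T x = y - g x.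
    apply: (resolvable_closed gT) ux _; first by move=> j; case: (du j).
    by apply: tends_eq (tendsB ey gu) => j; rewrite /= addrK.
  by split; [split | rewrite /= TxE subrK].
have ds : dense (dom truncated_sum).
  have := resolvable_dense gT; rewrite (_ : dom truncated_sum = dom T) //.
  exact: setIT.
(* The truncation has norm at most |n|, so the resolvent of [T] at |k| = 2 |n| leaves a residual of
   at most half the norm. *)
have onto k : `|k| = 2 * `|n| -> onto_shift truncated_sum (im k).
  move=> kE; have k0 : k != 0 by rewrite -normr_gt0 kE mulr_gt0.
  apply: (@onto_of_residual _ _ _ _ _ (1 / 2)) => //; first by lra.
  move=> y; exists (resolvent T k y); first by apply: dT; exact: resolvent_dom.
  rewrite /opshift /= op_resolvent //.
  have -> : y - (y - im k *: resolvent T k y + g (resolvent T k y) + im k *: resolvent T k y)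
      = - g (resolvent T k y).
    by rewrite addrAC subrK opprD addrA subrr add0r.
  rewrite nrmN (le_trans (truncation_le _)) //.
  have := resolvent_le gT k0 y; rewrite kE; lra.
apply: (@resolvable_of_onto _ _ _ _ (2 * `|n|)) => //; first by rewrite mulr_gt0.
  by apply: onto; rewrite normrM normr_id ger0_norm.
by apply: onto; rewrite normrN normrM normr_id ger0_norm.
Qed.

End TruncatedOperator.

(** * Approximate solutions for the sum *)

Section SumResidual.
Context {R : realType} {B : cstarAlgType R} {E : hilbertModType B}.
Variables (S T : operator E) (C L : R).
Hypothesis W : anticommuting S T C L.
Local Notation Rs := (resolvent S).
Local Notation J := (smoothing S).
Local Notation C1 := (comm_const C).
Implicit Types (x y : E) (m n k : R).

Let gS := anticommuting_resolvablel W.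
Let gT := anticommuting_resolvabler W.

(** The coefficients of |T x|^2 <= 2 eta^2 + (24 C1 + 36 C1^2) m^2 |x|^2, where eta = |T x + g x|;
    half of |T x|^2 has been absorbed. *)
Definition trunc_const : R := 2 + 24 * C1 + 36 * C1 ^+ 2.
Local Notation C2 := trunc_const.

(* The cross terms of [|T x + g x|^2] amount to [<x, (T g + g T) x>], which is
   of order [n |x|^2]. *)
Lemma truncated_sum_bound n m x : 1 <= m -> L <= `|n| -> `|n| = m ^+ 2 -> dom T x ->
  nrm (T x) <= C2 * (nrm (T x + truncation S n x) + m * nrm x).
Proof.
move=> m1 Ln nm Tx; have n0 := anticommuting_neq0 W Ln; have Nn0 := anticommuting_opp_neq0 W Ln.
set g := truncation S n; set eta := nrm (T x + g x).
have [Tg TgE] := op_truncation W Ln Tx.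
have h1 : nrm (T x) ^+ 2 <= eta ^+ 2 + 6 * (nrm x * nrm (truncation_anticomm S T n x)).
  apply: (le_trans (nrm_le_inner_add (T x) (g x))).
  have -> : inner (T x) (T x) + inner (g x) (g x) =
      inner (T x + g x) (T x + g x) - inner x (truncation_anticomm S T n x).
    have -> : truncation_anticomm S T n x = T (g x) + g (T x) by rewrite TgE subrK.
    rewrite [inner x _]innerDr -(resolvable_sym gT Tx Tg) -(truncation_sym gS n0 x (T x)).
    rewrite innerDl !innerDr opprD.
    by rewrite [RHS](AC ((2*2)*2)%AC ((1*4)*((2*5)*(3*6)))%AC) /= !subrr !addr0.
  apply: (le_trans (nrmB _ _)); rewrite /eta -nrm_sqr_inner lerD2l; exact: nrm_inner_le.
have C1p := comm_const_ge0 W.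
have h2 := truncation_anticomm_le W Ln Tx.
have h3 := op_resolvent_le gS n0 x; have h4 := op_resolvent_le gS Nn0 x.
have x0 := nrm_ge0 x; have t0 := nrm_ge0 (T x); have e0 : 0 <= eta := nrm_ge0 _.
rewrite nm in h2; set xi := nrm x in h1 h2 h3 h4 x0 *; set t := nrm (T x) in h1 h2 t0 *.
have m2 : 1 <= m ^+ 2 by rewrite expr_ge1 //; lra.
have h5 : m ^+ 2 * nrm (S (Rs n x)) + m ^+ 2 * nrm (S (Rs (- n) x)) + 2 * (t + xi) <=
   4 * (m ^+ 2 * xi) + 2 * t.
  have m2' : 0 <= m ^+ 2 by lra.
  have := ler_wpM2l m2' h3; have := ler_wpM2l m2' h4; have := ler_wpM2r x0 m2; lra.
have h6 : nrm (truncation_anticomm S T n x) <= C1 * (2 * (m ^+ 2 * xi) + t).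
  have := ler_wpM2l C1p h5; lra.
have h7 := ler_wpM2l x0 h6.
have h8 : t ^+ 2 <= eta ^+ 2 + 12 * C1 * (m ^+ 2 * xi ^+ 2) + 6 * C1 * xi * t.
  by lra.
have h9 : 6 * C1 * xi * t <= t ^+ 2 / 2 + 18 * C1 ^+ 2 * xi ^+ 2.
  by have := sqr_ge0 (t - 6 * C1 * xi); rewrite !expr2; lra.
have h10 : xi ^+ 2 <= m ^+ 2 * xi ^+ 2 by rewrite ler_peMl ?sqr_ge0.
have h11 : C1 ^+ 2 * xi ^+ 2 <= C1 ^+ 2 * (m ^+ 2 * xi ^+ 2) by rewrite ler_wpM2l ?sqr_ge0.
have cp : 2 <= C2 by rewrite /C2; have := sqr_ge0 C1; lra.
have u0 : 0 <= m ^+ 2 * xi ^+ 2 by rewrite mulr_ge0 ?sqr_ge0.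
have h12 : t ^+ 2 <= C2 * (eta ^+ 2 + m ^+ 2 * xi ^+ 2).
  have := mulr_ge0 C1p (sqr_ge0 eta); have := mulr_ge0 (sqr_ge0 C1) (sqr_ge0 eta).
  by rewrite /C2; lra.
have mx : 0 <= m * xi by rewrite mulr_ge0 //; lra.
have sp : 0 <= C2 * (eta + m * xi) by apply: mulr_ge0; lra.
rewrite -(@ler_pXn2r _ 2) ?nnegrE //.
apply: (le_trans h12); have -> : (C2 * (eta + m * xi)) ^+ 2 = C2 * (C2 * (eta + m * xi) ^+ 2)
  by ring.
apply: ler_wpM2l; first by lra.
apply: (@le_trans _ _ ((eta + m * xi) ^+ 2)).
  by have := mulr_ge0 e0 mx; rewrite !expr2; lra.
by rewrite ler_peMl ?sqr_ge0 //; lra.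
Qed.

(** The coefficient of |x| in the residual: 4 from [truncation_error], the rest from the commutator
    of [T] with J_m. *)
Definition sum_const : R := 4 + 4 * C1 + 2 * C1 * C2.

(* The approximate solution is [J_m x], where [(T + S J_n + i k) x = y] and
   [n = m^2]. *)
Lemma sum_residual k y : k != 0 -> 4 * sum_const <= `|k| ->
  exists2 x, dom (op_add S T) x & nrm (y - opshift (op_add S T) (im k) x) <= 3 / 4 * nrm y.
Proof.
move=> k0 kc; have C1p := comm_const_ge0 W.
have [y0|yn] := eqVneq (nrm y) 0.
  exists 0; first by split; exact: dom0.
  by rewrite y0 mulr0 /opshift op0 scaler0 addr0 (nrm_eq0 y0) subrr nrm0.
have yp : 0 < nrm y by rewrite lt0r yn nrm_ge0.
have [|M _ HM] := smoothing_approx gS y (e := nrm y / 4); first by rewrite divr_gt0.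
have C2p : 2 <= C2 by rewrite /C2; have := sqr_ge0 C1; lra.
have L1 := anticommuting_L1 W; have M0 := normr_ge0 M; have M1 := ler_norm M.
have c12 : 0 <= C1 * C2 by rewrite mulr_ge0 //; lra.
(* The last summand reduces 2 C1 C2 |y| / m to |y| / 4. Smoothing [y] and the terms in |x| cost
   another |y| / 4 each, hence 3 / 4. *)
pose m := L + `|M| + 8 * (C1 * C2).
have m1 : 1 <= m by rewrite /m; lra.
have mE : `|m| = m by rewrite ger0_norm //; lra.
have Lm : L <= `|m| by rewrite mE /m; lra.
have m0 := anticommuting_neq0 W Lm; have mp : 0 < m by lra.
pose n := m ^+ 2; have nE : `|n| = m ^+ 2 by rewrite ger0_norm ?sqr_ge0.
have Ln : L <= `|n|.
  by rewrite nE (@le_trans _ _ m) //; [rewrite -mE | rewrite expr2 ler_peMl //; lra].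
have n0 := anticommuting_neq0 W Ln.
have [x [Tx _] xE] := resolvable_onto (truncated_sum_resolvable gS gT n0) (l := im k) k0 y.
have sg := resolvable_sym (truncated_sum_resolvable gS gT n0).
have xk := shift_lower_bound (im k) sg (conj Tx I); rewrite xE /= in xk.
have h1 := op_le_shift_imag k sg (conj Tx I); rewrite -/(im k) xE /= in h1.
have [TJ TJE] := op_smoothing_comm W Lm Tx.
have SJ := smoothing_dom gS x m0.
exists (J m x) => //.
have JyE : J m y = J m (T x) + J m (truncation S n x) + im k *: J m x.
  rewrite -xE /opshift /= /smoothing.
  have Nm0 := anticommuting_opp_neq0 W Lm.
  rewrite !(resolventD gS Nm0) !(resolventD gS m0) (resolventZ gS Nm0) (resolventZ gS m0).
  by rewrite !scalerDr !scalerA [im k * _]mulrC.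
have -> : y - opshift (op_add S T) (im k) (J m x) =
    (y - J m y) - smoothing_comm S T m x - (S (J m x) - J m (truncation S n x)).
  rewrite /opshift /= TJE JyE !opprD opprK.
  rewrite [RHS](AC ((1*((1*1)*1))*1*2)%AC ((1*((6*(2*5))*4))*(3*7))%AC) /=.
  by rewrite addNr addr0.
have e1 := truncation_error gS x m0 n0 nE.
have e2 := HM m ltac:(rewrite mE /m; lra).
have e3 := smoothing_comm_le W Lm Tx; rewrite mE in e3.
have e4 := truncated_sum_bound m1 Ln nE Tx.
have e5 := op_resolvent_le gS (anticommuting_opp_neq0 W Lm) x.
have x0 := nrm_ge0 x; have t0 := nrm_ge0 (T x).
set sc := nrm (smoothing_comm S T m x) in e3 *.
have e6 : nrm (T x) <= C2 * (nrm y + m * nrm x).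
  by apply: (le_trans e4); apply: ler_wpM2l; [lra | rewrite lerD2r].
have e7 : sc <= (4 * C1 + 2 * C1 * C2) * nrm x + nrm y / 4.
  rewrite -(ler_pM2l mp); apply: (le_trans e3).
  have f1 : m * nrm (S (Rs (- m) x)) + (nrm (T x) + nrm x) <=
      2 * (m * nrm x) + C2 * (nrm y + m * nrm x).
    have := ler_wpM2l (ltW mp) e5; have := ler_wpM2r x0 m1; lra.
  have f2 := ler_wpM2l C1p f1.
  have f3 : 8 * (C1 * C2) * nrm y <= m * nrm y by rewrite ler_wpM2r ?(ltW yp) // /m; lra.
  lra.
have e8 : sum_const * nrm x <= nrm y / 4.
  have := ler_wpM2r x0 kc; rewrite /sum_const; lra.
have g1 := nrmB (y - J m y - smoothing_comm S T m x) (S (J m x) - J m (truncation S n x)).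
have g2 := nrmB (y - J m y) (smoothing_comm S T m x).
rewrite -/sc in g2; rewrite /sum_const in e8; lra.
Qed.

End SumResidual.

(** * Relative bounds for the summands, and resolvability of the sum *)

Section SumEstimate.
Context {R : realType} {B : cstarAlgType R} {E : hilbertModType B}.
Variables (S T : operator E) (C L : R).
Hypothesis W : anticommuting S T C L.
Implicit Types (x y : E).

Let gS := anticommuting_resolvablel W.
Let gT := anticommuting_resolvabler W.
Local Notation D := (op_add S T).

(* Here [a b = 1], so that [<a x + b k, a x + b k>] contains twice the cross
   term [v] of [<D x, D x>], where [k = [S, T] x]. *)
Lemma sum_estimate_identity (V : lmodType R[i]) (a b c0 c1 c2 : R) (p q r v w : V) :
  (2 : R)%:C *: (q + r + v) + (a ^+ 2 + b ^+ 2 * c0)%:C *: p - q - r =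
  ((a ^+ 2)%:C *: p + (v + v) + (b ^+ 2)%:C *: w)
  + (b ^+ 2)%:C *: (c0%:C *: p + c1%:C *: q + c2%:C *: r - w)
  + (1 - b ^+ 2 * c1)%:C *: q + (1 - b ^+ 2 * c2)%:C *: r.
Proof.
rewrite !scalerDr !scalerN !scalerA -!rmorphM /= ![(_ + _)%:C]rmorphD !rmorphN /= !scalerDl.
rewrite !scaleNr !scale1r.
rewrite [LHS](AC (((2*2*2)*2)*1*1)%AC (((1*9)*(3*10))*((2*4*(5*6))*(7*8)))%AC) /= !subrr !add0r.
set A := _ *: p; set A' := _ *: p; set b2 := _ *: w; set q1 := _ *: q; set r1 := _ *: r.
rewrite [RHS](AC ((1*2*1)*4*2*2)%AC (((9*11)*(2*3)*(1*5))*((4*8)*(6*10)*(7*12)))%AC) /=.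
by rewrite !subrr !addr0.
Qed.

Lemma inner_combination (a b : R) x y :
  inner (a%:C *: x + b%:C *: y) (a%:C *: x + b%:C *: y) =
  (a ^+ 2)%:C *: inner x x + ((a * b)%:C *: inner x y + (a * b)%:C *: inner y x)
  + (b ^+ 2)%:C *: inner y y.
Proof.
rewrite innerDl !innerDr !innerZlr !innerZr !scalerA -!rmorphM /=.
by rewrite (mulrC b a) -!expr2 !addrA.
Qed.

Hypothesis HB : anticomm_bound S T.

(** The cross term of <D x, D x> is <[S, T] x, x>, which completing a square bounds from below by a
    large multiple of <x, x> and a small one of <[S, T] x, [S, T] x>. This gives the claim on
    [comm_dom]; regularization and closedness of the cone extend it. *)
Lemma sum_estimate : exists2 c : R, 0 < c & forall x, dom D x ->
  cpositive ((2 : R)%:C *: inner (D x) (D x) + c%:C *: inner x x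
             - inner (S x) (S x) - inner (T x) (T x)).
Proof.
case: HB => C0 [C1 [C2 [p0 p1 p2 bd]]].
(* Then b^2 C1 and b^2 C2 are at most b^2 a = b <= 1, so the last two coefficients of the identity
   are nonnegative. *)
pose a := 1 + C1 + C2; pose b := a^-1.
have a1 : 1 <= a by rewrite /a; lra.
have b0 : 0 < b by rewrite invr_gt0; lra.
have ab : a * b = 1 by rewrite divff // gt_eqF //; lra.
have bb : b ^+ 2 * a <= 1 by rewrite expr2 -mulrA mulVf ?gt_eqF ?mulr1 ?invf_le1 //; lra.
have b2 := sqr_ge0 b.
have bC1 : b ^+ 2 * C1 <= 1 by apply: le_trans bb; rewrite ler_wpM2l // /a; lra.
have bC2 : b ^+ 2 * C2 <= 1 by apply: le_trans bb; rewrite ler_wpM2l // /a; lra.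
exists (a ^+ 2 + b ^+ 2 * C0).
  by apply: ltr_pwDl; [rewrite exprn_gt0 //; lra | rewrite mulr_ge0 // ltW].
have key x : comm_dom S T x ->
  cpositive ((2 : R)%:C *: inner (D x) (D x) + (a ^+ 2 + b ^+ 2 * C0)%:C *: inner x x
             - inner (S x) (S x) - inner (T x) (T x)).
  move=> Fx; have [Sx Tx TSx STx] := Fx; pose k := anticomm S T x.
  pose v := inner (S x) (T x) + inner (T x) (S x).
  have kx : inner k x = v by rewrite inner_anticomm //; [exact: addrC | exact: resolvable_sym..].
  have xk : inner x k = v.
    by rewrite -inner_star kx /v cstarD !inner_star addrC.
  have -> : inner (D x) (D x) = inner (S x) (S x) + inner (T x) (T x) + v.
    rewrite /= innerDl !innerDr /v.
    by rewrite [LHS](AC (2*2)%AC ((1*4)*(2*3))%AC).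
  rewrite (@sum_estimate_identity _ a b C0 C1 C2 _ _ _ v (inner k k)).
  apply: cpositiveD; last by apply: cpositiveZ; [lra | exact: inner_ge0].
  apply: cpositiveD; last by apply: cpositiveZ; [lra | exact: inner_ge0].
  apply: cpositiveD; last by apply: cpositiveZ => //; exact: bd.
  have -> : (a ^+ 2)%:C *: inner x x + (v + v) + (b ^+ 2)%:C *: inner k k =
      inner (a%:C *: x + b%:C *: k) (a%:C *: x + b%:C *: k).
    by rewrite inner_combination kx xk ab !scale1r.
  exact: inner_ge0.
move=> x [Sx Tx]; have hS := op_reg_tends W Sx; have hT := anticomm_op_reg_tends W Sx Tx.
apply: (cpositive_closed _ (fun n => key _ (reg_comm_dom W n Tx))).
have hx := reg_tends W x; apply: tendsB; last exact: tends_inner_sqr.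
apply: tendsB; last exact: tends_inner_sqr.
apply: tendsD; apply: tendsZ; apply: tends_inner_sqr => //; exact: tendsD.
Qed.

Lemma sum_estimatel : exists2 c : R, 0 < c & forall x, dom D x ->
  cle (inner (S x) (S x)) ((2 : R)%:C *: inner (D x) (D x) + c%:C *: inner x x) /\
  cle (inner (T x) (T x)) ((2 : R)%:C *: inner (D x) (D x) + c%:C *: inner x x).
Proof.
have [c c0 h] := sum_estimate; exists c => // x Dx; rewrite /cle; split.
  by have := cpositiveD (h x Dx) (inner_ge0 (T x)); rewrite subrK.
by have := cpositiveD (h x Dx) (inner_ge0 (S x)); rewrite addrAC subrK.
Qed.

Lemma sum_estimate_norm : exists2 c : R, 0 < c & forall x, dom D x ->
  nrm (S x) <= c * (nrm (D x) + nrm x) /\ nrm (T x) <= c * (nrm (D x) + nrm x).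
Proof.
have [c c0 h] := sum_estimatel; exists (2 + c); first by lra.
have main x (z : E) : cle (inner z z) ((2 : R)%:C *: inner (D x) (D x) + c%:C *: inner x x) ->
    nrm z <= (2 + c) * (nrm (D x) + nrm x).
  move=> le_z; have h1 := cpositive_nrm_le (inner_ge0 z) le_z.
  rewrite addrC subrK nrm_sqr_inner in h1.
  have h2 := le_trans h1 (nrmD _ _); rewrite !nrmZr !nrm_sqr_inner !gtr0_norm // in h2.
  have d0 := nrm_ge0 (D x); have x0 := nrm_ge0 x.
  rewrite -(@ler_pXn2r _ 2) ?nnegrE ?nrm_ge0 //; last by rewrite mulr_ge0 //; lra.
  apply: (le_trans h2); set d := nrm (D x) in d0 *; set e := nrm x in x0 *.
  have de := mulr_ge0 d0 x0; have cde := mulr_ge0 (ltW c0) de.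
  have f1 := mulr_ge0 (ltW c0) (sqr_ge0 d); have f2 := mulr_ge0 (ltW c0) (sqr_ge0 e).
  have f3 := mulr_ge0 (sqr_ge0 c) (sqr_ge0 (d + e)).
  have f4 := sqr_ge0 d; have f5 := sqr_ge0 e.
  lra.
by move=> x Dx; have [h1 h2] := h x Dx; split; exact: main.
Qed.

Lemma sum_symmetric : symmetric_op D.
Proof.
move=> x y [Sx Tx] [Sy Ty].
by rewrite /= innerDl innerDr (resolvable_sym gS Sx Sy) (resolvable_sym gT Tx Ty).
Qed.

(** Graph convergence for the sum forces convergence of both summands separately, so closedness is
    inherited from them. *)
Lemma sum_closed : closed_op D.
Proof.
have [c c0 h] := sum_estimate_norm.
move=> u x y du ux Duy.
have z0 : tends_cauchy (fun=> 0 : E) by exact: tends_is_cauchy (tends_cst 0).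
have cau (A : operator E) : (forall z, dom D z ->
  dom A z /\ nrm (A z) <= c * (nrm (D z) + nrm z)) ->
    tends_cauchy (fun n => A (u n)).
  move=> hA; apply: (cauchy_dom3 (tends_is_cauchy Duy) (tends_is_cauchy ux) z0 (a := c)) => i j.
  rewrite subrr nrm0 addr0.
  have [[Ai _] [Aj _]] := (hA _ (du i), hA _ (du j)).
  by rewrite -(opB Ai Aj) -(opB (du i) (du j)); case: (hA _ (domB (du i) (du j))).
have [|p Sp] := @cauchy_tends _ _ (fun n => S (u n)).
  by apply: cau => z dz; have [? _] := h z dz; case: dz.
have [|q Tq] := @cauchy_tends _ _ (fun n => T (u n)).
  by apply: cau => z dz; have [_ ?] := h z dz; case: dz.
have [Sx SxE] := resolvable_closed gS (fun n => (du n).1) ux Sp.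
have [Tx TxE] := resolvable_closed gT (fun n => (du n).2) ux Tq.
split; first by split.
by rewrite /= SxE TxE; exact: tends_unique (tendsD Sp Tq) Duy.
Qed.

Lemma sum_dense : dense (dom D).
Proof.
apply/denseP => x t t0.
have [|y Ty xy] := (denseP _).1 (resolvable_dense gT) x (t / 2); first by rewrite divr_gt0.
have [|N /(_ N (leqnn N)) HN] := (tendsP _ _).1 (reg_tends W y) (t / 2);
  first by rewrite divr_gt0.
have [Sr Tr _ _] := reg_comm_dom W N Ty.
exists (regularize S L N y); first by split.
rewrite nrm_distC in HN; rewrite -(subrKA y); apply: (le_lt_trans (nrmD _ _)); lra.
Qed.

Lemma sum_resolvable : resolvable D.
Proof.
pose k := 1 + `|4 * sum_const C|.
have k0 : 0 < k by have := normr_ge0 (4 * sum_const C); rewrite /k; lra.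
have onto m : `|m| = k -> onto_shift D (im m).
  move=> mk; have m0 : m != 0 by rewrite -normr_gt0 mk.
  apply: (@onto_of_residual _ _ _ _ _ (3 / 4)) => //.
  - exact: sum_symmetric.
  - exact: sum_closed.
  - by lra.
  move=> y; apply: (sum_residual W) => //.
  by rewrite mk /k; have := ler_norm (4 * sum_const C); lra.
apply: (@resolvable_of_onto _ _ _ _ k) => //.
- exact: sum_symmetric.
- exact: sum_closed.
- exact: sum_dense.
- by apply: onto; rewrite gtr0_norm.
- by apply: onto; rewrite normrN gtr0_norm.
Qed.

End SumEstimate.

(** * The sum of three operators *)

Section OrderOnCStarAlgebra.
Context {R : realType} {B : cstarAlgType R}.
Implicit Types (a b c d : B).

Lemma cle_refl a : cle a a.
Proof. by rewrite /cle subrr; exists 0; rewrite cmul0r. Qed.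

Lemma cle_trans b a c : cle a b -> cle b c -> cle a c.
Proof. by move=> ab bc; rewrite /cle -(subrKA b); exact: cpositiveD. Qed.

Lemma cleD a b c d : cle a b -> cle c d -> cle (a + c) (b + d).
Proof. by move=> ab cd; rewrite /cle opprD addrACA; exact: cpositiveD. Qed.

Lemma cleZ (t : R) a b : 0 <= t -> cle a b -> cle (t%:C *: a) (t%:C *: b).
Proof. by move=> t0 ab; rewrite /cle -scalerBr; exact: cpositiveZ. Qed.

End OrderOnCStarAlgebra.

Section SumOfThree.
Context {R : realType} {B : cstarAlgType R} {E : hilbertModType B}.
Implicit Types (S T : operator E) (x y : E).

(** Brings two pairs to a common threshold, so that one regularization by resolvents of [S3] serves
    both [S1] and [S2]. *)
Lemma anticommuting_weaken S T (C C' L L' : R) : anticommuting S T C L -> C <= C' ->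
  L <= L' -> 2 * C' <= L' ->
  norm_bound S T C' -> anticommuting S T C' L'.
Proof.
move=> W CC LL CL b; have C0 := anticommuting_C0 W; have L1 := anticommuting_L1 W.
split=> //; [exact: anticommuting_resolvablel W | exact: anticommuting_resolvabler W | lra |
  lra |].
by move=> m x Lm Tx; apply: (anticommuting_dom W) => //; exact: le_trans Lm.
Qed.

Lemma inner_sqr_add_le (k l : E) :
  cle (inner (k + l) (k + l)) ((2 : R)%:C *: inner k k + (2 : R)%:C *: inner l l).
Proof.
rewrite /cle (_ : _ - _ = inner (k - l) (k - l)); first exact: inner_ge0.
rewrite rmorphD /= !scalerDl !scale1r !innerDl !innerDr !innerNl !innerNr opprK !opprD.
rewrite [LHS](AC ((2*2)*((1*1)*(1*1)))%AC (((1*5)*(3*8))*((2*6)*(7*4)))%AC) /= !subrr.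
by rewrite addr0 add0r.
Qed.

Variables S1 S2 S3 : operator E.
Variables (C1 L1 C2 L2 : R).
Hypotheses (W1 : anticommuting S3 S1 C1 L1) (W2 : anticommuting S3 S2 C2 L1).
Local Notation D := (op_add S1 S2).
Hypothesis gD : resolvable D.
Hypotheses (B1 : anticomm_bound S1 S3) (B2 : anticomm_bound S2 S3).
Variable c : R.
Hypothesis c0 : 0 < c.
Hypothesis est : forall x, dom D x ->
  cle (inner (S1 x) (S1 x)) ((2 : R)%:C *: inner (D x) (D x) + c%:C *: inner x x) /\
  cle (inner (S2 x) (S2 x)) ((2 : R)%:C *: inner (D x) (D x) + c%:C *: inner x x).

Let g3 := anticommuting_resolvablel W1.

Lemma sum_comm_dom m x : L1 <= `|m| -> dom D x -> comm_dom S3 D (resolvent S3 m x).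
Proof.
move=> Lm [x1 x2]; have [a1 a2 a3 a4] := anticommuting_dom W1 Lm x1.
have [b1 b2 b3 b4] := anticommuting_dom W2 Lm x2.
by split=> //=; exact: domD.
Qed.

Local Notation r := (regularize S3 L1).

Lemma sum_dom_dense : dense (dom D `&` dom S3).
Proof.
apply/denseP => x t t0.
have [|y Dy xy] := (denseP _).1 (resolvable_dense gD) x (t / 2); first by rewrite divr_gt0.
have [|N /(_ N (leqnn N)) HN] := (tendsP _ _).1 (reg_tends W1 y) (t / 2);
  first by rewrite divr_gt0.
have [_ r1 _ _] := reg_comm_dom W1 N Dy.1; have [r3 r2 _ _] := reg_comm_dom W2 N Dy.2.
exists (r N y); first by split.
by rewrite nrm_distC in HN; rewrite -(subrKA y); apply: (le_lt_trans (nrmD _ _)); lra.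
Qed.

(* [[D, S3] x] is the limit of [[S1, S3] x_n + [S2, S3] x_n] along regularized
   [x_n], as is seen weakly, by pairing with the dense [dom D `&` dom S3]. *)
Lemma sum_anticomm_limit x : comm_dom D S3 x -> exists k1 k2,
  [/\ tends (fun n => anticomm S1 S3 (r n x)) k1, tends (fun n => anticomm S2 S3 (r n x)) k2 &
      anticomm D S3 x = k1 + k2].
Proof.
move=> Fx; have [[x1 x2] x3 _ _] := Fx.
have [k1 h1] := anticomm_reg_cvg W1 x3 x1; have [k2 h2] := anticomm_reg_cvg W2 x3 x2.
have {}h1 : tends (fun n => anticomm S1 S3 (r n x)) k1.
  by apply: tends_eq h1 => n; exact: anticommC.
have {}h2 : tends (fun n => anticomm S2 S3 (r n x)) k2.
  by apply: tends_eq h2 => n; exact: anticommC.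
exists k1, k2; split=> //; apply/eqP; rewrite -subr_eq0; apply/eqP.
apply: (inner_dense_eq0 sum_dom_dense) => z [[z1 z2] z3].
rewrite innerDl innerNl (inner_anticomm (resolvable_sym gD) (resolvable_sym g3) Fx) //.
have t3 := op_reg_tends W1 x3.
have t1 := anticomm_op_reg_tends W1 x3 x1; have t2 := anticomm_op_reg_tends W2 x3 x2.
apply/eqP; rewrite subr_eq0; apply/eqP.
have lim1 := tends_innerl z (tendsD h1 h2).
have lim2 := tendsD (tends_innerl (D z) t3) (tends_innerl (S3 z) (tendsD t1 t2)).
apply: (tends_unique lim2); apply: tends_eq lim1 => n.
have F1 := comm_domC (reg_comm_dom W1 n x1); have F2 := comm_domC (reg_comm_dom W2 n x2).
rewrite innerDl (inner_anticomm (resolvable_sym (anticommuting_resolvabler W1))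
  (resolvable_sym g3) F1) //.
rewrite (inner_anticomm (resolvable_sym (anticommuting_resolvabler W2)) (resolvable_sym g3)
  F2) //.
by rewrite addrACA -innerDr -innerDl.
Qed.

(** A point of [comm_dom D S3] may fail to lie in [comm_dom S S3] for a single summand [S]; the
    bound is therefore taken at the regularized vectors and passed to the limit [k]. *)
Lemma anticomm_bound_limit S (C : R) (a0 a1 a2 : R) x k : anticommuting S3 S C L1 ->
  (forall y, comm_dom S S3 y -> cle (inner (anticomm S S3 y) (anticomm S S3 y))
     (a0%:C *: inner y y + a1%:C *: inner (S y) (S y) + a2%:C *: inner (S3 y) (S3 y))) ->
  dom S x -> dom S3 x -> tends (fun n => anticomm S S3 (r n x)) k ->
  cle (inner k k)
    (a0%:C *: inner x x + a1%:C *: inner (S x) (S x) + a2%:C *: inner (S3 x) (S3 x)).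
Proof.
move=> W b Sx x3 hk.
apply: (cpositive_closed _ (fun n => b _ (comm_domC (reg_comm_dom W n Sx)))).
apply: tendsB; last exact: tends_inner_sqr.
apply: tendsD; last by apply: tendsZ; apply: tends_inner_sqr; exact: (op_reg_tends W x3).
apply: tendsD; first by apply: tendsZ; apply: tends_inner_sqr; exact: (reg_tends W x).
by apply: tendsZ; apply: tends_inner_sqr; exact: (anticomm_op_reg_tends W x3 Sx).
Qed.

Lemma sum_anticomm_bound : anticomm_bound D S3.
Proof.
case: B1 => a0 [a1 [a2 [pa0 pa1 pa2 ba]]]; case: B2 => b0 [b1 [b2 [pb0 pb1 pb2 bb]]].
(* The factor 2 comes from [inner_sqr_add_le]; replacing the squares of S1 x and S2 x through [est]
   doubles the middle constant and adds the part with [c] to the first. *)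
exists (2 * (a0 + b0) + 2 * (a1 + b1) * c), (4 * (a1 + b1)), (2 * (a2 + b2)).
have p1 : 0 < (a1 + b1) * c by rewrite mulr_gt0 //; lra.
split; try lra.
move=> x Fx; have [k1 [k2 [h1 h2 ->]]] := sum_anticomm_limit Fx.
have [[x1 x2] x3 _ _] := Fx; have [e1 e2] := est (conj x1 x2).
have l1 := anticomm_bound_limit W1 ba x1 x3 h1.
have l2 := anticomm_bound_limit W2 bb x2 x3 h2.
set d := inner (D x) (D x) in e1 e2 *; set p := inner x x in e1 e2 l1 l2 *.
set s := inner (S3 x) (S3 x) in l1 l2 *.
have {}l1 := cle_trans l1 (cleD (cleD (cle_refl _) (cleZ (ltW pa1) e1)) (cle_refl _)).
have {}l2 := cle_trans l2 (cleD (cleD (cle_refl _) (cleZ (ltW pb1) e2)) (cle_refl _)).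
have two : (0 : R) <= 2 by [].
have := cle_trans (inner_sqr_add_le k1 k2) (cleD (cleZ two l1) (cleZ two l2)).
congr cle; rewrite !scalerDr !scalerA -!rmorphM /=.
rewrite [LHS](AC ((1*2*1)*(1*2*1))%AC (((1*5)*(3*7))*(2*6)*(4*8))%AC) /=.
rewrite -!scalerDl -!rmorphD /=; congr (_%:C *: _ + _%:C *: _ + _%:C *: _); ring.
Qed.

End SumOfThree.

Theorem theorem5p4 (R : realType) (B : cstarAlgType R) (E : hilbertModType B)
    (S1 S2 S3 : operator E) :
  self_adjoint_regular S1 -> self_adjoint_regular S2 ->
  self_adjoint_regular S3 ->
  weakly_anticommuting S1 S2 -> weakly_anticommuting S2 S3 ->
  weakly_anticommuting S1 S3 ->
  weakly_anticommuting (op_add S1 S2) S3 /\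
  self_adjoint_regular (op_add (op_add S1 S2) S3).
Proof.
move=> _ _ sar3 w12 w23 w13.
have [C12 [L12 W12]] := weakly_anticommuting_resolvent w12.
have [C13 [L13 /anticommuting_sym W31]] := weakly_anticommuting_resolvent w13.
have [C23 [L23 /anticommuting_sym W32]] := weakly_anticommuting_resolvent w23.
set L31 := (_ + _) in W31; set L32 := (_ + _) in W32.
have [[_ _ B12 _] [_ _ B13 _] [_ _ B23 _]] := And3 w12 w13 w23.
have gD := sum_resolvable W12 B12.
have [c c0 est] := sum_estimatel W12 B12.
pose D := op_add S1 S2.
have [q1 q2 q3 q4] : [/\ 1 <= L31, 1 <= L32, 2 * C13 <= L31 & 2 * C23 <= L32].
  by split; [exact: anticommuting_L1 W31 | exact: anticommuting_L1 W32 | exact: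
    anticommuting_LC W31 | exact: anticommuting_LC W32].
pose L := L31 + L32.
have {}W31 : anticommuting S3 S1 C13 L.
  by apply: (anticommuting_weaken W31 (lexx _)); rewrite /L;
    [lra | lra | exact: anticommuting_bound W31].
have {}W32 : anticommuting S3 S2 C23 L.
  by apply: (anticommuting_weaken W32 (lexx _)); rewrite /L;
    [lra | lra | exact: anticommuting_bound W32].
have BD : anticomm_bound D S3 := sum_anticomm_bound W31 W32 gD B13 B23 c0 est.
have [C C0 bC] := anticomm_bound_norm BD.
have W3D : anticommuting S3 D C (L + 2 * C).
  split=> //; try (rewrite /L; lra).
  - exact: anticommuting_resolvablel W31.
  - exact: norm_boundC.
  - move=> m x Lm; apply: (sum_comm_dom W31 W32); apply: le_trans Lm; lra.
have WD3 := anticommuting_sym W3D.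
split; last exact/self_adjoint_regular_of_resolvable/(sum_resolvable WD3 BD).
split=> //; first exact: self_adjoint_regular_of_resolvable.
set l0 : R := _ + _ in WD3; have l1 := anticommuting_L1 WD3.
(* The domain of [S3] is its own core, as [anticommuting_dom] covers all of it. *)
exists (dom S3), l0; split; [|lra|].
  split=> //; first exact: dom_submodule.
  move=> x x3 e e0; exists x => //.
  by rewrite /graph_norm subrr op0 inner0l addr0 normr0 sqrtC0.
move=> l lre l0l x [Dx x3].
have lE : l = im (complex.Im l) by case: (l) lre => u v /= ->.
have l0m : l0 <= `|complex.Im l|.
  by move: l0l; rewrite lE normc_def /= expr0n /= add0r sqrtr_sqr lecR.
have m0 : complex.Im l != 0 by rewrite -normr_gt0; lra.
rewrite lE in x3.
have := anticommuting_dom WD3 l0m x3.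
by rewrite resolvent_shift.
Qed.
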